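(* Let $(M,F)$ be an arbitrary (sufficiently smooth) Finsler space of dimension $N\ge 3$, $H=H(x)$ an arbitrary smooth positive function with $H_i=\partial H/\partial x^i$, and $N^k{}_i(x,y)$ smooth coefficients, positively homogeneous of degree 1 in $y$. Suppose that the geodesic-arc angle $\alpha=\alpha_{\{x\}}(y_1,y_2)$ satisfies $$\frac{\partial\alpha}{\partial x^i}+N^k{}_i(x,y_1)\frac{\partial\alpha}{\partial y_1^k}+N^k{}_i(x,y_2)\frac{\partial\alpha}{\partial y_2^k}+\frac1HH_i\alpha=0$$ and that $d_iF=0$, where $d_i=\frac{\partial}{\partial x^i}+N^k{}_i\frac{\partial}{\partial y^k}$. Put $$T^k{}_{im}=-N^k{}_{im}-\frac1HH_ih^k_m,\qquad N^k{}_{im}=\frac{\partial N^k{}_i}{\partial y^m}.$$ Then $T^k{}_{im}y^m=-N^k{}_i$, and the covariant derivative $\mathcal T_i$ given by $$\mathcal T_iF=d_iF,\quad \mathcal T_il_m=d_il_m-T^h{}_{im}l_h,\quad \mathcal T_il^m=d_il^m+T^m{}_{ih}l^h,\quad \mathcal T_ig_{nm}=d_ig_{nm}-T^h{}_{im}g_{hn}-T^h{}_{in}g_{hm}$$ satisfies $$\mathcal T_iF=0,\qquad \mathcal T_il_m=0,\qquad \mathcal T_il^m=0,\qquad \mathcal T_ig_{nm}=0 .$$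
   Context: $g_{ij}=\frac12\partial^2F^2/\partial y^i\partial y^j$, $l^i=y^i/F$, $l_i=\partial F/\partial y^i$, $h^k_m=\delta^k_m-l^kl_m$. The indicatrix $\mathcal I_x=\{y\in T_xM:F(x,y)=1\}$ carries the Riemannian metric induced from $g_{ij}(x,y)dy^idy^j$ ($x$ fixed); the geodesic-arc angle $\alpha_{\{x\}}(y_1,y_2)$ of nonzero $y_1,y_2\in T_xM$ is the length of the Riemannian geodesic arc on $\mathcal I_x$ joining $y_1/F(x,y_1)$ and $y_2/F(x,y_2)$ (local considerations; the equation for $\alpha$ is required for all pairs with distinct directions for which the joining arc is well defined). *)

(* Defs.v *)
From HB Require Import structures.
From mathcomp Require Import all_boot all_order all_algebra.
From mathcomp Require Import all_classical all_reals all_analysis.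
Set Implicit Arguments.
Unset Strict Implicit.
Unset Printing Implicit Defensive.
Import Order.TTheory GRing.Theory Num.Theory numFieldNormedType.Exports.
Local Open Scope classical_set_scope.
Local Open Scope ring_scope.

(* Everything is written in a chart: points x range over an open U of R^n,    *)
(* tangent vectors y over R^n, and a function on TM is a curried function     *)
(* 'rV[R]_n -> 'rV[R]_n -> R of (x, y). Tensor indices precede (x, y), upper  *)
(* ones first: N k i x y is N^k_i(x, y).                                      *)

Definition pd (R : realType) (n : nat) (i : 'I_n) (f : 'rV[R]_n -> R)
    (x : 'rV[R]_n) : R :=
  'D_(delta_mx 0 i : 'rV[R]_n) f x.

Fixpoint Ck (R : realType) (V : normedModType R) (k : nat) (D : set V)
    (f : V -> R) : Prop :=
  if k is k'.+1 then
    (forall z, D z -> differentiable f z) /\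
    (forall v : V, Ck k' D (fun z => 'D_v f z))
  else forall z, D z -> {for z, continuous f}.

(* C^infinity on the open set D *)
Definition smooth_on (R : realType) (V : normedModType R) (D : set V)
    (f : V -> R) : Prop :=
  forall k, Ck k D f.

Definition slit (R : realType) (n : nat) (U : set 'rV[R]_n) :
    set ('rV[R]_n * 'rV[R]_n) :=
  [set z | U z.1 /\ z.2 != 0].

Definition g (R : realType) (n : nat) (F : 'rV[R]_n -> 'rV[R]_n -> R)
    (i j : 'I_n) (x y : 'rV[R]_n) : R :=
  2^-1 * pd i (pd j (fun z => F x z ^+ 2)) y.

Definition lup (R : realType) (n : nat) (F : 'rV[R]_n -> 'rV[R]_n -> R)
    (i : 'I_n) (x y : 'rV[R]_n) : R :=
  y 0 i / F x y.

Definition llow (R : realType) (n : nat) (F : 'rV[R]_n -> 'rV[R]_n -> R)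
    (i : 'I_n) (x y : 'rV[R]_n) : R :=
  pd i (F x) y.

Definition h (R : realType) (n : nat) (F : 'rV[R]_n -> 'rV[R]_n -> R)
    (k m : 'I_n) (x y : 'rV[R]_n) : R :=
  (k == m)%:R - lup F k x y * llow F m x y.

(* Homogeneity is also asked at y = 0, which amounts to F x 0 = 0. *)
Record finsler (R : realType) (n : nat) (U : set 'rV[R]_n)
    (F : 'rV[R]_n -> 'rV[R]_n -> R) : Prop := Finsler {
  finsler_smooth : smooth_on (slit U) (fun z => F z.1 z.2);
  finsler_gt0 : forall x y, U x -> y != 0 -> 0 < F x y;
  finsler_homo : forall x y (a : R), U x -> 0 < a -> F x (a *: y) = a * F x y;
  finsler_posdef : forall x y (v : 'rV[R]_n), U x -> y != 0 -> v != 0 ->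
    0 < \sum_i \sum_j g F i j x y * v 0 i * v 0 j }.

Definition indicatrix (R : realType) (n : nat)
    (F : 'rV[R]_n -> 'rV[R]_n -> R) (x : 'rV[R]_n) : set 'rV[R]_n :=
  [set y | F x y = 1].

(* Christoffel symbols of the Riemannian metric g_ij(x, y) dy^i dy^j on       *)
(* T_xM \ {0}, for x fixed.                                                   *)
Definition christoffel (R : realType) (n : nat)
    (F : 'rV[R]_n -> 'rV[R]_n -> R) (k i j : 'I_n) (x y : 'rV[R]_n) : R :=
  2^-1 * \sum_l invmx (\matrix_(a, b) g F a b x y) k l *
    (pd i (g F j l x) y + pd j (g F i l x) y - pd l (g F i j x) y).

Definition velocity (R : realType) (n : nat) (c : R -> 'rV[R]_n) (t : R) :
    'rV[R]_n :=
  'D_1 c t.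

(* Covariant acceleration of a curve in T_xM \ {0}. *)
Definition acceleration (R : realType) (n : nat)
    (F : 'rV[R]_n -> 'rV[R]_n -> R) (x : 'rV[R]_n) (c : R -> 'rV[R]_n) (t : R)
    : 'rV[R]_n :=
  \row_k (velocity (velocity c) t 0 k +
    \sum_i \sum_j christoffel F k i j x (c t) *
      velocity c t 0 i * velocity c t 0 j).

(* Geodesics of the Riemannian submanifold I_x of (T_xM \ {0}, g): the        *)
(* Levi-Civita connection of the induced metric is the tangential part of the *)
(* ambient one, so the covariant acceleration must be g-orthogonal to         *)
(* T_y I_x = {w | l_m w^m = 0}. The speed of a geodesic is constant, so       *)
(* continuity at the two ends of [0, 1] is enough for smoothness there.       *)
Definition geodesic_arc (R : realType) (n : nat)
    (F : 'rV[R]_n -> 'rV[R]_n -> R) (x p q : 'rV[R]_n) (c : R -> 'rV[R]_n)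
    : Prop :=
  [/\ c 0 = p /\ c 1 = q,
      {within `[0, 1], continuous c},
      forall t : R, t \in `[0, 1] -> indicatrix F x (c t),
      forall t : R, t \in `]0, 1[ ->
        derivable c t 1 /\ derivable (velocity c) t 1
    & forall (t : R) (w : 'rV[R]_n), t \in `]0, 1[ ->
        \sum_m llow F m x (c t) * w 0 m = 0 ->
        \sum_k \sum_m g F k m x (c t) * acceleration F x c t 0 k * w 0 m = 0].

Definition arc_length (R : realType) (n : nat)
    (F : 'rV[R]_n -> 'rV[R]_n -> R) (x : 'rV[R]_n) (c : R -> 'rV[R]_n) : R :=
  (\int[lebesgue_measure]_(t in `]0, 1[)
    Num.sqrt (\sum_i \sum_j g F i j x (c t) *
                velocity c t 0 i * velocity c t 0 j))%R.

(* Two points of I_x are in general joined by many geodesics (e.g. the two    *)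
(* arcs of a great circle); the joining arc is the shortest one.              *)
Definition shortest_arc (R : realType) (n : nat)
    (F : 'rV[R]_n -> 'rV[R]_n -> R) (x p q : 'rV[R]_n) (c : R -> 'rV[R]_n)
    : Prop :=
  geodesic_arc F x p q c /\
  forall c', geodesic_arc F x p q c' -> arc_length F x c <= arc_length F x c'.

Definition direction (R : realType) (n : nat)
    (F : 'rV[R]_n -> 'rV[R]_n -> R) (x y : 'rV[R]_n) : 'rV[R]_n :=
  (F x y)^-1 *: y.

Definition joining_arc_well_defined (R : realType) (n : nat)
    (F : 'rV[R]_n -> 'rV[R]_n -> R) (x y1 y2 : 'rV[R]_n) : Prop :=
  exists c, shortest_arc F x (direction F x y1) (direction F x y2) c /\
    forall c', shortest_arc F x (direction F x y1) (direction F x y2) c' ->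
      forall t : R, t \in `[0, 1] -> c' t = c t.

(* All shortest arcs have the same length, so [set L | ...] has at most one   *)
(* element; 0 is a dummy value when there is no arc.                          *)
Definition angle (R : realType) (n : nat)
    (F : 'rV[R]_n -> 'rV[R]_n -> R) (x y1 y2 : 'rV[R]_n) : R :=
  xget 0 [set L | exists c,
    shortest_arc F x (direction F x y1) (direction F x y2) c /\
    L = arc_length F x c].

(* The operator d_i = d/dx^i + N^k_i d/dy^k. *)
Definition dN (R : realType) (n : nat)
    (N : 'I_n -> 'I_n -> 'rV[R]_n -> 'rV[R]_n -> R) (i : 'I_n)
    (f : 'rV[R]_n -> 'rV[R]_n -> R) (x y : 'rV[R]_n) : R :=
  pd i (fun z => f z y) x + \sum_k N k i x y * pd k (f x) y.

Definition angle_equation (R : realType) (n : nat)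
    (F : 'rV[R]_n -> 'rV[R]_n -> R) (H : 'rV[R]_n -> R)
    (N : 'I_n -> 'I_n -> 'rV[R]_n -> 'rV[R]_n -> R) (i : 'I_n)
    (x y1 y2 : 'rV[R]_n) : Prop :=
  pd i (fun z => angle F z y1 y2) x
  + \sum_k N k i x y1 * pd k (fun z => angle F x z y2) y1
  + \sum_k N k i x y2 * pd k (fun z => angle F x y1 z) y2
  + (H x)^-1 * pd i H x * angle F x y1 y2 = 0.

Definition T (R : realType) (n : nat)
    (F : 'rV[R]_n -> 'rV[R]_n -> R) (H : 'rV[R]_n -> R)
    (N : 'I_n -> 'I_n -> 'rV[R]_n -> 'rV[R]_n -> R)
    (k i m : 'I_n) (x y : 'rV[R]_n) : R :=
  - pd m (N k i x) y - (H x)^-1 * pd i H x * h F k m x y.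

Definition cov_F (R : realType) (n : nat)
    (F : 'rV[R]_n -> 'rV[R]_n -> R)
    (N : 'I_n -> 'I_n -> 'rV[R]_n -> 'rV[R]_n -> R)
    (i : 'I_n) (x y : 'rV[R]_n) : R :=
  dN N i F x y.

Definition cov_llow (R : realType) (n : nat)
    (F : 'rV[R]_n -> 'rV[R]_n -> R) (H : 'rV[R]_n -> R)
    (N : 'I_n -> 'I_n -> 'rV[R]_n -> 'rV[R]_n -> R)
    (i m : 'I_n) (x y : 'rV[R]_n) : R :=
  dN N i (llow F m) x y - \sum_a T F H N a i m x y * llow F a x y.

Definition cov_lup (R : realType) (n : nat)
    (F : 'rV[R]_n -> 'rV[R]_n -> R) (H : 'rV[R]_n -> R)
    (N : 'I_n -> 'I_n -> 'rV[R]_n -> 'rV[R]_n -> R)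
    (i m : 'I_n) (x y : 'rV[R]_n) : R :=
  dN N i (lup F m) x y + \sum_a T F H N m i a x y * lup F a x y.

Definition cov_g (R : realType) (n : nat)
    (F : 'rV[R]_n -> 'rV[R]_n -> R) (H : 'rV[R]_n -> R)
    (N : 'I_n -> 'I_n -> 'rV[R]_n -> 'rV[R]_n -> R)
    (i j m : 'I_n) (x y : 'rV[R]_n) : R :=
  dN N i (g F j m) x y
  - \sum_a T F H N a i m x y * g F a j x y
  - \sum_a T F H N a i j x y * g F a m x y.

(* Main.v *)
Require Import Defs.
From HB Require Import structures.
From mathcomp Require Import all_boot all_order all_algebra.
From mathcomp Require Import all_classical all_reals all_analysis.
From mathcomp Require Import ring lra.
Set Implicit Arguments.
Unset Strict Implicit.
Unset Printing Implicit Defensive.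
Import Order.TTheory GRing.Theory Num.Theory numFieldNormedType.Exports.
Local Open Scope classical_set_scope.
Local Open Scope ring_scope.

(** The angle equation is used only for nearly parallel arguments. Put
    A_e(x, y, v) = alpha_x(y, y + e v)^2 / e^2. As e tends to 0 this tends to
    the angular metric Q(x, y, v) = (g(v, v) - l(v)^2) / F^2, the pull-back of
    the metric of the indicatrix by the projection y / F. Dividing the angle
    equation at (y, y + e v) by e^2 and letting e tend to 0 should give

      d_i Q + (derivative of Q along v |-> v^m N^k_im) + 2 (H_i / H) Q = 0,

    the transport equation [angular_transport]. Since d_i F = 0 forces
    d_i l_m = - N^a_im l_a [dN_llow], the left-hand side is F^-2 times the
    quadratic form of T_i g_nm [angular_lieE]. Hence this form vanishes at
    every v that is not a multiple of y, then at all v by the parallelogram law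
    [quad_vanishes], and the symmetric tensor T_i g_nm is zero by polarization.
    The remaining identities follow from d_i F = 0, the homogeneity of F and N,
    and the fact that h annihilates y and l.

    Two points need analysis. The first is the uniform estimate
    |A_e - Q| <= C e near a given (x, y, v) [angle_expansion], which includes
    the existence and uniqueness of the shortest arc between close points of
    the indicatrix. A geodesic of the indicatrix solves
    c'' = - g(c', c') c - Gamma(c', c'), an equation that is quadratic in the
    velocity. Between points at distance d the boundary value problem is solved
    by a contraction acting on the acceleration [spray_bvp_exists], and slow
    solutions are unique [spray_bvp_unique]. A solution with ends on the
    indicatrix remains there [spray_stays], so it is a geodesic, and any
    geodesic that is not longer has constant speed of order d, stays close and
    coincides with it [small_arc]. Its squared length is
    g_p(q - p, q - p) + O(d^3).

    The second is the passage to the limit: the derivatives of A_e are not known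
    to converge. At a minimum of A_e - Q + |z - z0|^2 over a small ball about
    z0 = (x, y, v) they agree with those of Q up to the small gradient of the
    penalty, and the minimum is interior and tends to z0 because A_e is
    uniformly close to Q [touching]. The equation for A_e at these points
    becomes, in the limit, the transport equation for Q at z0. *)

(** * Algebra of smooth functions *)

(** Differentiability depends only on the germ of a function: the difference
    f' - f vanishes near z, so it is differentiable with differential 0. *)
Lemma differentiable_near_eq (R : realType) (V : normedModType R)
    (f f' : V -> R) (z : V) :
  (\near z, f z = f' z) -> differentiable f z -> differentiable f' z.
Proof.
move=> ff' df.
have -> : f' = f + (f' - f) by rewrite addrC subrK.
apply: differentiableD => //.
have h0 : (f' - f) \o shift z = cst ((f' - f) z) + (cst 0 : V -> R) +o_ 0 id.
  apply/eqaddoP => _/posnumP[e].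
  have : \forall y \near (0 : V), f (y + z) = f' (y + z).
    by move: ff'; rewrite (near_shift 0) /= subr0.
  apply: filterS => y fy /=.
  have ffz := nbhs_singleton ff'.
  rewrite [X in `|X|](_ : _ = (f' (y + z) - f (y + z)) - ((f' z - f z) + 0))//.
  by rewrite fy ffz !subrr addr0 subr0 normr0 mulr_ge0.
have c0 : continuous (cst 0 : V -> R) by exact: cst_continuous.
apply/diff_locallyP.
have -> : 'd (f' - f) z = \0 :> (V -> R).
  by apply: diff_unique => //=.
by split => //; exact: cst_continuous.
Qed.

Section SmoothAlgebra.
Variables (R : realType) (V : normedModType R) (D : set V).
Hypothesis Dopen : open D.
Implicit Types (f : V -> R) (k : nat).

Lemma near_open z (P : V -> Prop) : D z -> (forall y, D y -> P y) ->
  \near z, P z.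
Proof.
move=> Dz DP; have : nbhs z D by exact: open_nbhs_nbhs.
exact: filterS.
Qed.

Lemma Ck_ext k f (f' : V -> R) : (forall z, D z -> f z = f' z) -> Ck k D f -> Ck k D f'.
Proof.
elim: k f f' => [|k IH] f f' ff' /=.
  move=> fc z Dz; rewrite /prop_for /continuous_at -(ff' z Dz).
  apply: cvg_trans (fc z Dz); apply: near_eq_cvg.
  exact: near_open.
case=> df Df; split=> [z Dz|v].
  by apply: differentiable_near_eq (df z Dz); exact: near_open.
apply: IH (Df v) => z Dz /=; apply: near_eq_derive; exact: near_open.
Qed.

Lemma CkS k f : Ck k.+1 D f -> Ck k D f.
Proof.
elim: k f => [|k IH] f /=; first by case=> df _ z Dz; exact: differentiable_continuous (df z Dz).
by case=> df Df; split=> // v; apply: IH; exact: Df.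
Qed.

Lemma Ck_cst k (c : R) : Ck k D (fun=> c).
Proof.
elim: k c => [|k IH] c /=; first by move=> z _; exact: cst_continuous.
split=> [z _|v]; first exact: differentiable_cst.
by apply: Ck_ext (IH 0) => z _; rewrite derive_cst.
Qed.

Lemma CkD k f (f' : V -> R) : Ck k D f -> Ck k D f' -> Ck k D (fun z => f z + f' z).
Proof.
elim: k f f' => [|k IH] f f' /=.
  by move=> cf cf' z Dz; apply: cvgD; [exact: cf|exact: cf'].
move=> [df Df] [df' Df']; split=> [z Dz|v].
  by apply: differentiableD; [exact: df|exact: df'].
apply: Ck_ext (IH _ _ (Df v) (Df' v)) => z Dz.
by rewrite -deriveD//; apply: diff_derivable; [exact: df|exact: df'].
Qed.

Lemma CkM k f (f' : V -> R) : Ck k D f -> Ck k D f' -> Ck k D (fun z => f z * f' z).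
Proof.
elim: k f f' => [|k IH] f f'.
  by move=> cf cf' z Dz; apply: cvgM; [exact: cf|exact: cf'].
move=> cf cf'; have kf := CkS cf; have kf' := CkS cf'.
move: cf cf' => /= [df Df] [df' Df']; split=> [z Dz|v].
  by apply: differentiableM; [exact: df|exact: df'].
apply: Ck_ext (CkD (IH _ _ kf (Df' v)) (IH _ _ kf' (Df v))) => z Dz.
by rewrite -deriveM//; apply: diff_derivable; [exact: df|exact: df'].
Qed.

Lemma CkV k f : (forall z, D z -> f z != 0) -> Ck k D f ->
  Ck k D (fun z => (f z)^-1).
Proof.
move=> f0; elim: k => [|k IH].
  by move=> cf z Dz; apply: cvgV; [exact: f0|exact: cf].
move=> cf; have kf := IH (CkS cf).
move: cf => /= [df Df]; split=> [z Dz|v].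
  by apply: differentiableV; [exact: df|exact: f0].
have c1 := CkM (Ck_cst k (-1)) (CkM (CkM kf kf) (Df v)).
apply: Ck_ext c1 => z Dz.
rewrite deriveV; [|exact: f0|by apply: diff_derivable; exact: df].
by rewrite -exprVn expr2 mulN1r scaleNr.
Qed.

Lemma smooth_ext f (f' : V -> R) : (forall z, D z -> f z = f' z) -> smooth_on D f -> smooth_on D f'.
Proof. by move=> ff' sf k; exact: Ck_ext ff' (sf k). Qed.

Lemma smooth_cst (c : R) : smooth_on D (fun=> c).
Proof. by move=> k; exact: Ck_cst. Qed.

Lemma smoothD f (f' : V -> R) : smooth_on D f -> smooth_on D f' -> smooth_on D (fun z => f z + f' z).
Proof. by move=> sf sf' k; exact: CkD. Qed.

Lemma smoothM f (f' : V -> R) : smooth_on D f -> smooth_on D f' -> smooth_on D (fun z => f z * f' z).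
Proof. by move=> sf sf' k; exact: CkM. Qed.

Lemma smoothN f : smooth_on D f -> smooth_on D (fun z => - f z).
Proof.
move=> sf; apply: smooth_ext (smoothM (smooth_cst (-1)) sf) => z _.
by rewrite mulN1r.
Qed.

Lemma smoothB f (f' : V -> R) : smooth_on D f -> smooth_on D f' -> smooth_on D (fun z => f z - f' z).
Proof. by move=> sf sf'; apply: smoothD => //; exact: smoothN. Qed.

Lemma smoothV f : (forall z, D z -> f z != 0) -> smooth_on D f ->
  smooth_on D (fun z => (f z)^-1).
Proof. by move=> f0 sf k; exact: CkV. Qed.

Lemma smooth_exp2 f : smooth_on D f -> smooth_on D (fun z => f z ^+ 2).
Proof. by move=> sf; apply: smooth_ext (smoothM sf sf) => z _; rewrite expr2. Qed.

Lemma smooth_sum (I : Type) (r : seq I) (f : I -> V -> R) :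
  (forall i, smooth_on D (f i)) -> smooth_on D (fun z => \sum_(i <- r) f i z).
Proof.
move=> sf; elim: r => [|i r IH].
  by apply: smooth_ext (smooth_cst 0) => z _; rewrite big_nil.
by apply: smooth_ext (smoothD (sf i) IH) => z _; rewrite big_cons.
Qed.

Lemma smooth_prod (I : Type) (r : seq I) (f : I -> V -> R) :
  (forall i, smooth_on D (f i)) -> smooth_on D (fun z => \prod_(i <- r) f i z).
Proof.
move=> sf; elim: r => [|i r IH].
  by apply: smooth_ext (smooth_cst 1) => z _; rewrite big_nil.
by apply: smooth_ext (smoothM (sf i) IH) => z _; rewrite big_cons.
Qed.

Lemma smooth_det n (A : V -> 'M[R]_n) :
  (forall i j, smooth_on D (fun z => A z i j)) -> smooth_on D (fun z => \det (A z)).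
Proof.
move=> sA; rewrite /determinant.
apply: smooth_sum => s; apply: smoothM; first exact: smooth_cst.
exact: smooth_prod.
Qed.

(** By Cramer's rule the entries of the inverse are rational functions of the
    entries of A, with denominator the determinant. *)
Lemma smooth_invmx n (A : V -> 'M[R]_n) (i j : 'I_n) :
  (forall z, D z -> A z \in unitmx) ->
  (forall i j, smooth_on D (fun z => A z i j)) ->
  smooth_on D (fun z => invmx (A z) i j).
Proof.
move=> uA sA.
have sdet := smooth_det sA.
have sdetV : smooth_on D (fun z => (\det (A z))^-1).
  by apply: smoothV => // z /uA; rewrite unitmxE unitfE.
have scof : smooth_on D (fun z => \adj (A z) i j).
  have sd : smooth_on D (fun z => \det (row' j (col' i (A z)))).
    by apply: smooth_det => a b; apply: smooth_ext (sA (lift j a) (lift i b)) => z _; rewrite !mxE.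
  by apply: smooth_ext (smoothM (smooth_cst ((-1) ^+ (j + i))) sd) => z _; rewrite mxE.
apply: smooth_ext (smoothM sdetV scof) => z Dz.
by rewrite /invmx uA// [RHS]mxE.
Qed.

Lemma smooth_derive f (v : V) : smooth_on D f -> smooth_on D (fun z => 'D_v f z).
Proof. by move=> sf k; have /= [_] := sf k.+1; apply. Qed.

Lemma smooth_diff f z : smooth_on D f -> D z -> differentiable f z.
Proof. by move=> sf Dz; have /= [df _] := sf 1%N; exact: df. Qed.

Lemma smooth_cont f z : smooth_on D f -> D z -> {for z, continuous f}.
Proof. by move=> sf Dz; exact: sf 0%N _ Dz. Qed.

End SmoothAlgebra.

(** * Derivatives along lines and the symmetry of second derivatives *)

Lemma second_difference_rescale (R : realType) (h e A B : R) :
  `|A - B| <= e -> `|h * (h * B) - h ^+ 2 * A| <= e * h ^+ 2.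
Proof.
move=> AB; have -> : h * (h * B) - h ^+ 2 * A = (B - A) * h ^+ 2 by ring.
by rewrite normrM (ger0_norm (sqr_ge0 h)) ler_wpM2r ?sqr_ge0// distrC.
Qed.

Lemma second_difference_unique (R : realType) (h e S A B : R) : 0 < h ->
  `|S - h ^+ 2 * A| <= e / 2 * h ^+ 2 -> `|S - h ^+ 2 * B| <= e / 2 * h ^+ 2 ->
  `|A - B| <= e.
Proof.
move=> h0 SA SB; have hh0 : 0 < h ^+ 2 by rewrite exprn_gt0.
rewrite -(ler_pM2l hh0) -{1}(ger0_norm (ltW hh0)) -normrM mulrBr.
by move: SA SB; rewrite !ler_norml; lra.
Qed.

Section Lines.
Variables (R : realType) (V : normedModType R).
Implicit Types (f : V -> R) (z u v w : V).

Lemma deriveZv f z (a : R) v : differentiable f z -> 'D_(a *: v) f z = a * 'D_v f z.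
Proof. by move=> df; rewrite !deriveE// linearZ. Qed.

Lemma deriveDv f z v w : differentiable f z -> 'D_(v + w) f z = 'D_v f z + 'D_w f z.
Proof. by move=> df; rewrite !deriveE// linearD. Qed.

Lemma derive_sumv f z (I : finType) (v : I -> V) : differentiable f z ->
  'D_(\sum_i v i) f z = \sum_i 'D_(v i) f z.
Proof.
move=> df; rewrite deriveE// linear_sum; apply: eq_bigr => i _.
by rewrite deriveE.
Qed.

Lemma chain_rule (c : R -> V) f t : derivable c t 1 -> differentiable f (c t) ->
  is_derive t 1 (fun s => f (c s)) ('D_('D_1 c t) f (c t)).
Proof.
move=> /derivable1_diffP dc df.
have dfc : differentiable (f \o c) t by exact: differentiable_comp.
apply: DeriveDef; first exact: diff_derivable.
by rewrite [LHS](deriveE _ dfc) diff_comp//= (deriveE _ dc) deriveE.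
Qed.

Lemma derivable_line z u t : derivable (fun s : R => s *: u + z) t 1.
Proof.
apply: derivableD; last exact: derivable_cst.
by apply/derivable1_diffP; exact: differentiableZl.
Qed.

Lemma derive_line z u t : 'D_1 (fun s : R => s *: u + z) t = u.
Proof.
have d1 : differentiable (fun s : R => s *: u) t by exact: differentiableZl.
rewrite deriveD; [|by apply/derivable1_diffP|exact: derivable_cst].
by rewrite derive_cst addr0 deriveE// diffZl// diff_val/= scale1r.
Qed.

Lemma line_rule f z u t : differentiable f (t *: u + z) ->
  is_derive t 1 (fun s => f (s *: u + z)) ('D_u f (t *: u + z)).
Proof.
move=> df; have := @chain_rule (fun s => s *: u + z) f t (@derivable_line z u t) df.
by rewrite derive_line.
Qed.

Lemma MVT_line f z w :
  (forall s : R, 0 <= s <= 1 -> differentiable f (s *: w + z)) ->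
  exists2 s : R, 0 < s < 1 & f (w + z) - f z = 'D_w f (s *: w + z).
Proof.
move=> df.
have d1 (s : R) : s \in `]0, 1[ -> is_derive s 1 (fun s => f (s *: w + z)) ('D_w f (s *: w + z)).
  by rewrite in_itv/= => /andP[s0 s1]; apply: line_rule; apply: df; rewrite !ltW.
have [|s s01] := MVT ltr01 d1.
  apply: derivable_within_continuous => s; rewrite in_itv/= => s01.
  by have [] := line_rule (df s s01).
rewrite scale1r scale0r add0r subr0 mulr1 => ->.
by exists s => //; move: s01; rewrite in_itv.
Qed.

Lemma derive_shiftv f u w z : 'D_u (fun y => f (y + w)) z = 'D_u f (z + w).
Proof.
rewrite /derive.
have -> : (fun h : R => h^-1 *: (((fun y => f (y + w)) \o shift z) (h *: u) - f (z + w)))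
  = (fun h : R => h^-1 *: ((f \o shift (z + w)) (h *: u) - f (z + w))) => //.
by apply/funext => h /=; rewrite addrA.
Qed.

Lemma differentiable_shiftv f w z : differentiable f (z + w) ->
  differentiable (fun y => f (y + w)) z.
Proof.
move=> df; apply: (@differentiable_comp _ _ _ _ (fun y => y + w) f) => //.
Qed.

(** The mean value theorem, used along u and then along v, evaluates the mixed
    second difference as h^2 times an iterated derivative at a nearby point. *)
Lemma second_difference (D : set V) f z u v : open D -> Ck 2 D f -> D z ->
  forall e, 0 < e -> exists2 h0 : R, 0 < h0 & forall h, 0 < h < h0 ->
  `|(f (h *: u + z + h *: v) - f (h *: u + z) - (f (z + h *: v) - f z))
     - h ^+ 2 * 'D_v ('D_u f) z| <= e * h ^+ 2.
Proof.
move=> Do /= [df /(_ u)[dfu /(_ v) cf]] Dz e e0.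
have nD : nbhs z D by exact: open_nbhs_nbhs.
have := cf z Dz; move/cvgrPdist_le => /(_ _ e0) ne.
have /nbhs_ballP[r /= r0 Hr] : nbhs z (D `&` [set y | `|'D_v ('D_u f) z - 'D_v ('D_u f) y| <= e]).
  exact: filterI.
have k0 : 0 < `|u| + `|v| + 1 by rewrite ltr_wpDl// addr_ge0.
exists (r / (`|u| + `|v| + 1)); first exact: divr_gt0.
move=> h /andP[h0 hr].
have inb a b : 0 <= a <= 1 -> 0 <= b <= 1 -> ball z r (a *: (h *: u) + z + b *: (h *: v)).
  move=> /andP[a0 a1] /andP[b0 b1].
  rewrite -ball_normE /ball_/= addrAC opprD addrCA subrr addr0 normrN.
  rewrite (le_lt_trans (ler_normD _ _))// !normrZ !ger0_norm// ?(ltW h0)//.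
  move: hr; rewrite ltr_pdivlMr// => hr; apply: le_lt_trans hr.
  have : a * (h * `|u|) <= h * `|u| by rewrite ler_piMl// mulr_ge0// ltW.
  have : b * (h * `|v|) <= h * `|v| by rewrite ler_piMl// mulr_ge0// ltW.
  lra.
have [|s /andP[s0 s1]] := @MVT_line (fun y => f (y + h *: v) - f y) z (h *: u).
  move=> s s01; apply: differentiableB.
    apply: differentiable_shiftv; apply: df.
    by have [] := Hr _ (inb _ 1 s01 _); rewrite ?scale1r// ler01 lexx.
  apply: df; have [] := Hr _ (inb _ 0 s01 _); rewrite ?lexx ?ler01//.
  by rewrite scale0r addr0.
have s01 : 0 <= s <= 1 by rewrite !ltW.
have d1 : differentiable f (s *: (h *: u) + z).
  apply: df; have [] := Hr _ (inb _ 0 s01 _); rewrite ?lexx ?ler01//.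
  by rewrite scale0r addr0.
have d2 : differentiable f (s *: (h *: u) + z + h *: v).
  apply: df; have [] := Hr _ (inb _ 1 s01 _); rewrite ?lexx ?ler01//.
  by rewrite scale1r.
move=> ->.
rewrite deriveB; [|by apply: diff_derivable; exact: differentiable_shiftv
  |exact: diff_derivable].
rewrite derive_shiftv !deriveZv// -mulrBr.
have [|t /andP[t0 t1]] := @MVT_line ('D_u f) (s *: (h *: u) + z) (h *: v).
  move=> t t01; apply: dfu; rewrite addrC.
  by have [] := Hr _ (inb s t s01 t01).
rewrite [h *: v + _]addrC => ->.
have t01 : 0 <= t <= 1 by rewrite !ltW.
have /= [Dt nt] := Hr _ (inb s t s01 t01).
rewrite [t *: _ + _]addrC deriveZv; last exact: dfu.
exact: second_difference_rescale.
Qed.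

(** The mixed second difference is symmetric in u and v, so both iterated
    derivatives are its limit after division by h^2. *)
Lemma schwarz (D : set V) f z u v : open D -> Ck 2 D f -> D z ->
  'D_u ('D_v f) z = 'D_v ('D_u f) z.
Proof.
move=> Do cf Dz; apply/eqP; rewrite -subr_eq0 -normr_le0; apply/ler_addgt0Pr => e e0.
rewrite add0r.
have e20 : 0 < e / 2 by rewrite divr_gt0.
have [h1 h10 H1] := second_difference u v Do cf Dz e20.
have [h2 h20 H2] := second_difference v u Do cf Dz e20.
pose h := Num.min h1 h2 / 2.
have m0 : 0 < Num.min h1 h2 by rewrite lt_min h10.
have h0 : 0 < h by rewrite divr_gt0.
have hm : h < Num.min h1 h2 by rewrite ltr_pdivrMr// ltr_pMr// ltr1n.
move: hm; rewrite lt_min => /andP[hh1 hh2].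
have := H1 h; rewrite h0 hh1 => /(_ isT) {}H1.
have := H2 h; rewrite h0 hh2 => /(_ isT) {}H2.
rewrite distrC; apply: (second_difference_unique h0 H1).
move: H2; congr (`|_ - _| <= _).
rewrite (addrC z (h *: u)) (addrC z (h *: v)).
have -> : h *: u + z + h *: v = h *: v + z + h *: u by rewrite addrAC -addrA addrC.
have swap (a b c d : R) : a - b - (c - d) = a - c - (b - d) by ring.
exact: swap.
Qed.

End Lines.

(** * Functions of a point and a direction *)

(** Uncurried form of a function of a point and a direction, to which the
    notions of total differentiability and smoothness apply. *)
Definition uncur (A B C : Type) (f : A -> B -> C) (z : A * B) : C := f z.1 z.2.

Section Partials.
Variables (R : realType) (n : nat).
Local Notation E := 'rV[R]_n.
Implicit Types (f : E -> E -> R) (x y a b w : E) (i k m : 'I_n).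

Local Notation e_ i := (delta_mx 0 i : E).

Lemma row_sum w : w = \sum_i w 0 i *: e_ i.
Proof. exact: row_sum_delta. Qed.

Lemma coord_le w i : `|w 0 i| <= `|w|.
Proof.
rewrite [leRHS]/Num.Def.normr/= mx_normrE.
by apply: le_trans (le_bigmax _ _ (0, i)) => /=.
Qed.

Lemma norm_le w (r : R) : 0 <= r -> (forall i, `|w 0 i| <= r) -> `|w| <= r.
Proof.
move=> r0 wr; rewrite [leLHS]/Num.Def.normr/= mx_normrE.
by apply: bigmax_le => // -[j i] _ /=; rewrite ord1.
Qed.

Lemma derive_row (f : E -> R) y w : differentiable f y ->
  'D_w f y = \sum_i w 0 i * pd i f y.
Proof.
move=> df; rewrite {1}(row_sum w) derive_sumv//.
by apply: eq_bigr => i _; rewrite deriveZv.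
Qed.

Lemma pd_uncur2 f i x y : pd i (f x) y = 'D_((0, e_ i) : E * E) (uncur f) (x, y).
Proof.
rewrite /pd /derive; set g1 := fun h => _; set g2 := (X in _ = lim (X @ _)).
suff -> : g1 = g2 by [].
by apply/funext => h; rewrite /g1 /g2 /uncur /= scaler0 add0r.
Qed.

Lemma pd_uncur1 f i x y :
  pd i (fun z => f z y) x = 'D_((e_ i, 0) : E * E) (uncur f) (x, y).
Proof.
rewrite /pd /derive; set g1 := fun h => _; set g2 := (X in _ = lim (X @ _)).
suff -> : g1 = g2 by [].
by apply/funext => h; rewrite /g1 /g2 /uncur /= scaler0 add0r.
Qed.

Lemma derive_uncur f x y a b : differentiable (uncur f) (x, y) ->
  'D_((a, b) : E * E) (uncur f) (x, y) =
  \sum_i a 0 i * pd i (fun z => f z y) x + \sum_i b 0 i * pd i (f x) y.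
Proof.
move=> df.
have -> : (a, b) = \sum_i a 0 i *: (e_ i, 0) + \sum_i b 0 i *: (0, e_ i) :> E * E.
  apply/pair_equal_spec; split.
    rewrite /= (raddf_sum fst) (raddf_sum fst)/= [X in _ + X]big1 ?addr0.
      by rewrite [LHS]row_sum.
    by move=> i _; rewrite scaler0.
  rewrite /= (raddf_sum snd) (raddf_sum snd)/= [X in X + _]big1 ?add0r.
    by rewrite [LHS]row_sum.
  by move=> i _; rewrite scaler0.
rewrite deriveDv// !derive_sumv//.
congr (_ + _); apply: eq_bigr => i _; rewrite deriveZv//.
  by rewrite pd_uncur1.
by rewrite pd_uncur2.
Qed.

Lemma differentiable_uncur2 f x y : differentiable (uncur f) (x, y) ->
  differentiable (f x) y.
Proof.
move=> df; apply: (@differentiable_comp _ _ _ _ (fun y => (x, y)) (uncur f)) => //.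
Qed.

Lemma differentiable_uncur1 f x y : differentiable (uncur f) (x, y) ->
  differentiable (fun z => f z y) x.
Proof.
move=> df; apply: (@differentiable_comp _ _ _ _ (fun x => (x, y)) (uncur f)) => //.
Qed.

End Partials.

Section Smooth2.
Variables (R : realType) (n : nat) (U : set 'rV[R]_n).
Hypothesis U_open : open U.
Local Notation E := 'rV[R]_n.
Implicit Types (f : E -> E -> R) (x y a b w : E) (i k m : 'I_n).

Definition smooth2 f := smooth_on (slit U) (uncur f).

Lemma slit_open : open (slit U).
Proof.
have -> : slit U = (fst @^-1` U) `&` (snd @^-1` [set y | y != 0]) by [].
apply: openI; apply: open_comp => //.
- by move=> z _; exact: cvg_fst.
- by move=> z _; exact: cvg_snd.
- have -> : [set y : E | y != 0] = ~` [set 0].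
    by apply/seteqP; split=> y /= /eqP.
  by apply: closed_openC; exact: accessible_closed_set1 (hausdorff_accessible (@norm_hausdorff _ _)) _.
Qed.

Lemma smooth2_pd f i : smooth2 f -> smooth2 (fun x y => pd i (f x) y).
Proof.
move=> sf; apply: smooth_ext (smooth_derive (0, delta_mx 0 i) sf).
- exact: slit_open.
- by move=> [x y] _; rewrite /uncur /= pd_uncur2.
Qed.

Lemma smooth2_pd1 f i : smooth2 f -> smooth2 (fun x y => pd i (fun z => f z y) x).
Proof.
move=> sf; apply: smooth_ext (smooth_derive (delta_mx 0 i, 0) sf).
- exact: slit_open.
- by move=> [x y] _; rewrite /uncur /= pd_uncur1.
Qed.

Lemma smooth2_diff f x y : smooth2 f -> U x -> y != 0 -> differentiable (uncur f) (x, y).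
Proof. by move=> sf Ux y0; exact: smooth_diff sf _. Qed.

Lemma smooth2_diff2 f x y : smooth2 f -> U x -> y != 0 -> differentiable (f x) y.
Proof. by move=> sf Ux y0; apply: differentiable_uncur2; exact: smooth2_diff. Qed.

Lemma smooth2_diff1 f x y : smooth2 f -> U x -> y != 0 ->
  differentiable (fun z => f z y) x.
Proof. by move=> sf Ux y0; apply: differentiable_uncur1; exact: smooth2_diff. Qed.

Lemma smooth2_cont f x y : smooth2 f -> U x -> y != 0 ->
  {for (x, y), continuous (uncur f)}.
Proof. by move=> sf Ux y0; exact: smooth_cont sf _. Qed.

Lemma pd_pd2 f i k x y : smooth2 f -> U x -> y != 0 ->
  pd i (pd k (f x)) y = pd k (pd i (f x)) y.
Proof.
move=> sf Ux y0.
have uE j : uncur (fun x y => pd j (f x) y) = 'D_((0, delta_mx 0 j) : E * E) (uncur f).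
  by apply/funext => -[z w]; rewrite /uncur /= pd_uncur2.
rewrite (pd_uncur2 (fun x y => pd k (f x) y)) (pd_uncur2 (fun x y => pd i (f x) y)) !uE.
by apply: (schwarz _ _ slit_open) => //; exact: sf.
Qed.

Lemma pd_pd1 f i k x y : smooth2 f -> U x -> y != 0 ->
  pd i (fun z => pd k (f z) y) x = pd k (fun y => pd i (fun z => f z y) x) y.
Proof.
move=> sf Ux y0.
rewrite (pd_uncur1 (fun x y => pd k (f x) y)).
rewrite (pd_uncur2 (fun x y => pd i (fun z => f z y) x)).
have -> : uncur (fun x y => pd k (f x) y) = 'D_((0, delta_mx 0 k) : E * E) (uncur f).
  by apply/funext => -[z w]; rewrite /uncur /= pd_uncur2.
have -> : uncur (fun x y => pd i (fun z => f z y) x) = 'D_((delta_mx 0 i, 0) : E * E) (uncur f).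
  by apply/funext => -[z w]; rewrite /uncur /= pd_uncur1.
by apply: (schwarz _ _ slit_open) => //; exact: sf.
Qed.

End Smooth2.

(** * Uniform bounds on compact sets *)

Section CompactBounds.
Variables (R : realType).

Lemma compact_bound (V : topologicalType) (K : set V) (f : V -> R) :
  compact K -> (forall z, K z -> {for z, continuous f}) ->
  exists2 C : R, 0 < C & forall z, K z -> `|f z| <= C.
Proof.
move=> cK cf; have [->|/set0P K0] := eqVneq K set0; first by exists 1.
have [|c _ cmax] := @compact_EVT_max V R (fun z => `|f z|) K K0 cK.
  apply: continuous_in_subspaceT => z; rewrite inE => Kz.
  by apply: (@continuous_comp _ _ _ f (fun r => `|r|)); [exact: cf|exact: norm_continuous].
exists (`|f c| + 1); first by rewrite ltr_wpDl.
by move=> z Kz; rewrite (le_trans (cmax z _)) ?inE// lerDl.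
Qed.

Lemma compact_bounds (I : finType) (V : topologicalType) (K : set V) (f : I -> V -> R) :
  compact K -> (forall i z, K z -> {for z, continuous (f i)}) ->
  exists2 C : R, 0 < C & forall i z, K z -> `|f i z| <= C.
Proof.
move=> cK cf.
have /choice[C HC] i : exists C : R, 0 < C /\ forall z, K z -> `|f i z| <= C.
  by have [C C0 HC] := compact_bound cK (cf i); exists C.
exists (\sum_i C i + 1).
  by rewrite ltr_wpDl// sumr_ge0// => i _; have [/ltW] := HC i.
move=> i z Kz; have [_ /(_ z Kz) h] := HC i; apply: (le_trans h).
rewrite (bigD1 i)//= -addrA lerDl addr_ge0// sumr_ge0// => j _.
by have [/ltW] := HC j.
Qed.

Variables (n : nat) (U : set 'rV[R]_n).
Hypothesis U_open : open U.
Local Notation E := 'rV[R]_n.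

(** Only the segment from y to y' has to stay in K, because the compact sets
    of interest contain annuli and are not convex. *)
Lemma compact_lipschitz (I : finType) (f : I -> E -> E -> R) (K : set (E * E)) :
  compact K -> K `<=` slit U -> (forall i, smooth2 U (f i)) ->
  exists2 C : R, 0 < C & forall i x y y',
    (forall s : R, 0 <= s <= 1 -> K (x, s *: (y' - y) + y)) ->
    `|f i x y' - f i x y| <= C * `|y' - y|.
Proof.
move=> cK KU sf.
have [|C C0 HC] := @compact_bounds (I * 'I_n)%type _ K
  (fun p z => pd p.2 (f p.1 z.1) z.2) cK.
  move=> [i k] [x y] /KU[/= Ux y0].
  exact: (@smooth2_cont _ _ U (fun x y => pd k (f i x) y)) (smooth2_pd U_open k (sf i)) _ _.
exists (\sum_(k < n) C + 1); first by rewrite ltr_wpDl// sumr_ge0// => _ _; exact: ltW.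
move=> i x y y' seg.
have dfs s : 0 <= s <= 1 -> differentiable (f i x) (s *: (y' - y) + y).
  by move=> /seg/KU[/= Ux y0]; exact: smooth2_diff2 (sf i) _ _.
have [s s01] := MVT_line dfs.
rewrite subrK => ->.
have s01' : 0 <= s <= 1 by case/andP: s01 => s0 s1; rewrite !ltW.
rewrite derive_row; last exact: dfs.
rewrite (le_trans (ler_norm_sum _ _ _))//.
rewrite (@le_trans _ _ (\sum_(k < n) C * `|y' - y|))//.
  apply: ler_sum => k _; rewrite normrM mulrC ler_pM//.
    exact: (HC (i, k) _ (seg _ s01')).
  exact: coord_le.
by rewrite -mulr_suml ler_wpM2r// lerDl.
Qed.

End CompactBounds.

(** * Rules for directional derivatives *)

(** The restriction h > -1 fits homogeneous functions, whose values are
    related along a ray only for positive factors 1 + h. *)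
Lemma derive_const_growth (R : realType) (V : normedModType R) (f : V -> R) z v (c : R) :
  (forall h : R, h != 0 -> -1 < h -> h^-1 *: (f (h *: v + z) - f z) = c) -> 'D_v f z = c.
Proof.
move=> fc; apply: cvg_lim => //.
apply/cvgrPdist_le => e e0; near=> h.
rewrite [X in `|_ - X|](_ : _ = c) ?subrr ?normr0 ?ltW//.
apply: fc; first by near: h; exact: nbhs_dnbhs_neq.
have : `|h| < 1 by near: h; exact: dnbhs0_lt.
by rewrite ltr_norml => /andP[].
Unshelve. all: by end_near. Qed.

Section Smooth2Algebra.
Variables (R : realType) (n : nat) (U : set 'rV[R]_n).
Hypothesis U_open : open U.
Local Notation E := 'rV[R]_n.
Implicit Types (f g : E -> E -> R).

Let O : open (slit U) := slit_open U_open.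

Lemma smooth2_cst (c : R) : smooth2 U (fun _ _ => c).
Proof. exact: (smooth_cst O). Qed.

Lemma smooth2D f g : smooth2 U f -> smooth2 U g -> smooth2 U (fun x y => f x y + g x y).
Proof. exact: (smoothD O). Qed.

Lemma smooth2M f g : smooth2 U f -> smooth2 U g -> smooth2 U (fun x y => f x y * g x y).
Proof. exact: (smoothM O). Qed.

Lemma smooth2N f : smooth2 U f -> smooth2 U (fun x y => - f x y).
Proof. exact: (smoothN O). Qed.

Lemma smooth2B f g : smooth2 U f -> smooth2 U g -> smooth2 U (fun x y => f x y - g x y).
Proof. exact: (smoothB O). Qed.

Lemma smooth2V f : (forall x y, U x -> y != 0 -> f x y != 0) -> smooth2 U f ->
  smooth2 U (fun x y => (f x y)^-1).
Proof. by move=> f0; apply: (smoothV O) => -[x y] [/= Ux y0]; exact: f0. Qed.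

Lemma smooth2X f : smooth2 U f -> smooth2 U (fun x y => f x y ^+ 2).
Proof. exact: (smooth_exp2 O). Qed.

Lemma smooth2_sum (I : finType) (f : I -> E -> E -> R) :
  (forall i, smooth2 U (f i)) -> smooth2 U (fun x y => \sum_i f i x y).
Proof. exact: (smooth_sum O). Qed.

Lemma derive_coord2 (k : 'I_n) (z v : E * E) :
  'D_v (uncur (fun _ y : E => y 0 k)) z = v.2 0 k.
Proof.
apply: derive_const_growth => h h0 _.
by rewrite /uncur /= !mxE addrK [LHS]mulKf.
Qed.

Lemma smooth2_coord (k : 'I_n) : smooth2 U (fun _ y => y 0 k).
Proof.
have lin := derive_coord2 k.
have dif (z : E * E) : differentiable (uncur (fun _ y : E => y 0 k)) z.
  apply: (@differentiable_comp _ _ _ _ snd (fun y : E => y 0 k)) => //.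
    by apply: linear_differentiable => w; exact: cvg_snd.
  exact: differentiable_coord.
case=> [|j].
  by move=> z _; exact: differentiable_continuous.
split=> [z _|v]; first exact: dif.
have H := Ck_cst O j (v.2 0 k).
by apply: (Ck_ext O _ H) => w _; rewrite lin.
Qed.

End Smooth2Algebra.

Section DeriveRules.
Variables (R : realType) (V : normedModType R).
Implicit Types (f g : V -> R) (z v : V).

Lemma deriveMf f g z v : differentiable f z -> differentiable g z ->
  'D_v (fun z => f z * g z) z = f z * 'D_v g z + g z * 'D_v f z.
Proof. by move=> df dg; rewrite [LHS]deriveM//; exact: diff_derivable. Qed.

Lemma deriveDf f g z v : differentiable f z -> differentiable g z ->
  'D_v (fun z => f z + g z) z = 'D_v f z + 'D_v g z.
Proof. by move=> df dg; rewrite [LHS]deriveD//; exact: diff_derivable. Qed.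

Lemma deriveBf f g z v : differentiable f z -> differentiable g z ->
  'D_v (fun z => f z - g z) z = 'D_v f z - 'D_v g z.
Proof. by move=> df dg; rewrite [LHS]deriveB//; exact: diff_derivable. Qed.

Lemma deriveZf f z v (c : R) : differentiable f z ->
  'D_v (fun z => c * f z) z = c * 'D_v f z.
Proof. by move=> df; rewrite [LHS]deriveZ//; exact: diff_derivable. Qed.

Lemma deriveX2f f z v : differentiable f z ->
  'D_v (fun z => f z ^+ 2) z = 2 * f z * 'D_v f z.
Proof.
move=> df; have -> : (fun z => f z ^+ 2) = (fun z => f z * f z).
  by apply/funext => y; rewrite expr2.
by rewrite deriveMf// -mulrA mulr_natl mulr2n.
Qed.

Lemma deriveVf f z v : f z != 0 -> differentiable f z ->
  'D_v (fun z => (f z)^-1) z = - (f z) ^- 2 * 'D_v f z.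
Proof. by move=> f0 df; rewrite [LHS]deriveV//; exact: diff_derivable. Qed.

Lemma differentiable_sumf (I : finType) (f : I -> V -> R) z :
  (forall i, differentiable (f i) z) -> differentiable (fun z => \sum_i f i z) z.
Proof.
move=> df; have H : forall r : seq I, differentiable (fun z => \sum_(i <- r) f i z) z.
  elim=> [|i r IH].
    have -> : (fun z => \sum_(i <- [::]) f i z) = cst 0 by apply/funext => y; rewrite big_nil.
    exact: differentiable_cst.
  have -> : (fun z => \sum_(i <- i :: r) f i z) = (fun z => f i z + \sum_(i <- r) f i z).
    by apply/funext => y; rewrite big_cons.
  exact: differentiableD.
exact: H.
Qed.

Lemma derive_sumf (I : finType) (f : I -> V -> R) z v :
  (forall i, differentiable (f i) z) ->
  'D_v (fun z => \sum_i f i z) z = \sum_i 'D_v (f i) z.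
Proof.
move=> df; have H : forall r : seq I, differentiable (fun z => \sum_(i <- r) f i z) z /\
    'D_v (fun z => \sum_(i <- r) f i z) z = \sum_(i <- r) 'D_v (f i) z.
  elim=> [|i r [IH1 IH2]].
    have -> : (fun z => \sum_(i <- [::]) f i z) = cst 0 by apply/funext => y; rewrite big_nil.
    by split; [exact: differentiable_cst|rewrite derive_cst big_nil].
  have -> : (fun z => \sum_(i <- i :: r) f i z) = (fun z => f i z + \sum_(i <- r) f i z).
    by apply/funext => y; rewrite big_cons.
  by split; [exact: differentiableD|rewrite deriveDf// IH2 big_cons].
by have [] := H (index_enum I).
Qed.

End DeriveRules.

(** * Euler identities of a Finsler metric *)

Lemma sum_delta (R : realType) (n : nat) (f : 'I_n -> R) k :
  \sum_j f j * (j == k)%:R = f k.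
Proof.
rewrite (bigD1 k)//= eqxx mulr1 big1 ?addr0// => j /negPf ->.
by rewrite mulr0.
Qed.

Section FinslerIdentities.
Variables (R : realType) (n : nat) (U : set 'rV[R]_n).
Hypothesis U_open : open U.
Local Notation E := 'rV[R]_n.
Variable F : E -> E -> R.
Hypothesis hF : finsler U F.
Implicit Types (x y v w : E) (i j k m : 'I_n).

Lemma pd_coord k j y : pd k (fun z : E => z 0 j) y = (j == k)%:R.
Proof.
apply: derive_const_growth => h h0 _.
by rewrite !mxE eqxx/= addrK [LHS]mulKf.
Qed.

Lemma smooth_F : smooth2 U F. Proof. exact: (finsler_smooth hF). Qed.

Lemma F_gt0 x y : U x -> y != 0 -> 0 < F x y.
Proof. exact: (finsler_gt0 hF). Qed.

Lemma F_neq0 x y : U x -> y != 0 -> F x y != 0.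
Proof. by move=> Ux y0; rewrite gt_eqF// F_gt0. Qed.

(** The gradient in y of the energy F^2 / 2; its derivatives are the g_ij. *)
Definition denergy i x y : R := 2^-1 * pd i (fun z => F x z ^+ 2) y.

Lemma smooth_F2 : smooth2 U (fun x y => F x y ^+ 2).
Proof. exact: (smooth2X U_open smooth_F). Qed.

Lemma smooth_llow i : smooth2 U (llow F i).
Proof. exact: (smooth2_pd U_open i smooth_F). Qed.

Lemma smooth_lup i : smooth2 U (lup F i).
Proof.
apply: (smooth2M U_open); first exact: smooth2_coord.
by apply: (smooth2V U_open) smooth_F; exact: F_neq0.
Qed.

Lemma smooth_denergy i : smooth2 U (denergy i).
Proof.
apply: (smooth2M U_open (smooth2_cst U_open 2^-1)).
exact: (smooth2_pd U_open i smooth_F2).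
Qed.

Lemma smooth_g i j : smooth2 U (g F i j).
Proof.
apply: (smooth2M U_open (smooth2_cst U_open 2^-1)).
exact: (smooth2_pd U_open i (smooth2_pd U_open j smooth_F2)).
Qed.

Lemma denergyE i x y : U x -> y != 0 -> denergy i x y = F x y * llow F i x y.
Proof.
move=> Ux y0; rewrite /denergy /pd deriveX2f; last exact: (smooth2_diff2 smooth_F).
by rewrite /llow /pd -mulrA mulKf.
Qed.

Lemma pd_denergy i j x y : U x -> y != 0 -> pd i (denergy j x) y = g F i j x y.
Proof.
move=> Ux y0; rewrite /pd deriveZf//.
exact: (smooth2_diff2 (smooth2_pd U_open j smooth_F2)).
Qed.

Lemma g_sym i j x y : U x -> y != 0 -> g F i j x y = g F j i x y.
Proof. by move=> Ux y0; rewrite /g (pd_pd2 U_open _ _ smooth_F2). Qed.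

Lemma dg_sym12 k i j x y : U x -> y != 0 -> pd k (g F i j x) y = pd i (g F k j x) y.
Proof.
move=> Ux y0.
have sj := smooth2_pd U_open j smooth_F2.
have d k' : differentiable (pd k' (pd j (fun z => F x z ^+ 2))) y.
  exact: (smooth2_diff2 (smooth2_pd U_open k' sj)).
have dgE k' i' : pd k' (g F i' j x) y =
    2^-1 * pd k' (pd i' (pd j (fun z => F x z ^+ 2))) y.
  exact: (deriveZf _ _ (d i')).
by rewrite !dgE (pd_pd2 U_open _ _ sj).
Qed.

Lemma near_slit x y (P : E -> Prop) : y != 0 -> (forall z, z != 0 -> P z) ->
  \forall z \near y, P z.
Proof.
move=> y0 HP; have Oy : open [set z : E | z != 0].
  have -> : [set y : E | y != 0] = ~` [set 0] by apply/seteqP; split=> z /= /eqP.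
  by apply: closed_openC; exact: accessible_closed_set1 (hausdorff_accessible (@norm_hausdorff _ _)) _.
by have : nbhs y [set z : E | z != 0] by [exact: open_nbhs_nbhs]; apply: filterS.
Qed.

Lemma pd_slit_ext k (f f' : E -> R) y : y != 0 -> (forall z, z != 0 -> f z = f' z) ->
  pd k f y = pd k f' y.
Proof.
by move=> y0 ff'; rewrite /pd; apply: near_eq_derive; exact: near_slit.
Qed.

Lemma dg_sym23 k i j x y : U x -> y != 0 -> pd k (g F i j x) y = pd k (g F j i x) y.
Proof.
move=> Ux y0; apply: (pd_slit_ext _ y0) => z z0; exact: g_sym.
Qed.

Lemma derive_homothety (f : E -> R) y v (a : R) :
  'D_v (fun z => f (a *: z)) y = 'D_(a *: v) f (a *: y).
Proof.
rewrite /derive.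
have -> : (fun h : R => h^-1 *: (((fun z => f (a *: z)) \o shift y) (h *: v) - f (a *: y)))
  = (fun h : R => h^-1 *: ((f \o shift (a *: y)) (h *: (a *: v)) - f (a *: y))) => //.
by apply/funext => h /=; rewrite [a *: (_ + y)]scalerDr !scalerA (mulrC h a).
Qed.

(** Euler's identity: along the ray through y a function of degree 1 has
    constant difference quotients. *)
Lemma euler1 (f : E -> R) y : differentiable f y ->
  (forall a : R, 0 < a -> f (a *: y) = a * f y) -> \sum_i y 0 i * pd i f y = f y.
Proof.
move=> df hf; rewrite -derive_row//.
apply: derive_const_growth => h h0 h1.
have h10 : 0 < h + 1 by rewrite -ltrBlDr sub0r.
have -> : h *: y + y = (h + 1) *: y by rewrite scalerDl scale1r.
by rewrite hf// mulrDl mul1r addrK [LHS]mulKf.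
Qed.

Lemma denergy_homo i x y (a : R) : U x -> y != 0 -> 0 < a -> denergy i x (a *: y) = a * denergy i x y.
Proof.
move=> Ux y0 a0; have ay0 : a *: y != 0 by rewrite scaler_eq0 (gt_eqF a0).
have d z : z != 0 -> differentiable (fun z => F x z ^+ 2) z.
  by move=> z0; exact: (smooth2_diff2 smooth_F2).
have : a * pd i (fun z => F x z ^+ 2) (a *: y) = a ^+ 2 * pd i (fun z => F x z ^+ 2) y.
  rewrite /pd -deriveZv; last exact: d.
  rewrite -(derive_homothety (fun z => F x z ^+ 2)) -deriveZf; last exact: d.
  have -> : (fun z => F x (a *: z) ^+ 2) = (fun z => a ^+ 2 * F x z ^+ 2).
    by apply/funext => z; rewrite (finsler_homo hF z Ux a0) exprMn.
  by [].
rewrite expr2 -mulrA => /(mulfI (lt0r_neq0 a0)).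
by rewrite /denergy => ->; rewrite mulrCA.
Qed.

Lemma llow_euler x y : U x -> y != 0 -> \sum_i y 0 i * llow F i x y = F x y.
Proof.
move=> Ux y0; apply: euler1; first exact: (smooth2_diff2 smooth_F).
by move=> a a0; exact: (finsler_homo hF).
Qed.

Lemma g_euler i x y : U x -> y != 0 -> \sum_j y 0 j * g F j i x y = F x y * llow F i x y.
Proof.
move=> Ux y0; rewrite -(denergyE i Ux y0) -[RHS](@euler1 (denergy i x)).
- by apply: eq_bigr => j _; rewrite (pd_denergy j i Ux y0).
- exact: (smooth2_diff2 (smooth_denergy i)).
- by move=> a a0; exact: denergy_homo.
Qed.

(** The y-derivative of the identity g_ij y^j = d(F^2 / 2) / dy^i already
    contains g_ik on both sides, so the derivative of g contributes 0. *)
Lemma dg_euler k i x y : U x -> y != 0 -> \sum_j y 0 j * pd k (g F i j x) y = 0.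
Proof.
move=> Ux y0.
have dg j : differentiable (g F i j x) y by exact: (smooth2_diff2 (smooth_g i j)).
have dc j : differentiable (fun z : E => z 0 j) y by exact: differentiable_coord.
have : pd k (fun z => \sum_j z 0 j * g F i j x z) y = pd k (denergy i x) y.
  apply: (pd_slit_ext _ y0) => z z0.
  rewrite (denergyE i Ux z0) -(g_euler i Ux z0).
  by apply: eq_bigr => j _; rewrite (g_sym i j Ux z0).
rewrite (pd_denergy k i Ux y0) /pd derive_sumf; last by move=> j; exact: differentiableM.
under eq_bigr => j _ do rewrite (deriveMf _ (dc j) (dg j)) -/(pd k (fun z : E => z 0 j) y) pd_coord.
rewrite big_split/=.
by rewrite sum_delta (g_sym i k Ux y0) => /(canRL (addrK _)) ->; rewrite subrr.
Qed.

Definition gmx x y : 'M[R]_n := \matrix_(a, b) g F a b x y.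

Lemma gmx_unit x y : U x -> y != 0 -> gmx x y \in unitmx.
Proof.
move=> Ux y0; rewrite unitmxE unitfE; apply/negP => /det0P[v v0 vg].
have := finsler_posdef hF Ux y0 v0; rewrite exchange_big /= big1 ?ltxx// => j _.
rewrite -mulr_suml (_ : \sum_i _ = (v *m gmx x y) 0 j).
  by rewrite vg mxE mul0r.
by rewrite mxE; apply: eq_bigr => i _; rewrite mxE mulrC.
Qed.

Lemma smooth_christoffel k i j : smooth2 U (christoffel F k i j).
Proof.
apply: (smooth2M U_open (smooth2_cst U_open 2^-1)); apply: (smooth2_sum U_open) => l.
apply: (smooth2M U_open).
  apply: (smooth_invmx (slit_open U_open)) => [[x y] [/= Ux y0]|a b].
    exact: gmx_unit.
  by apply: smooth_ext (smooth_g a b); [exact: slit_open|move=> z _; rewrite mxE].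
apply: (smooth2B U_open); [apply: (smooth2D U_open)|];
  exact: (smooth2_pd U_open _ (smooth_g _ _)).
Qed.

(** All three derivatives of g in the Christoffel symbol agree, since g is a
    second derivative; two of them cancel. *)
Lemma g_christoffel m i j x y : U x -> y != 0 ->
  \sum_k g F m k x y * christoffel F k i j x y = 2^-1 * pd m (g F i j x) y.
Proof.
move=> Ux y0; rewrite /christoffel.
under eq_bigr => k _ do rewrite mulrCA; rewrite -mulr_sumr; congr (_ * _).
under eq_bigr => k _ do rewrite mulr_sumr; rewrite exchange_big /=.
have gV l : \sum_k g F m k x y * invmx (gmx x y) k l = (m == l)%:R.
  have := mulmxV (gmx_unit Ux y0); move/matrixP/(_ m l); rewrite !mxE => <-.
  by apply: eq_bigr => k _; rewrite mxE.
under eq_bigr => l _.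
  under eq_bigr => k _ do rewrite mulrA.
  rewrite -mulr_suml gV.
over.
under eq_bigr => l _ do rewrite eq_sym mulrC.
rewrite sum_delta.
have -> : pd i (g F j m x) y = pd m (g F i j x) y.
  by rewrite (dg_sym23 i j m Ux y0) (dg_sym12 i m j Ux y0).
have -> : pd j (g F i m x) y = pd m (g F i j x) y.
  by rewrite (dg_sym12 j i m Ux y0) (dg_sym23 i j m Ux y0) (dg_sym12 i m j Ux y0).
by rewrite addrK.
Qed.

(** F l_k = g_km y^m, so the contraction is half of y^m dg_ij / dy^m, which
    vanishes because g has degree 0. *)
Lemma llow_christoffel i j x y : U x -> y != 0 ->
  \sum_k llow F k x y * christoffel F k i j x y = 0.
Proof.
move=> Ux y0; apply: (mulfI (F_neq0 Ux y0)); rewrite mulr0 mulr_sumr.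
under eq_bigr => k _ do rewrite mulrA -(g_euler k Ux y0) mulr_suml.
rewrite exchange_big /=.
under eq_bigr => m _.
  under eq_bigr => k _ do rewrite -mulrA.
  rewrite -mulr_sumr (g_christoffel m i j Ux y0) (dg_sym12 m i j Ux y0).
  rewrite (dg_sym23 i m j Ux y0) mulrCA.
over.
by rewrite -mulr_sumr (dg_euler i j Ux y0) mulr0.
Qed.

End FinslerIdentities.

(** * Linear two-point boundary value problems *)

Section RealCurves.
Variable R : realType.
Implicit Types (a b B : R).

Lemma half_pow_small (C e : R) : 0 <= C -> 0 < e -> exists k, C / 2 ^+ k < e.
Proof.
move=> C0 e0; have Ce : 0 <= C / e by rewrite divr_ge0// ltW.
exists (Num.bound (C / e)); rewrite ltr_pdivrMr ?exprn_gt0// mulrC -ltr_pdivrMr//.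
apply: (lt_trans (archi_boundP Ce)); rewrite -natrX ltr_nat; exact: ltn_expl.
Qed.

(** Uniqueness principle for the boundary value problems below: a bounded
    quantity whose bounds can be halved is zero. *)
Lemma halving_zero (T : Type) (X : T -> R) B0 : 0 <= B0 -> (forall t, `|X t| <= B0) ->
  (forall B, 0 <= B -> (forall t, `|X t| <= B) -> forall t, `|X t| <= B / 2) ->
  forall t, X t = 0.
Proof.
move=> B00 HB0 H t; apply/eqP; rewrite -normr_eq0 eq_le normr_ge0 andbT.
apply/ler_addgt0Pr => e e0; rewrite add0r.
have [k /ltW ke] := half_pow_small B00 e0; apply: le_trans ke.
elim: k t => [|k IH] t; first by rewrite expr0 divr1.
rewrite exprSr invfM mulrA; apply: H => //.
by rewrite divr_ge0// exprn_ge0.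
Qed.

Lemma is_derive_continuous (f : R -> R) (t d : R) : is_derive t 1 f d -> {for t, continuous f}.
Proof. by move=> [df _]; apply: differentiable_continuous; apply/derivable1_diffP. Qed.

Lemma mvt_bound (f df : R -> R) (s t : R) B : s <= t ->
  {within `[s, t], continuous f} ->
  (forall u, u \in `]s, t[ -> is_derive u 1 f (df u)) ->
  (forall u, u \in `]s, t[ -> `|df u| <= B) ->
  `|f t - f s| <= B * (t - s).
Proof.
rewrite le_eqVlt => /orP[/eqP->|st] cf dff dfB.
  by rewrite !subrr normr0 mulr0.
have [c cI ->] := MVT st dff cf.
have st0 : 0 <= t - s by rewrite subr_ge0 ltW.
by rewrite normrM (ger0_norm st0) ler_wpM2r//; exact: dfB.
Qed.

(** Two integrations from boundary data: a function vanishing at both ends of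
    [0, 1] has a critical point (Rolle), so a bound of the second derivative
    bounds the first derivative and then the function itself. *)
Lemma bvp_bound (w w1 w2 : R -> R) a b B : a <= 0 -> 1 <= b ->
  {within `[0, 1], continuous w} -> w 0 = 0 -> w 1 = 0 ->
  (forall t, t \in `]a, b[ -> is_derive t 1 w (w1 t)) ->
  (forall t, t \in `]a, b[ -> is_derive t 1 w1 (w2 t)) ->
  (forall t, t \in `]a, b[ -> t \in `[0, 1] -> `|w2 t| <= B) ->
  (forall t, t \in `]a, b[ -> t \in `[0, 1] -> `|w1 t| <= B) /\
  (forall t, t \in `[0, 1] -> `|w t| <= B).
Proof.
move=> a0 b1 cw w0 w10 dw dw1 HB.
have oo (t : R) : t \in `]0, 1[ -> t \in `]a, b[.
  rewrite !in_itv/= => /andP[t0 t1].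
  by rewrite (le_lt_trans a0 t0) (lt_le_trans t1 b1).
have [|xi xiI dxi] := @Rolle R w 0 1 ltr01 _ cw (etrans w0 (esym w10)).
  by move=> t /oo/dw[].
have xi0 : w1 xi = 0.
  by have [_ <-] := dw xi (oo _ xiI); have [_ ->] := dxi.
have B0 : 0 <= B.
  by apply: le_trans (HB xi (oo _ xiI) (subset_itv_oo_cc xiI)).
have H1 (t : R) : t \in `]a, b[ -> t \in `[0, 1] -> `|w1 t| <= B.
  move=> tI; rewrite in_itv/= => /andP[t0 t1].
  move: (xiI); rewrite in_itv/= => /andP[x0 x1].
  have key (s u : R) : 0 <= s -> u <= 1 -> s <= u -> s \in `]a, b[ -> u \in `]a, b[ ->
      `|w1 u - w1 s| <= B.
    move=> s0 u1 su; rewrite !in_itv/= => /andP[as_ sb] /andP[au ub].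
    have inI (v : R) : v \in `[s, u] -> (v \in `]a, b[) /\ (v \in `[0, 1]).
      rewrite !in_itv/= => /andP[sv vu].
      rewrite (lt_le_trans as_ sv) (le_lt_trans vu ub) (le_trans s0 sv).
      by rewrite (le_trans vu u1).
    have c1 : {within `[s, u], continuous w1}.
      apply: derivable_within_continuous => v vI.
      by have [/dw1[]] := inI v vI.
    have d1 (v : R) : v \in `]s, u[ -> is_derive v 1 w1 (w2 v).
      by move=> /subset_itv_oo_cc/inI[vI _]; exact: dw1.
    have e1 (v : R) : v \in `]s, u[ -> `|w2 v| <= B.
      by move=> /subset_itv_oo_cc/inI[vI vJ]; exact: HB.
    apply: (le_trans (mvt_bound su c1 d1 e1)).
    by rewrite ler_piMr// lerBlDr; apply: (le_trans u1); rewrite lerDl.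
  rewrite -[w1 t]subr0 -xi0.
  case: (leP xi t) => [xt|/ltW tx]; first exact: (key _ _ (ltW x0) t1 xt (oo _ xiI) tI).
  by rewrite distrC; exact: (key _ _ t0 (ltW x1) tx tI (oo _ xiI)).
split=> // t; rewrite in_itv/= => /andP[t0 t1].
have c1 : {within `[0, t], continuous w}.
  apply: continuous_subspaceW cw => v /=; rewrite !in_itv/= => /andP[v0 vt].
  by rewrite v0 (le_trans vt t1).
have inI (v : R) : v \in `]0, t[ -> v \in `]0, 1[.
  by rewrite !in_itv/= => /andP[v0 vt]; rewrite v0 (lt_le_trans vt t1).
have d1 (v : R) : v \in `]0, t[ -> is_derive v 1 w (w1 v).
  by move=> /inI/oo; exact: dw.
have e1 (v : R) : v \in `]0, t[ -> `|w1 v| <= B.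
  by move=> /inI vI; apply: H1 (oo _ vI) (subset_itv_oo_cc vI).
have := mvt_bound t0 c1 d1 e1; rewrite w0 !subr0 => H; apply: (le_trans H).
by rewrite ler_piMr.
Qed.

Lemma antiderivative (f : R -> R) a b a' b' : a < a' -> b' < b ->
  (forall t, t \in `]a, b[ -> {for t, continuous f}) ->
  exists A : R -> R, forall t, t \in `]a', b'[ -> is_derive t 1 A (f t).
Proof.
move=> aa bb cf.
have cI (t : R) : t \in `[a', b'] -> {for t, continuous f}.
  rewrite in_itv/= => /andP[t0 t1]; apply: cf.
  by rewrite in_itv/= (lt_le_trans aa t0) (le_lt_trans t1 bb).
exists (fun x => \int[lebesgue_measure]_(t in `[a', x]) f t)%R => t.
rewrite in_itv/= => /andP[t0 t1].
have [|||d e] := @continuous_FTC1_closed R f a' t b' t1.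
- apply: continuous_compact_integrable; first exact: segment_compact.
  by apply: continuous_in_subspaceT => x; rewrite inE => /cI.
- exact: t0.
- by apply: cI; rewrite in_itv/= !ltW.
by apply: DeriveDef; [exact: d|rewrite -derive1E; exact: e].
Qed.

(** Two successive primitives, corrected by the affine function with the same
    boundary values. *)
Lemma bvp_solve (f : R -> R) : continuous f ->
  exists w w1 : R -> R, [/\ w 0 = 0, w 1 = 0,
    forall t : R, t \in `](-1), 2[ -> is_derive t 1 w (w1 t) &
    forall t : R, t \in `](-1), 2[ -> is_derive t 1 w1 (f t)].
Proof.
move=> cf.
(* Each primitive is defined on a slightly smaller interval: from ]-3, 4[ to
   ]-2, 3[ and then to ]-1, 2[. *)
have l1 : -3 < -2 :> R by lra.
have l2 : 3 < 4 :> R by lra.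
have l3 : -2 < -1 :> R by lra.
have l4 : 2 < 3 :> R by lra.
have [A HA] := antiderivative l1 l2 (fun t _ => cf t).
have cA (t : R) : t \in `](-2), 3[ -> {for t, continuous A}.
  by move=> /HA; exact: is_derive_continuous.
have [W HW] := antiderivative l3 l4 cA.
have sub (t : R) : t \in `](-1), 2[ -> t \in `](-2), 3[.
  by rewrite !in_itv/= => /andP[? ?]; apply/andP; split; lra.
exists (fun t => W t - W 0 - t * (W 1 - W 0)), (fun t => A t - (W 1 - W 0)).
split=> [||t tI|t /sub tI]; first by rewrite mul0r !subrr.
- by rewrite mul1r subrr.
- have d1 := HW t tI.
  by apply: is_derive_eq; rewrite /GRing.scale/= !(mulr0,mul1r,mulr1,addr0,subr0,add0r).
- have d1 := HA t tI.
  by apply: is_derive_eq; rewrite subr0.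
Qed.

End RealCurves.

(** * Vector-valued curves and a fixed point theorem *)

Section RowCurves.
Variables (R : realType) (n : nat).
Local Notation E := 'rV[R]_n.
Implicit Types (c w : R -> E).

(** Coordinatewise form of differentiability, in which the results on real
    functions apply to each entry. *)
Definition row_derive c (t : R) (d : E) :=
  forall k : 'I_n, is_derive t 1 (fun s => c s 0 k) (d 0 k).

Lemma row_deriveP c (t : R) (d : E) : row_derive c t d <->
  derivable c t 1 /\ 'D_1 c t = d.
Proof.
split=> [H|[dc cE] k].
  have dc : derivable c t 1.
    by apply/derivable_mxP => i k; rewrite (ord1 i); have [] := H k.
  split=> //; rewrite derive_mx//; apply/rowP => k; rewrite mxE.
  by have [_ ->] := H k.
apply: DeriveDef; first by move/derivable_mxP : dc.
by rewrite -cE derive_mx// mxE.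
Qed.

Lemma row_derive_continuous c (t : R) (d : E) : row_derive c t d -> {for t, continuous c}.
Proof.
by move=> /row_deriveP[dc _]; apply: differentiable_continuous; apply/derivable1_diffP.
Qed.

Lemma row_continuous_coord c (t : R) k : {for t, continuous c} ->
  {for t, continuous (fun s => c s 0 k)}.
Proof.
move=> cc; apply: (@continuous_comp _ _ _ c (fun M : E => M 0 k)) => //.
exact: coord_continuous.
Qed.

Lemma row_within_coord c (A : set R) k : {within A, continuous c} ->
  {within A, continuous (fun s => c s 0 k)}.
Proof.
move=> cc t.
apply: (@continuous_comp (subspace A) _ _ (c : subspace A -> E) (fun M : E => M 0 k)).
  exact: cc.
exact: coord_continuous.
Qed.

Lemma row_bvp_bound (w w1 w2 : R -> E) (a b B : R) : a <= 0 -> 1 <= b -> 0 <= B ->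
  {within `[0, 1], continuous w} -> w 0 = 0 -> w 1 = 0 ->
  (forall t : R, t \in `]a, b[ -> row_derive w t (w1 t)) ->
  (forall t : R, t \in `]a, b[ -> row_derive w1 t (w2 t)) ->
  (forall t : R, t \in `]a, b[ -> t \in `[0, 1] -> `|w2 t| <= B) ->
  (forall t : R, t \in `]a, b[ -> t \in `[0, 1] -> `|w1 t| <= B) /\
  (forall t : R, t \in `[0, 1] -> `|w t| <= B).
Proof.
move=> a0 b1 B0 cw w0 w1_0 dw dw1 HB.
have H k := @bvp_bound R (fun s => w s 0 k) (fun s => w1 s 0 k) (fun s => w2 s 0 k)
  a b B a0 b1 (row_within_coord (k := k) cw).
have {}H (k : 'I_n) : (forall t : R, t \in `]a, b[ -> t \in `[0, 1] -> `|w1 t 0 k| <= B) /\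
  (forall t : R, t \in `[0, 1] -> `|w t 0 k| <= B).
  apply: H; first by rewrite w0 mxE.
  - by rewrite w1_0 mxE.
  - by move=> t tI; exact: dw tI k.
  - by move=> t tI; exact: dw1 tI k.
  - by move=> t tI tJ; apply: (le_trans (coord_le _ _)); exact: HB.
split=> [t tI tJ|t tJ]; apply: norm_le => // k; have [H1 H2] := H k.
- exact: H1.
- exact: H2.
Qed.

Lemma row_bvp_solve (f : R -> E) : continuous f ->
  exists w w1 : R -> E, [/\ w 0 = 0, w 1 = 0,
    forall t : R, t \in `](-1), 2[ -> row_derive w t (w1 t) &
    forall t : R, t \in `](-1), 2[ -> row_derive w1 t (f t)].
Proof.
move=> cf.
have /choice[W HW] (k : 'I_n) : exists W : (R -> R) * (R -> R), [/\ W.1 0 = 0, W.1 1 = 0,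
    forall t : R, t \in `](-1), 2[ -> is_derive t 1 W.1 (W.2 t) &
    forall t : R, t \in `](-1), 2[ -> is_derive t 1 W.2 (f t 0 k)].
  have [|w [w1 H]] := @bvp_solve R (fun t => f t 0 k); last by exists (w, w1).
  by move=> t; apply: row_continuous_coord; exact: cf.
have rE (g : 'I_n -> R -> R) k : (fun s => (\row_k g k s : E) 0 k) = g k.
  by apply/funext => s; rewrite mxE.
exists (fun t => \row_k (W k).1 t), (fun t => \row_k (W k).2 t).
split=> [||t tI k|t tI k].
- by apply/rowP => k; rewrite !mxE; have [] := HW k.
- by apply/rowP => k; rewrite !mxE; have [] := HW k.
- by rewrite rE mxE; have [_ _ H _] := HW k; exact: H.
- by rewrite rE; have [_ _ _ H] := HW k; exact: H.
Qed.

(** Banach's fixed point theorem in the sup norm, for curves on the whole line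
    with values in a ball and contraction factor 1/2. *)
Lemma contraction_fix (Phi : (R -> E) -> R -> E) (B : R) : 0 <= B ->
  (forall a, continuous a -> (forall t, `|a t| <= B) ->
    continuous (Phi a) /\ forall t, `|Phi a t| <= B) ->
  (forall a b (d : R), continuous a -> (forall t, `|a t| <= B) ->
    continuous b -> (forall t, `|b t| <= B) -> 0 <= d ->
    (forall t, `|a t - b t| <= d) -> forall t, `|Phi a t - Phi b t| <= d / 2) ->
  exists a, [/\ continuous a, forall t, `|a t| <= B & forall t, Phi a t = a t].
Proof.
move=> B0 PhiB PhiC.
pose u k := iter k Phi (fun=> 0).
have uP k : continuous (u k) /\ forall t, `|u k t| <= B.
  elim: k => [|k [IH1 IH2]]; last exact: PhiB.
  by split=> [t|t]; [exact: cst_continuous|rewrite normr0].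
have uS k t : `|u k.+1 t - u k t| <= B / 2 ^+ k.
  elim: k t => [|k IH] t.
    by rewrite expr0 divr1 subr0; have [_] := uP 1%N; exact.
  rewrite exprSr invfM mulrA.
  by apply: PhiC IH t; [exact: (uP k.+1).1|exact: (uP k.+1).2|exact: (uP k).1|
    exact: (uP k).2|rewrite divr_ge0// exprn_ge0].
have uD k m t : `|u (k + m)%N t - u k t| <= 2 * B / 2 ^+ k.
  suff : `|u (k + m)%N t - u k t| <= 2 * B / 2 ^+ k - 2 * B / 2 ^+ (k + m).
    move=> H; apply: (le_trans H); rewrite lerBlDr lerDl.
    by rewrite divr_ge0// ?exprn_ge0// mulr_ge0.
  elim: m => [|m IH]; first by rewrite addn0 !subrr normr0.
  rewrite addnS -(subrKA (u (k + m)%N t)) (le_trans (ler_normD _ _))//.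
  apply: (le_trans (lerD (uS _ _) IH)); rewrite exprSr invfM.
  set C := B / _; have -> : 2 * B / 2 ^+ (k + m) = 2 * C by rewrite /C; ring.
  have -> : 2 * B * ((2 ^+ (k + m))^-1 * 2^-1) = C by rewrite /C; field; rewrite expf_neq0.
  lra.
have Hl (t : R) : exists l : E, u k t @[k --> \oo] --> l.
  have : cauchy (u k t @[k --> \oo]).
    apply: cauchy_exP => e e0.
    have [k ke] := half_pow_small (mulr_ge0 (ler0n R 2) B0) e0.
    exists (u k t); exists k => //= m /= km.
    rewrite -ball_normE /ball_/= distrC -(subnKC km); exact: le_lt_trans (uD _ _ _) ke.
  by move=> /cauchy_cvgP /cvg_ex.
have [a Ha] := choice Hl.
have aD k t : `|a t - u k t| <= 2 * B / 2 ^+ k.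
  have cl : `|u m t - u k t| @[m --> \oo] --> `|a t - u k t|.
    by apply: cvg_norm; apply: cvgB; [exact: Ha|exact: cvg_cst].
  apply: (cvgr_to_le cl); exists k => //= m /= km.
  by rewrite -(subnKC km); exact: uD.
have aB t : `|a t| <= B.
  have cl : `|u m t| @[m --> \oo] --> `|a t| by apply: cvg_norm; exact: Ha.
  by apply: (cvgr_to_le cl); exists 0%N => //= m _; exact: (uP m).2.
have ca : continuous a.
  move=> t; apply/cvgrPdist_le => e e0.
  have e30 : 0 < e / 3 by rewrite divr_gt0.
  have [k /ltW ke] := half_pow_small (mulr_ge0 (ler0n R 2) B0) e30.
  have /cvgrPdist_le/(_ _ e30) H := (uP k).1 t.
  near=> s; have Hs : `|u k t - u k s| <= e / 3 by near: s.
  have H1 := le_trans (aD k t) ke.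
  have H2 := le_trans (aD k s) ke.
  have -> : a t - a s = (a t - u k t) + ((u k t - u k s) - (a s - u k s)).
    by rewrite opprB !addrA subrK subrK.
  rewrite (le_trans (ler_normD _ _))// (le_trans (lerD H1 (ler_normB _ _)))//.
  apply: (le_trans (lerD (lexx _) (lerD Hs H2))); lra.
exists a; split=> // t; apply/eqP; rewrite -subr_eq0 -normr_le0.
apply/ler_addgt0Pr => e e0; rewrite add0r.
have [k /ltW ke] := half_pow_small (mulr_ge0 (ler0n R 2) B0) e0.
have d0 : 0 <= 2 * B / 2 ^+ k by rewrite divr_ge0// ?exprn_ge0// mulr_ge0.
have H1 := PhiC a (u k) _ ca aB (uP k).1 (uP k).2 d0 (aD k) t.
have H2 := aD k.+1 t.
have -> : Phi a t - a t = (Phi a t - u k.+1 t) - (a t - u k.+1 t).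
  by rewrite opprB addrA subrK.
apply: (le_trans (ler_normB _ _)); apply: (le_trans (lerD H1 H2)).
by apply: le_trans ke; rewrite exprSr invfM mulrA -splitr.
Unshelve. all: by end_near. Qed.

End RowCurves.

(** * Slow solutions of equations quadratic in the velocity *)

Lemma ler_sqr_mono (R : realType) (a b : R) : 0 <= a -> a <= b -> a ^+ 2 <= b ^+ 2.
Proof. by move=> a0 ab; rewrite !expr2 ler_pM. Qed.

Lemma row_deriveB (R : realType) (n : nat) (f f1 g g1 : R -> 'rV[R]_n) (t : R) :
  row_derive f t (f1 t) -> row_derive g t (g1 t) ->
  row_derive (fun t => f t - g t) t (f1 t - g1 t).
Proof.
move=> df dg k; rewrite !mxE.
have -> : (fun s => (f s - g s) 0 k) = (fun s => f s 0 k - g s 0 k).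
  by apply/funext => s; rewrite !mxE.
by have d1 := df k; have d2 := dg k; exact: is_deriveB.
Qed.

Section Spray.
Variables (R : realType) (n : nat).
Local Notation E := 'rV[R]_n.

(** Precomposition with this retraction onto [0, 1] extends a curve that is
    given on [0, 1] to a continuous curve on the whole line. *)
Definition clamp (t : R) : R := Num.max 0 (Num.min 1 t).

Lemma clamp_in t : clamp t \in `[0, 1].
Proof. by rewrite in_itv/= le_max lexx/= ge_max ler01/= ge_min lexx. Qed.

Lemma clamp_id t : t \in `[0, 1] -> clamp t = t.
Proof.
by rewrite in_itv/= => /andP[t0 t1]; rewrite /clamp (min_idPr t1) (max_idPr t0).
Qed.

Lemma clamp_continuous : continuous clamp.
Proof.
have H (t : R) : {for t, continuous ((fun=> 0) \max ((fun=> 1) \min (fun s => s)) : R -> R^o)}.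
  apply: continuous_max; first exact: cst_continuous.
  by apply: continuous_min; [exact: cst_continuous|exact: cvg_id].
exact: H.
Qed.

(* The right-hand side of c'' = S(c, c') has the growth and Lipschitz bounds of
   a quadratic form in the velocity whose coefficients depend smoothly on c. *)
Variables (S : E -> E -> E) (p : E) (r K : R).
Hypothesis K0 : 0 < K.
Hypothesis S_bound : forall c v, `|c - p| <= r -> `|S c v| <= K * `|v| ^+ 2.
Hypothesis S_lipschitz : forall c c' v v', `|c - p| <= r -> `|c' - p| <= r ->
  `|S c v - S c' v'| <= K * (`|v| ^+ 2 * `|c - c'| + (`|v| + `|v'|) * `|v - v'|).

(** Slow curves make the equation contractive: if the velocities are at most 2
    d and K d is small, then S changes at most half as much as its arguments. *)
Lemma spray_halving (d e : R) c c' v v' : 0 <= d -> d <= 1 -> 16 * K * d <= 1 ->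
  `|c - p| <= r -> `|c' - p| <= r -> `|v| <= 2 * d -> `|v'| <= 2 * d ->
  `|c - c'| <= e -> `|v - v'| <= e -> `|S c v - S c' v'| <= e / 2.
Proof.
move=> d0 d1 Kd cr c'r vd v'd ce ve.
have e0 : 0 <= e by exact: le_trans ce.
apply: (le_trans (S_lipschitz v v' cr c'r)).
have H1 : `|v| ^+ 2 * `|c - c'| <= 4 * d * e.
  apply: (@le_trans _ _ ((2 * d) ^+ 2 * e)).
    by rewrite ler_pM ?exprn_ge0//; exact: ler_sqr_mono.
  apply: ler_wpM2r => //; rewrite exprMn expr2.
  have : d ^+ 2 <= d by rewrite expr2 ler_piMr.
  lra.
have H2 : (`|v| + `|v'|) * `|v - v'| <= 4 * d * e.
  rewrite ler_pM ?addr_ge0//; apply: (le_trans (lerD vd v'd)); lra.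
apply: (@le_trans _ _ (K * (8 * d * e))).
  by rewrite (ler_pM2l K0); lra.
have : 16 * K * d * e <= e by rewrite ler_piMl.
lra.
Qed.

(** The unknown is the acceleration a. Its two primitives with zero boundary
    values give the deviation of c from the segment joining p to q, and the
    map sending a to S(c, c') preserves the bound 4 K d^2 and halves
    distances. *)
Lemma spray_bvp_exists q (d := `|q - p|) : d <= 1 -> 16 * K * d <= 1 -> 2 * d <= r ->
  exists c c1 : R -> E, [/\ c 0 = p, c 1 = q,
    forall t : R, t \in `](-1), 2[ -> row_derive c t (c1 t),
    forall t : R, t \in `]0, 1[ -> row_derive c1 t (S (c t) (c1 t)) &
    forall t : R, t \in `[0, 1] -> `|c t - p| <= 2 * d /\
      `|c1 t - (q - p)| <= 4 * K * d ^+ 2].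
Proof.
move=> d1 Kd dr.
have d0 : 0 <= d by exact: normr_ge0.
pose B := 4 * K * d ^+ 2.
have B0 : 0 <= B by rewrite /B mulr_ge0 ?exprn_ge0// mulr_ge0// ltW.
have Bd : B <= d.
  rewrite /B expr2 mulrA ler_piMl//.
  have : 0 <= K * d by rewrite mulr_ge0// ltW.
  lra.
have [W HW] : exists W : (R -> E) -> (R -> E) * (R -> E), forall a, continuous a ->
    [/\ (W a).1 0 = 0, (W a).1 1 = 0,
      forall t : R, t \in `](-1), 2[ -> row_derive (W a).1 t ((W a).2 t) &
      forall t : R, t \in `](-1), 2[ -> row_derive (W a).2 t (a t)].
  have H (a : R -> E) : exists w : (R -> E) * (R -> E), continuous a ->
      [/\ w.1 0 = 0, w.1 1 = 0,
      forall t : R, t \in `](-1), 2[ -> row_derive w.1 t (w.2 t) &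
      forall t : R, t \in `](-1), 2[ -> row_derive w.2 t (a t)].
    case: (pselect (continuous a)) => [ca|nca].
      by have [w [w1 H]] := row_bvp_solve ca; exists (w, w1).
    (* A dummy value: only continuous accelerations are integrated. *)
    by exists (a, a).
  by have [W HW] := choice H; exists W.
pose c a (t : R) : E := p + t *: (q - p) + (W a).1 t.
pose c1 a (t : R) : E := (q - p) + (W a).2 t.
pose Phi a (t : R) : E := S (c a (clamp t)) (c1 a (clamp t)).
have in01 (t : R) : t \in `[0, 1] -> t \in `](-1), 2[.
  by rewrite !in_itv/= => /andP[? ?]; apply/andP; split; lra.
have n1 : -1 <= 0 :> R by lra.
have n2 : 1 <= 2 :> R by lra.
have within (w w1 : R -> E) : (forall t : R, t \in `](-1), 2[ -> row_derive w t (w1 t)) ->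
    {within `[0, 1], continuous w}.
  move=> dw; apply: continuous_in_subspaceT => t; rewrite inE => /in01/dw.
  exact: row_derive_continuous.
have bnd a : continuous a -> (forall t, `|a t| <= B) -> forall t : R, t \in `[0, 1] ->
    [/\ `|c a t - p| <= 2 * d, `|c1 a t - (q - p)| <= B & `|c1 a t| <= 2 * d].
  move=> ca aB t tI; have [W0 W1 dW dW1] := HW a ca.
  have [|H1 H2] := row_bvp_bound n1 n2 B0 (within _ _ dW) W0 W1 dW dW1.
    by move=> s _ _; exact: aB.
  have h2 := H2 t tI; have h1 := H1 t (in01 _ tI) tI.
  split.
  - rewrite /c addrC -(addrA p) addKr.
    apply: (le_trans (ler_normD _ _)); rewrite normrZ.
    move: tI; rewrite in_itv/= => /andP[t0 t1]; rewrite (ger0_norm t0).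
    have : t * d <= d by rewrite ler_piMl.
    rewrite /d; move: h2 Bd; rewrite /d; lra.
  - by rewrite /c1 addrC addKr.
  - apply: (le_trans (ler_normD _ _)); move: h1 Bd; rewrite /d; lra.
have [a ca aB|a b e ca aB cb bB e0 ab t|a [ca aB aE]] := @contraction_fix R n Phi B B0.
- split=> [t|t]; last first.
    have [h1 _ h2] := bnd a ca aB _ (clamp_in t).
    apply: (le_trans (S_bound _ (le_trans h1 dr))).
    have : `|c1 a (clamp t)| ^+ 2 <= (2 * d) ^+ 2.
      exact: ler_sqr_mono.
    rewrite -(ler_pM2l K0) => h; apply: (le_trans h).
    by rewrite /B exprMn; lra.
  have [W0 W1 dW dW1] := HW a ca.
  have ctI := in01 _ (clamp_in t).
  have cc : {for t, continuous (c a \o clamp)}.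
    apply: continuous_comp; first exact: clamp_continuous.
    apply: cvgD; last exact: row_derive_continuous (dW _ ctI).
    apply: cvgD; first exact: cvg_cst.
    by apply: cvgZl; exact: cvg_id.
  have cc1 : {for t, continuous (c1 a \o clamp)}.
    apply: continuous_comp; first exact: clamp_continuous.
    by apply: cvgD; [exact: cvg_cst|exact: row_derive_continuous (dW1 _ ctI)].
  apply/cvgrPdist_le => e e0.
  move/cvgrPdist_le : cc => /(_ _ e0) cc; move/cvgrPdist_le : cc1 => /(_ _ e0) cc1.
  near=> s.
  have [h1 _ h2] := bnd a ca aB _ (clamp_in t).
  have [k1 _ k2] := bnd a ca aB _ (clamp_in s).
  have Hc : `|c a (clamp t) - c a (clamp s)| <= e by near: s.
  have Hv : `|c1 a (clamp t) - c1 a (clamp s)| <= e by near: s.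
  apply: (le_trans (spray_halving d0 d1 Kd (le_trans h1 dr) (le_trans k1 dr) h2 k2 Hc Hv)).
  by rewrite ler_pdivrMr// ler_peMr// ?ler1n//; exact: ltW.
- have [h1 _ h2] := bnd a ca aB _ (clamp_in t).
  have [k1 _ k2] := bnd b cb bB _ (clamp_in t).
  have [Wa0 Wa1 dWa dWa1] := HW a ca.
  have [Wb0 Wb1 dWb dWb1] := HW b cb.
  pose w (t : R) := (W a).1 t - (W b).1 t.
  pose w1 (t : R) := (W a).2 t - (W b).2 t.
  have dw (s : R) : s \in `](-1), 2[ -> row_derive w s (w1 s).
    by move=> sI; apply: row_deriveB; [exact: dWa|exact: dWb].
  have dw1 (s : R) : s \in `](-1), 2[ -> row_derive w1 s (a s - b s).
    by move=> sI; apply: row_deriveB; [exact: dWa1|exact: dWb1].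
  have w0 : w 0 = 0 by rewrite /w Wa0 Wb0 subrr.
  have w10 : w 1 = 0 by rewrite /w Wa1 Wb1 subrr.
  have [|H1 H2] := row_bvp_bound n1 n2 e0 (within _ _ dw) w0 w10 dw dw1.
    by move=> s _ _; exact: ab.
  apply: (spray_halving d0 d1 Kd (le_trans h1 dr) (le_trans k1 dr) h2 k2).
  + by rewrite /c opprD addrACA subrr add0r; exact: H2 (clamp_in t).
  + by rewrite /c1 opprD addrACA subrr add0r; apply: H1 (clamp_in t); exact: in01 (clamp_in t).
- have [W0 W1 dW dW1] := HW a ca.
  exists (c a), (c1 a); split.
  + by rewrite /c W0 scale0r !addr0.
  + by rewrite /c W1 scale1r addr0 addrC subrK.
  + move=> t /dW H k.
    have H' := H k.
    have -> : (fun s => c a s 0 k) = (fun s => p 0 k + s * (q - p) 0 k + (W a).1 s 0 k).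
      by apply/funext => s; rewrite !mxE.
    by apply: is_derive_eq; rewrite [RHS]mxE add0r mul1r scaler0 add0r [_%:A]mulr1.
  + move=> t tI; have tJ := subset_itv_oo_cc tI.
    have H := dW1 t (in01 _ tJ).
    have -> : S (c a t) (c1 a t) = a t by rewrite -aE /Phi clamp_id.
    move=> k; have H' := H k.
    have -> : (fun s => c1 a s 0 k) = (fun s => (q - p) 0 k + (W a).2 s 0 k).
      by apply/funext => s; rewrite !mxE.
    by apply: is_derive_eq; rewrite add0r mul1r.
  + by move=> t /(bnd a ca aB)[].
Unshelve. all: by end_near. Qed.

(** The difference w of two solutions vanishes at both ends. A bound of its
    second derivative is therefore a bound of w and of its velocity, and by
    [spray_halving] half of it is again a bound of the second derivative. *)
Lemma spray_bvp_unique (s : R) (c c1 c' c1' : R -> E) : 0 <= s -> s <= 2 -> 8 * K * s <= 1 ->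
  {within `[0, 1], continuous c} -> {within `[0, 1], continuous c'} ->
  c 0 = c' 0 -> c 1 = c' 1 ->
  (forall t : R, t \in `]0, 1[ -> [/\ row_derive c t (c1 t), row_derive c1 t (S (c t) (c1 t)),
     `|c t - p| <= r & `|c1 t| <= s]) ->
  (forall t : R, t \in `]0, 1[ -> [/\ row_derive c' t (c1' t), row_derive c1' t (S (c' t) (c1' t)),
     `|c' t - p| <= r & `|c1' t| <= s]) ->
  forall t : R, t \in `[0, 1] -> c t = c' t.
Proof.
move=> s0 s2 Ks cc cc' e0 e1 H H'.
pose w (t : R) := c t - c' t.
pose w1 (t : R) := c1 t - c1' t.
pose w2 (t : R) := S (c t) (c1 t) - S (c' t) (c1' t).
have cw : {within `[0, 1], continuous w}.
  by move=> t; apply: cvgB; [exact: cc|exact: cc'].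
have w0 : w 0 = 0 by rewrite /w e0 subrr.
have w10 : w 1 = 0 by rewrite /w e1 subrr.
have dw (t : R) : t \in `]0, 1[ -> row_derive w t (w1 t).
  by move=> tI; have [d1 _ _ _] := H t tI; have [d2 _ _ _] := H' t tI; exact: row_deriveB.
have dw1 (t : R) : t \in `]0, 1[ -> row_derive w1 t (w2 t).
  move=> tI; have [_ d1 _ _] := H t tI; have [_ d2 _ _] := H' t tI.
  exact: (@row_deriveB R n c1 (fun t => S (c t) (c1 t)) c1' (fun t => S (c' t) (c1' t))).
have main B : 0 <= B -> (forall t : R, t \in `]0, 1[ -> `|w2 t| <= B) ->
    (forall t : R, t \in `]0, 1[ -> `|w1 t| <= B) /\ (forall t : R, t \in `[0, 1] -> `|w t| <= B).
  move=> B0 HB.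
  have [|H1 H2] := row_bvp_bound (lexx 0) (lexx 1) B0 cw w0 w10 dw dw1.
    by move=> t tI _; exact: HB.
  by split=> // t tI; apply: H1 => //; exact: subset_itv_oo_cc tI.
pose X (t : R) := if t \in `]0, 1[ then `|w2 t| else 0.
have X0 : forall t, X t = 0.
  apply: (@halving_zero R R X (2 * (K * s ^+ 2))).
  - by rewrite !mulr_ge0 ?exprn_ge0//; exact: ltW.
  - move=> t; rewrite /X; case: ifP => tI; last first.
      by rewrite normr0 !mulr_ge0 ?exprn_ge0//; exact: ltW.
    rewrite normr_id; apply: (le_trans (ler_normB _ _)).
    have hb (a v : E) : `|a - p| <= r -> `|v| <= s -> `|S a v| <= K * s ^+ 2.
      move=> ar vs; apply: (le_trans (S_bound _ ar)).
      by rewrite (ler_pM2l K0); exact: ler_sqr_mono.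
    have [_ _ k1 k2] := H t tI; have [_ _ k3 k4] := H' t tI.
    by apply: (le_trans (lerD (hb _ _ k1 k2) (hb _ _ k3 k4))); lra.
  - move=> B B0 XB t; rewrite /X; case: ifP => tI; last first.
      by rewrite normr0 divr_ge0.
    have [H1 H2] : (forall t : R, t \in `]0, 1[ -> `|w1 t| <= B) /\
        (forall t : R, t \in `[0, 1] -> `|w t| <= B).
      by apply: main => // u uI; have := XB u; rewrite /X uI normr_id.
    have [_ _ k1 k2] := H t tI; have [_ _ k3 k4] := H' t tI.
    have sE : 2 * (s / 2) = s by rewrite mulrC divfK.
    rewrite normr_id; apply: (@spray_halving (s / 2)) => //; rewrite ?sE//.
    + by rewrite divr_ge0.
    + by rewrite ler_pdivrMr// mul1r.
    + by move: Ks; lra.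
    + by apply: H2; exact: subset_itv_oo_cc tI.
    + exact: H1.
have [||_ Hw] := @main 0 => // [t tI|].
  by have := X0 t; rewrite /X tI => ->.
by move=> t tI; apply/eqP; rewrite -subr_eq0 -normr_le0; exact: Hw.
Qed.

End Spray.

(** * The geodesic equation of the indicatrix *)

Section RealDerivatives.
Variable R : realType.
Lemma is_derive_mul (f f' : R -> R) (t d d' : R) :
  is_derive t 1 f d -> is_derive t 1 f' d' ->
  is_derive t 1 (fun s => f s * f' s) (d * f' t + f t * d').
Proof.
move=> df df'; apply: is_derive_eq.
by rewrite addrC mulrC.
Qed.

Lemma is_derive_bigsum (I : finType) (f : I -> R -> R) (d : I -> R) (t : R) :
  (forall i, is_derive t 1 (f i) (d i)) ->
  is_derive t 1 (fun s => \sum_i f i s) (\sum_i d i).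
Proof.
move=> df; have H : forall r : seq I,
    is_derive t 1 (fun s => \sum_(i <- r) f i s) (\sum_(i <- r) d i).
  elim=> [|i r IH].
    have -> : (fun s => \sum_(i <- [::]) f i s) = cst 0 by apply/funext => y; rewrite big_nil.
    by rewrite big_nil; exact: is_derive_cst.
  have -> : (fun s => \sum_(i <- i :: r) f i s) = (fun s => f i s + \sum_(i <- r) f i s).
    by apply/funext => y; rewrite big_cons.
  by rewrite big_cons; have dfi := df i; exact: is_deriveD.
exact: H.
Qed.

Lemma is_derive_locally_cst (f : R -> R) (c t d : R) (a b : R) : t \in `]a, b[ ->
  (forall s : R, s \in `]a, b[ -> f s = c) -> is_derive t 1 f d -> d = 0.
Proof.
move=> tI fc [_ <-].
rewrite -(derive_cst c t 1); apply: near_eq_derive.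
by have : \forall s \near t, s \in `]a, b[ by [exact: near_in_itvoo]; apply: filterS => s /fc.
Qed.

End RealDerivatives.

Section Forms.
Variables (R : realType) (n : nat) (U : set 'rV[R]_n).
Hypothesis U_open : open U.
Local Notation E := 'rV[R]_n.
Variable F : E -> E -> R.
Hypothesis hF : finsler U F.
Implicit Types (x y v w : E) (i j k m : 'I_n).

Definition gform x y v w : R := \sum_i \sum_j g F i j x y * v 0 i * w 0 j.

Definition lform x y w : R := \sum_m llow F m x y * w 0 m.

(** The quadratic map v |-> Gamma^k_ij v^i v^j. *)
Definition gamma x y v : E :=
  \row_k \sum_i \sum_j christoffel F k i j x y * v 0 i * v 0 j.

(** The acceleration of a geodesic of the indicatrix: the normal direction at
    y is y itself, and the second derivative of F = 1 along the curve fixes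
    the normal component as - g(v, v). *)
Definition spray x y v : E := - gform x y v v *: y - gamma x y v.

Lemma gform_sym x y v w : U x -> y != 0 -> gform x y v w = gform x y w v.
Proof.
move=> Ux y0; rewrite /gform exchange_big /=; apply: eq_bigr => i _.
by apply: eq_bigr => j _; rewrite (g_sym U_open hF j i Ux y0) -!mulrA [v 0 j * _]mulrC.
Qed.

Lemma gformDl x y u v w : gform x y (u + v) w = gform x y u w + gform x y v w.
Proof.
rewrite /gform -big_split; apply: eq_bigr => i _; rewrite -big_split.
by apply: eq_bigr => j _; rewrite mxE mulrDr mulrDl.
Qed.

Lemma gformZl x y (a : R) v w : gform x y (a *: v) w = a * gform x y v w.
Proof.
rewrite /gform mulr_sumr; apply: eq_bigr => i _; rewrite mulr_sumr.
by apply: eq_bigr => j _; rewrite mxE mulrCA -!mulrA.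
Qed.

Lemma gformNl x y v w : gform x y (- v) w = - gform x y v w.
Proof. by rewrite -scaleN1r gformZl mulN1r. Qed.

Lemma gformBl x y u v w : gform x y (u - v) w = gform x y u w - gform x y v w.
Proof. by rewrite gformDl gformNl. Qed.

Lemma gformDr x y u v w : gform x y w (u + v) = gform x y w u + gform x y w v.
Proof.
rewrite /gform -big_split; apply: eq_bigr => i _; rewrite -big_split.
by apply: eq_bigr => j _; rewrite mxE mulrDr.
Qed.

Lemma gformZr x y (a : R) v w : gform x y v (a *: w) = a * gform x y v w.
Proof.
rewrite /gform mulr_sumr; apply: eq_bigr => i _; rewrite mulr_sumr.
by apply: eq_bigr => j _; rewrite mxE mulrCA.
Qed.

Lemma lformD x y u v : lform x y (u + v) = lform x y u + lform x y v.
Proof. by rewrite /lform -big_split; apply: eq_bigr => i _; rewrite mxE mulrDr. Qed.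

Lemma lformZ x y (a : R) v : lform x y (a *: v) = a * lform x y v.
Proof. by rewrite /lform mulr_sumr; apply: eq_bigr => i _; rewrite mxE mulrCA. Qed.

Lemma lform_self x y : U x -> y != 0 -> lform x y y = F x y.
Proof.
move=> Ux y0; rewrite -(llow_euler hF Ux y0).
by apply: eq_bigr => i _; rewrite mulrC.
Qed.

Lemma gform_self x y w : U x -> y != 0 -> gform x y y w = F x y * lform x y w.
Proof.
move=> Ux y0; rewrite /gform exchange_big /lform mulr_sumr; apply: eq_bigr => j _.
rewrite mulrA -(g_euler U_open hF j Ux y0) mulr_suml.
by apply: eq_bigr => i _; rewrite [g F _ _ _ _ * _]mulrC.
Qed.

Lemma gform_gt0 x y v : U x -> y != 0 -> v != 0 -> 0 < gform x y v v.
Proof. exact: (finsler_posdef hF). Qed.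

Lemma gform_ge0 x y v : U x -> y != 0 -> 0 <= gform x y v v.
Proof.
move=> Ux y0; have [->|v0] := eqVneq v 0; last exact: ltW (gform_gt0 Ux y0 v0).
rewrite /gform big1// => i _; rewrite big1// => j _.
by rewrite !mxE !mulr0.
Qed.

Lemma gform_eq0 x y v : U x -> y != 0 -> gform x y v v = 0 -> v = 0.
Proof.
move=> Ux y0 gv; apply/eqP/negPn/negP => v0.
by have := gform_gt0 Ux y0 v0; rewrite gv ltxx.
Qed.

Lemma gform_gamma x y v w : U x -> y != 0 -> gform x y (gamma x y v) w =
  2^-1 * \sum_m w 0 m * \sum_i \sum_j pd m (g F i j x) y * v 0 i * v 0 j.
Proof.
move=> Ux y0; rewrite /gform exchange_big mulr_sumr; apply: eq_bigr => m _ /=.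
rewrite -mulr_suml mulrC mulrCA; congr (_ * _).
under [LHS]eq_bigr => k _.
  rewrite (g_sym U_open hF k m Ux y0) mxE mulr_sumr.
  under eq_bigr => i _ do rewrite mulr_sumr.
over.
rewrite [LHS]exchange_big mulr_sumr; apply: eq_bigr => i _ /=.
rewrite [LHS]exchange_big mulr_sumr; apply: eq_bigr => j _ /=.
rewrite [RHS]mulrA [2^-1 * (_ * _)]mulrA -(g_christoffel U_open hF m i j Ux y0) !mulr_suml.
by apply: eq_bigr => k _; rewrite !mulrA.
Qed.

Lemma lform_gamma x y v : U x -> y != 0 -> lform x y (gamma x y v) = 0.
Proof.
move=> Ux y0; rewrite /lform.
under eq_bigr => k _.
  rewrite mxE mulr_sumr; under eq_bigr => i _ do rewrite mulr_sumr.
over.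
rewrite exchange_big big1// => i _ /=; rewrite exchange_big big1// => j _ /=.
under eq_bigr => k _ do rewrite -mulrA mulrA.
by rewrite -mulr_suml (llow_christoffel U_open hF i j Ux y0) mul0r.
Qed.

Lemma accelerationE x c t : acceleration F x c t =
  velocity (velocity c) t + gamma x (c t) (velocity c t).
Proof. by apply/rowP => k; rewrite !mxE. Qed.

Section Curve.
Variables (x : E) (c c1 c2 : R -> E) (t : R).
Hypotheses (Ux : U x) (ct0 : c t != 0).
Hypotheses (dc : row_derive c t (c1 t)) (dc1 : row_derive c1 t (c2 t)).

Lemma smooth2_along (f : E -> E -> R) : smooth2 U f ->
  is_derive t 1 (fun s => f x (c s)) (\sum_k c1 t 0 k * pd k (f x) (c t)).
Proof.
move=> sf; have [dct <-] := (row_deriveP c t (c1 t)).1 dc.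
have df := smooth2_diff2 sf Ux ct0.
by rewrite -(derive_row _ df); exact: chain_rule.
Qed.

Lemma F2_along : is_derive t 1 (fun s => 2^-1 * F x (c s) ^+ 2)
  (\sum_k denergy F k x (c t) * c1 t 0 k).
Proof.
have s1 := smooth2M U_open (smooth2_cst U_open 2^-1) (smooth_F2 U_open hF).
have H := smooth2_along s1.
have <- : \sum_k c1 t 0 k * pd k (fun y => 2^-1 * F x y ^+ 2) (c t) =
    \sum_k denergy F k x (c t) * c1 t 0 k.
  apply: eq_bigr => k _; rewrite mulrC; congr (_ * _).
  exact: (deriveZf _ _ (smooth2_diff2 (smooth_F2 U_open hF) Ux ct0)).
exact: H.
Qed.

Lemma dF2_along : is_derive t 1 (fun s => \sum_k denergy F k x (c s) * c1 s 0 k)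
  (gform x (c t) (c1 t) (c1 t) + \sum_k denergy F k x (c t) * c2 t 0 k).
Proof.
have H k : is_derive t 1 (fun s => denergy F k x (c s) * c1 s 0 k)
    ((\sum_j c1 t 0 j * g F j k x (c t)) * c1 t 0 k + denergy F k x (c t) * c2 t 0 k).
  apply: is_derive_mul; last exact: dc1.
  have := smooth2_along (smooth_denergy U_open hF k).
  by under eq_bigr => j _ do rewrite (pd_denergy U_open hF j k Ux ct0).
have := is_derive_bigsum H; rewrite big_split /=.
suff -> : \sum_k (\sum_j c1 t 0 j * g F j k x (c t)) * c1 t 0 k =
  gform x (c t) (c1 t) (c1 t) by [].
rewrite /gform exchange_big; apply: eq_bigr => k _; rewrite mulr_suml.
by apply: eq_bigr => j _; rewrite [g F _ _ _ _ * _]mulrC.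
Qed.

Lemma gform_along : is_derive t 1 (fun s => gform x (c s) (c1 s) (c1 s))
  (\sum_m c1 t 0 m * (\sum_i \sum_j pd m (g F i j x) (c t) * c1 t 0 i * c1 t 0 j)
   + 2 * gform x (c t) (c2 t) (c1 t)).
Proof.
have H i j : is_derive t 1 (fun s => g F i j x (c s) * c1 s 0 i * c1 s 0 j)
    (((\sum_m c1 t 0 m * pd m (g F i j x) (c t)) * c1 t 0 i + g F i j x (c t) * c2 t 0 i)
      * c1 t 0 j + g F i j x (c t) * c1 t 0 i * c2 t 0 j).
  apply: is_derive_mul; last exact: dc1.
  apply: is_derive_mul; last exact: dc1.
  exact: smooth2_along (smooth_g U_open hF i j).
have {}H := is_derive_bigsum (fun i => is_derive_bigsum (H i)).
apply: (is_derive_eq H).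
under eq_bigr => i _ do rewrite big_split /=.
rewrite big_split /= -/(gform x (c t) (c1 t) (c2 t)).
under eq_bigr => i _.
  under eq_bigr => j _ do rewrite mulrDl.
  rewrite big_split /=.
over.
rewrite big_split /= -/(gform x (c t) (c2 t) (c1 t)).
rewrite (gform_sym _ _ Ux ct0) -addrA -mulr2n mulr_natl; congr (_ + _).
under [RHS]eq_bigr => m _.
  rewrite mulr_sumr; under eq_bigr => i _ do rewrite mulr_sumr.
over.
rewrite [RHS]exchange_big; apply: eq_bigr => i _.
rewrite [RHS]exchange_big; apply: eq_bigr => j _.
by rewrite !mulr_suml; apply: eq_bigr => m _; rewrite !mulrA.
Qed.

End Curve.
End Forms.

(** * Solutions of the geodesic equation *)

Lemma derive0_constant (R : realType) (f : R -> R) (a b : R) :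
  (forall t : R, t \in `]a, b[ -> is_derive t 1 f 0) ->
  forall s t : R, s \in `]a, b[ -> t \in `]a, b[ -> f s = f t.
Proof.
move=> df; have key (s t : R) : s <= t -> s \in `]a, b[ -> t \in `]a, b[ -> f s = f t.
  move=> st sI tI.
  have inI (u : R) : u \in `[s, t] -> u \in `]a, b[.
    move: sI tI; rewrite !in_itv/= => /andP[s0 s1] /andP[t0 t1] /andP[su ut].
    by rewrite (lt_le_trans s0 su) (le_lt_trans ut t1).
  have cf : {within `[s, t], continuous f}.
    by apply: derivable_within_continuous => u /inI/df[].
  have d1 (u : R) : u \in `]s, t[ -> is_derive u 1 f 0.
    by move=> /subset_itv_oo_cc/inI/df.
  have d0 (u : R) : u \in `]s, t[ -> `|(0 : R)| <= 0 by rewrite normr0.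
  have := mvt_bound st cf d1 d0.
  by rewrite mul0r normr_le0 subr_eq0 => /eqP.
by move=> s t sI tI; case: (leP s t) => [st|/ltW ts]; [exact: key|apply/esym/key].
Qed.

Section Geodesics.
Variables (R : realType) (n : nat) (U : set 'rV[R]_n).
Hypothesis U_open : open U.
Local Notation E := 'rV[R]_n.
Variable F : E -> E -> R.
Hypothesis hF : finsler U F.
Implicit Types (x y v w p q : E).

Lemma denergy_lform x y w : U x -> y != 0 ->
  \sum_k denergy F k x y * w 0 k = F x y * lform F x y w.
Proof.
move=> Ux y0; rewrite /lform mulr_sumr; apply: eq_bigr => k _.
by rewrite (denergyE hF k Ux y0) mulrA.
Qed.

Lemma F_at0 x : U x -> F x 0 = 0.
Proof.
move=> Ux; have := finsler_homo hF 0 Ux (ltr0n R 2).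
rewrite scaler0 => /eqP; rewrite -subr_eq0 -[X in X - _]mul1r -mulrBl mulf_eq0.
by rewrite -opprB oppr_eq0 subr_eq0 => /orP[/eqP h|/eqP//]; lra.
Qed.

Lemma indicatrix_neq0 x y : U x -> F x y = 1 -> y != 0.
Proof.
move=> Ux Fy; apply/eqP => y0; move: Fy; rewrite y0 (F_at0 Ux) => /eqP.
by rewrite eq_sym oner_eq0.
Qed.

Lemma lform_spray x y v : U x -> y != 0 ->
  lform F x y (spray F x y v) = - gform F x y v v * F x y.
Proof.
move=> Ux y0; rewrite /spray lformD lformZ (lform_self hF Ux y0).
by rewrite -[- gamma F x y v]scaleN1r lformZ (lform_gamma U_open hF _ Ux y0) mulr0 addr0.
Qed.

(** The defect u = (F^2 - 1) / 2 satisfies u'' = - 2 g(c', c') u along a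
    solution of the spray equation, hence vanishes when it vanishes at both
    ends of a slow solution. *)
Lemma spray_stays x (c c1 : R -> E) : U x ->
  (forall t : R, t \in `[0, 1] -> {for t, continuous c}) ->
  (forall t : R, t \in `[0, 1] -> c t != 0) ->
  F x (c 0) = 1 -> F x (c 1) = 1 ->
  (forall t : R, t \in `]0, 1[ -> [/\ row_derive c t (c1 t),
    row_derive c1 t (spray F x (c t) (c1 t)) & gform F x (c t) (c1 t) (c1 t) <= 4^-1]) ->
  forall t : R, t \in `[0, 1] -> F x (c t) = 1.
Proof.
move=> Ux cc c0 F0 F1 H.
pose u (t : R) := 2^-1 * F x (c t) ^+ 2 - 2^-1.
pose u1 (t : R) := \sum_k denergy F k x (c t) * c1 t 0 k.
pose u2 (t : R) := - (2 * gform F x (c t) (c1 t) (c1 t) * u t).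
have cu : {within `[0, 1], continuous u}.
  apply: continuous_in_subspaceT => t; rewrite inE => tI.
  have cF : {for t, continuous (fun s => F x (c s))}.
    apply: (@continuous_comp _ _ _ c (F x)); first exact: cc.
    apply: differentiable_continuous.
    exact: (smooth2_diff2 (smooth_F hF) Ux (c0 t tI)).
  apply: cvgB; last exact: cvg_cst.
  by apply: cvgM; [exact: cvg_cst|apply: cvgM; exact: cF].
have u0 : u 0 = 0 by rewrite /u F0 expr1n mulr1 subrr.
have u10 : u 1 = 0 by rewrite /u F1 expr1n mulr1 subrr.
have du (t : R) : t \in `]0, 1[ -> is_derive t 1 u (u1 t).
  move=> tI; have [d1 _ _] := H t tI; have ct0 := c0 t (subset_itv_oo_cc tI).
  have d2 := F2_along U_open hF Ux ct0 d1.
  by apply: is_derive_eq; rewrite scaler0 subr0.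
have du1 (t : R) : t \in `]0, 1[ -> is_derive t 1 u1 (u2 t).
  move=> tI; have [d1 d2 _] := H t tI; have ct0 := c0 t (subset_itv_oo_cc tI).
  have := @dF2_along _ _ _ U_open _ hF x c c1 (fun s => spray F x (c s) (c1 s)) t
    Ux ct0 d1 d2.
  rewrite (denergy_lform _ Ux ct0) (lform_spray _ Ux ct0).
  congr (is_derive _ _ _ _); rewrite /u2 /u; set G := gform _ _ _ _ _; by field.
have main B : (forall t : R, t \in `[0, 1] -> `|u t| <= B) ->
    forall t : R, t \in `[0, 1] -> `|u t| <= B / 2.
  move=> HB.
  have HB2 (t : R) : t \in `]0, 1[ -> t \in `[0, 1] -> `|u2 t| <= B / 2; last first.
    by have [_] := bvp_bound (lexx 0) (lexx 1) cu u0 u10 du du1 HB2.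
  move=> tI tJ; have [_ _ g4] := H t tI.
  have g0 := gform_ge0 hF (c1 t) Ux (c0 t tJ).
  have B0 : 0 <= B by apply: le_trans (HB t tJ).
  rewrite /u2 normrN normrM ger0_norm ?mulr_ge0// mulrC.
  apply: ler_pM => //; [by rewrite mulr_ge0|exact: HB|lra].
(* An initial bound of u, with which the halving starts. *)
have [tm tmI Hm] : exists2 s : R, s \in `[0, 1] & forall t : R, t \in `[0, 1] -> `|u t| <= `|u s|.
  apply: EVT_max => // t.
  by apply: cvg_norm; exact: cu.
pose X (t : R) := if t \in `[0, 1] then u t else 0.
have X0 : forall t, X t = 0.
  apply: (@halving_zero R R X `|u tm|) => // [t|B B0 XB t].
    by rewrite /X; case: ifP => [/Hm//|_]; rewrite normr0.
  rewrite /X; case: ifP => tI; last by rewrite normr0 divr_ge0.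
  by apply: main => // s sI; have := XB s; rewrite /X sI.
move=> t tI; have := X0 t; rewrite /X tI /u => /eqP.
rewrite subr_eq0 -[X in _ == X]mulr1 => /eqP/mulfI e.
have /eqP : F x (c t) ^+ 2 = 1 by apply: e; rewrite invr_eq0.
by rewrite sqrf_eq1 => /orP[/eqP//|/eqP e1]; have := F_gt0 hF Ux (c0 t tI); rewrite e1; lra.
Qed.

Lemma velocity_eq (a b : R) (c c1 : R -> E) :
  (forall t : R, t \in `]a, b[ -> row_derive c t (c1 t)) ->
  forall t : R, t \in `]a, b[ -> derivable c t 1 /\ velocity c t = c1 t.
Proof. by move=> H t /H/row_deriveP. Qed.

Lemma row_derive_near (a b : R) (c c' : R -> E) (d : E) (t : R) : t \in `]a, b[ ->
  (forall s : R, s \in `]a, b[ -> c s = c' s) -> row_derive c t d -> row_derive c' t d.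
Proof.
move=> tI cc' H k; have := H k; apply: near_eq_is_derive.
have : \forall s \near t, s \in `]a, b[ by exact: near_in_itvoo.
by apply: filterS => s /cc' ->.
Qed.

(** The covariant acceleration is - g(c', c') c, and g(c, w) = F l(w) is zero
    on the tangent space of the indicatrix. *)
Lemma spray_geodesic x (c c1 : R -> E) : U x ->
  {within `[0, 1], continuous c} ->
  (forall t : R, t \in `[0, 1] -> F x (c t) = 1) ->
  (forall t : R, t \in `]0, 1[ -> row_derive c t (c1 t) /\
    row_derive c1 t (spray F x (c t) (c1 t))) ->
  geodesic_arc F x (c 0) (c 1) c.
Proof.
move=> Ux cc Fc H.
have dc (t : R) : t \in `]0, 1[ -> row_derive c t (c1 t) by move=> /H[].
have vE (t : R) : t \in `]0, 1[ -> velocity c t = c1 t by move=> /(velocity_eq dc)[].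
have dv (t : R) : t \in `]0, 1[ -> row_derive (velocity c) t (spray F x (c t) (c1 t)).
  move=> tI; have [_] := H t tI; apply: (row_derive_near tI) => s sI.
  by rewrite vE.
split=> //.
- move=> t tI; split; first by have [] := velocity_eq dc tI.
  by have /row_deriveP[] := dv t tI.
- move=> t w tI wl; have ct0 := indicatrix_neq0 Ux (Fc t (subset_itv_oo_cc tI)).
  have /row_deriveP[_ aE] := dv t tI.
  rewrite -/(gform F x (c t) _ w) accelerationE /velocity aE -/(velocity c t) (vE t tI).
  rewrite /spray subrK gformZl (gform_self U_open hF w Ux ct0) /lform wl.
  by rewrite !mulr0.
Qed.

(** The second derivative of F = 1 gives the component along c of the
    covariant acceleration A. The rest W of A is tangent, so g(A, W) = g(c, W)
    = 0 and thus g(W, W) = 0. *)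
Lemma geodesic_spray x p q (c : R -> E) : U x -> geodesic_arc F x p q c ->
  forall t : R, t \in `]0, 1[ -> [/\ c t != 0, row_derive c t (velocity c t),
    row_derive (velocity c) t (spray F x (c t) (velocity c t)) &
    lform F x (c t) (velocity c t) = 0].
Proof.
move=> Ux [_ _ Fc dc acc].
have F1 (t : R) : t \in `]0, 1[ -> F x (c t) = 1 by move=> /subset_itv_oo_cc/Fc.
have c0 (t : R) : t \in `]0, 1[ -> c t != 0 by move=> /F1; exact: indicatrix_neq0.
have d1 (t : R) : t \in `]0, 1[ -> row_derive c t (velocity c t).
  by move=> /dc[d _]; apply/row_deriveP.
have d2 (t : R) : t \in `]0, 1[ -> row_derive (velocity c) t (velocity (velocity c) t).
  by move=> /dc[_ d]; apply/row_deriveP.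
have e1 (t : R) : t \in `]0, 1[ -> \sum_k denergy F k x (c t) * velocity c t 0 k = 0.
  move=> tI; apply: (is_derive_locally_cst tI) (F2_along U_open hF Ux (c0 t tI) (d1 t tI)).
  by move=> s /F1 ->; rewrite expr1n.
have e2 (t : R) : t \in `]0, 1[ -> gform F x (c t) (velocity c t) (velocity c t) +
    \sum_k denergy F k x (c t) * velocity (velocity c) t 0 k = 0.
  move=> tI; apply: (is_derive_locally_cst tI)
    (dF2_along U_open hF Ux (c0 t tI) (d1 t tI) (d2 t tI)).
  exact: e1.
move=> t tI; have ct0 := c0 t tI; have Ft := F1 t tI.
have l1 : lform F x (c t) (velocity c t) = 0.
  by have := e1 t tI; rewrite (denergy_lform _ Ux ct0) Ft mul1r.
split=> //; first exact: d1.
have := d2 t tI; suff -> : velocity (velocity c) t = spray F x (c t) (velocity c t) by [].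
pose A := acceleration F x c t.
have lA : lform F x (c t) A = - gform F x (c t) (velocity c t) (velocity c t).
  rewrite /A accelerationE lformD (lform_gamma U_open hF _ Ux ct0) addr0.
  have /eqP := e2 t tI; rewrite (denergy_lform _ Ux ct0) Ft mul1r addrC addr_eq0.
  by move=> /eqP.
(* The tangential part of the acceleration. *)
pose W := A - lform F x (c t) A *: c t.
have lW : lform F x (c t) W = 0.
  by rewrite /W lformD -scaleNr lformZ (lform_self hF Ux ct0) Ft mulr1 subrr.
have gAW : gform F x (c t) A W = 0 by apply: acc.
have gcW : gform F x (c t) (c t) W = 0.
  by rewrite (gform_self U_open hF _ Ux ct0) lW mulr0.
have /(gform_eq0 hF Ux ct0) W0 : gform F x (c t) W W = 0.
  by rewrite {1}/W gformBl gformZl gAW gcW mulr0 subrr.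
have AE : A = lform F x (c t) A *: c t by apply/eqP; rewrite -subr_eq0 -/W W0.
move: AE; rewrite lA /A accelerationE => /(canRL (addrK _)) ->.
by rewrite /spray.
Qed.

(** In the derivative of g(c', c') the variation of g cancels against the
    Christoffel term, and what remains is a multiple of g(c, c') = F l(c') =
    0. *)
Lemma geodesic_speed_cst x p q (c : R -> E) : U x -> geodesic_arc F x p q c ->
  forall t : R, t \in `]0, 1[ -> is_derive t 1
    (fun s => gform F x (c s) (velocity c s) (velocity c s)) 0.
Proof.
move=> Ux gc t tI; have [ct0 d1 d2 l0] := geodesic_spray Ux gc tI.
have := @gform_along _ _ _ U_open _ hF x c (velocity c)
  (fun s => spray F x (c s) (velocity c s)) t Ux ct0 d1 d2.
set v := velocity c t.
suff -> : \sum_m v 0 m * (\sum_i \sum_j pd m (g F i j x) (c t) * v 0 i * v 0 j)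
    + 2 * gform F x (c t) (spray F x (c t) v) v = 0 by [].
rewrite /spray gformBl gformZl (gform_gamma U_open hF v v Ux ct0).
rewrite (gform_self U_open hF v Ux ct0) l0 !mulr0 sub0r mulrN mulrA divff//.
by rewrite mul1r subrr.
Qed.

Lemma geodesic_speed x p q (c : R -> E) : U x -> geodesic_arc F x p q c ->
  forall s t : R, s \in `]0, 1[ -> t \in `]0, 1[ ->
  gform F x (c s) (velocity c s) (velocity c s) =
  gform F x (c t) (velocity c t) (velocity c t).
Proof.
move=> Ux gc; exact: (derive0_constant (geodesic_speed_cst Ux gc)).
Qed.

Lemma arc_length_speed x p q (c : R -> E) : U x -> geodesic_arc F x p q c ->
  forall t : R, t \in `]0, 1[ -> arc_length F x c =
  Num.sqrt (gform F x (c t) (velocity c t) (velocity c t)).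
Proof.
move=> Ux gc t tI; rewrite /arc_length.
set L := RHS.
transitivity (\int[lebesgue_measure]_(s in `]0, 1[) (cst L s))%R.
  apply: eq_Rintegral => s; rewrite inE /= => sI.
  by rewrite -/(gform F x (c s) _ _) (geodesic_speed Ux gc sI tI).
rewrite Rintegral_cst; last exact: measurable_itv.
by rewrite /= lebesgue_measure_itv/= lte_fin ltr01 sube0/= mulr1.
Qed.

End Geodesics.

(** * Estimates uniform in the base point *)

Section Quadratic.
Variables (R : realType) (n : nat).
Local Notation E := 'rV[R]_n.
Implicit Types (q : 'I_n -> 'I_n -> R) (v w : E).

Definition quad q v : R := \sum_i \sum_j q i j * v 0 i * v 0 j.

Lemma double_sum_le (f : 'I_n -> 'I_n -> R) (C : R) :
  (forall i j, `|f i j| <= C) -> `|\sum_i \sum_j f i j| <= (n ^ 2)%:R * C.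
Proof.
move=> fC; apply: (le_trans (ler_norm_sum _ _ _)).
apply: (@le_trans _ _ (\sum_(i < n) \sum_(j < n) C)).
  apply: ler_sum => i _; apply: (le_trans (ler_norm_sum _ _ _)).
  by apply: ler_sum => j _; exact: fC.
by rewrite !sumr_const !card_ord -mulrnA mulr_natl expnS expn1.
Qed.

Lemma quad_bound q (C : R) v : (forall i j, `|q i j| <= C) ->
  `|quad q v| <= (n ^ 2)%:R * C * `|v| ^+ 2.
Proof.
move=> qC; rewrite -mulrA; apply: double_sum_le => i j.
rewrite -mulrA normrM normrM expr2.
by apply: ler_pM => //; apply: ler_pM => //; exact: coord_le.
Qed.

Lemma quad_lipschitz q q' (C D : R) v w :
  (forall i j, `|q' i j| <= C) -> (forall i j, `|q i j - q' i j| <= C * D) ->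
  `|quad q v - quad q' w| <=
    (n ^ 2)%:R * C * (`|v| ^+ 2 * D + (`|v| + `|w|) * `|v - w|).
Proof.
move=> qC qD; rewrite -mulrA /quad -sumrB.
under eq_bigr => i _ do rewrite -sumrB.
apply: double_sum_le => i j.
have -> : q i j * v 0 i * v 0 j - q' i j * w 0 i * w 0 j =
  (q i j - q' i j) * (v 0 i * v 0 j) +
  q' i j * ((v - w) 0 i * v 0 j + w 0 i * (v - w) 0 j) by rewrite !mxE; ring.
rewrite [leRHS]mulrDr; apply: (le_trans (ler_normD _ _)); apply: lerD.
  rewrite !normrM [leRHS](_ : _ = C * D * (`|v| * `|v|)); last by ring.
  by apply: ler_pM => //; apply: ler_pM => //; exact: coord_le.
rewrite normrM; apply: ler_pM => //.
apply: (le_trans (ler_normD _ _)); rewrite !normrM [leRHS]mulrDl; apply: lerD.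
  by rewrite mulrC; apply: ler_pM => //; exact: coord_le.
by apply: ler_pM => //; exact: coord_le.
Qed.

End Quadratic.

Section Compactness.
Variables (R : realType) (n : nat).
Local Notation E := 'rV[R]_n.

Lemma norm_le_closed (z : E) (r : R) : closed [set x : E | `|x - z| <= r].
Proof.
have -> : [set x : E | `|x - z| <= r] = (fun x => `|x - z|) @^-1` [set s : R | s <= r] by [].
apply: closed_comp; last exact: closed_le.
move=> x _; apply: (@continuous_comp _ _ _ (fun x : E => x - z) (fun u => `|u|)).
  by apply: differentiable_continuous; exact: differentiableB.
exact: norm_continuous.
Qed.

Lemma norm_ball_compact (z : E) (r : R) : compact [set x : E | `|x - z| <= r].
Proof.
apply: bounded_closed_compact; last exact: norm_le_closed.
exists (`|z| + r); split; first exact: num_real.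
move=> M HM x /= xz; have -> : x = x - z + z by rewrite subrK.
apply: (le_trans (ler_normD _ _)); move: xz HM; set u := `|x - z|; lra.
Qed.

Lemma annulus_compact (a b : R) : compact [set y : E | a <= `|y| /\ `|y| <= b].
Proof.
have -> : [set y : E | a <= `|y| /\ `|y| <= b] =
    [set y : E | `|y - 0| <= b] `&` [set y : E | a <= `|y|].
  by apply/seteqP; split=> y /=; rewrite subr0 => -[].
apply: compact_closedI; first exact: norm_ball_compact.
have -> : [set y : E | a <= `|y|] = (fun y => `|y|) @^-1` [set s : R | a <= s] by [].
by apply: closed_comp; [move=> y _; exact: norm_continuous|exact: closed_ge].
Qed.

End Compactness.

Lemma continuous_sumf (R : realType) (V : topologicalType) (I : finType) (f : I -> V -> R) (z : V) :
  (forall i, {for z, continuous (f i)}) -> {for z, continuous (fun z => \sum_i f i z)}.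
Proof.
move=> cf; have H : forall r : seq I, {for z, continuous (fun z => \sum_(i <- r) f i z)}.
  elim=> [|i r IH].
    have -> : (fun z => \sum_(i <- [::]) f i z) = cst 0 by apply/funext => y; rewrite big_nil.
    exact: cst_continuous.
  have -> : (fun z => \sum_(i <- i :: r) f i z) = (fun z => f i z + \sum_(i <- r) f i z).
    by apply/funext => y; rewrite big_cons.
  by apply: cvgD; [exact: cf|exact: IH].
exact: H.
Qed.

Lemma rescale_lower (R : realType) (C r G : R) : 0 < C -> 0 < r -> 0 < G ->
  `|(r^-1 * (r^-1 * G))^-1| <= C -> C^-1 * r ^+ 2 <= G.
Proof.
move=> C0 r0 G0; have -> : (r^-1 * (r^-1 * G))^-1 = r ^+ 2 / G.
  by field; rewrite !gt_eqF.
have q0 : 0 <= r ^+ 2 / G by apply: divr_ge0; [rewrite exprn_ge0// ltW|exact: ltW].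
rewrite (ger0_norm q0) ler_pdivrMr// => H.
by rewrite mulrC ler_pdivrMr// mulrC.
Qed.

Section LocalConstants.
Variables (R : realType) (n : nat) (U : set 'rV[R]_n).
Hypothesis U_open : open U.
Local Notation E := 'rV[R]_n.
Variable F : E -> E -> R.
Hypothesis hF : finsler U F.
Implicit Types (x y v w p q : E).

(** One family collects the coefficients, as quadratic forms in the velocity,
    of g itself (index None) and of all entries of the spray, so that they are
    bounded together on a compact set. *)
Definition spray_coef (o : option 'I_n) (i j : 'I_n) x y : R :=
  if o is Some k then - (g F i j x y * y 0 k) - christoffel F k i j x y
  else g F i j x y.

Lemma smooth_spray_coef o i j : smooth2 U (spray_coef o i j).
Proof.
case: o => [k|]; last exact: smooth_g.
apply: (smooth2B U_open); last exact: (smooth_christoffel U_open hF).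
apply: (smooth2N U_open); apply: (smooth2M U_open); first exact: smooth_g.
exact: smooth2_coord.
Qed.

Lemma gform_quad x y v : gform F x y v v = quad (fun i j => spray_coef None i j x y) v.
Proof. by []. Qed.

Lemma sub_coord v w k : (v - w) 0 k = v 0 k - w 0 k.
Proof. by rewrite !mxE. Qed.

Lemma spray_quad x y v k :
  spray F x y v 0 k = quad (fun i j => spray_coef (Some k) i j x y) v.
Proof.
rewrite /spray /gamma /gform /quad !mxE mulNr mulr_suml.
rewrite -opprD -big_split /= -sumrN; apply: eq_bigr => i _.
rewrite mulr_suml -big_split /= -sumrN; apply: eq_bigr => j _.
by ring.
Qed.

Lemma spray_bound x y v (C : R) : 0 <= C -> (forall o i j, `|spray_coef o i j x y| <= C) ->
  `|spray F x y v| <= (n ^ 2)%:R * C * `|v| ^+ 2.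
Proof.
move=> C0 sC; apply: norm_le => [|k].
  by rewrite !mulr_ge0// exprn_ge0.
by rewrite spray_quad; apply: quad_bound => i j; exact: sC.
Qed.

Lemma spray_coef_lipschitz x y z v w (C : R) : 0 <= C ->
  (forall o i j, `|spray_coef o i j x z| <= C) ->
  (forall o i j, `|spray_coef o i j x y - spray_coef o i j x z| <= C * `|y - z|) ->
  `|spray F x y v - spray F x z w| <=
    (n ^ 2)%:R * C * (`|v| ^+ 2 * `|y - z| + (`|v| + `|w|) * `|v - w|).
Proof.
move=> C0 sC sL; apply: norm_le => [|k].
  by rewrite mulr_ge0 ?mulr_ge0// addr_ge0 ?mulr_ge0 ?exprn_ge0// addr_ge0.
have -> : (spray F x y v - spray F x z w) 0 k =
    quad (fun i j => spray_coef (Some k) i j x y) v -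
    quad (fun i j => spray_coef (Some k) i j x z) w.
  by rewrite sub_coord (spray_quad x y v k) (spray_quad x z w k).
by apply: quad_lipschitz => i j; [exact: sC|exact: sL].
Qed.

Lemma closed_ball_in x0 : U x0 -> exists2 rho : R, 0 < rho &
  forall x, `|x - x0| <= rho -> U x.
Proof.
move=> Ux0; have /nbhs_ballP[e /= e0 He] : nbhs x0 U by exact: open_nbhs_nbhs.
exists (e / 2); first by rewrite divr_gt0.
move=> x xx; apply: He; rewrite -ball_normE /ball_/= distrC.
by apply: (le_lt_trans xx); rewrite ltr_pdivrMr// ltr_pMr// ltr1n.
Qed.

Lemma norm_normalize v : v != 0 -> `| `|v|^-1 *: v| = 1.
Proof. by move=> v0; rewrite normrZ normfV normr_id mulVf// normr_eq0. Qed.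

(** By homogeneity it suffices to bound F from above and below on the unit
    sphere. The factor 2 leaves room for balls of radius a that avoid the
    origin. *)
Lemma indicatrix_norms x0 (rho : R) : (forall x, `|x - x0| <= rho -> U x) ->
  exists a b : R, 0 < a /\ forall x p, `|x - x0| <= rho -> F x p = 1 ->
    2 * a <= `|p| /\ `|p| <= b.
Proof.
move=> HU; pose K : set (E * E) := [set x | `|x - x0| <= rho] `*` [set y | 1 <= `|y| /\ `|y| <= 1].
have cK : compact K by apply: compact_setX; [exact: norm_ball_compact|exact: annulus_compact].
have KU z : K z -> U z.1 /\ z.2 != 0.
  case=> /= zx [z1 _]; split; first exact: HU.
  by rewrite -normr_gt0 (lt_le_trans ltr01).
have cF z : K z -> {for z, continuous (uncur F)}.
  by case: z => x y /KU[/= Ux y0]; exact: (smooth2_cont (smooth_F hF)).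
have [M0 M00 HM0] := compact_bound cK cF.
have [M1 M10 HM1] : exists2 C : R, 0 < C & forall z, K z -> `|(uncur F z)^-1| <= C.
  apply: compact_bound => // z Kz; apply: cvgV; last exact: cF.
  by have [Ux y0] := KU z Kz; exact: (F_neq0 hF).
exists (2 * M0)^-1, M1; split; first by rewrite invr_gt0 mulr_gt0.
move=> x p xx Fp; have Ux := HU x xx.
have p0 := indicatrix_neq0 hF Ux Fp.
have np : 0 < `|p| by rewrite normr_gt0.
have Kp : K (x, `|p|^-1 *: p) by split => //=; rewrite norm_normalize.
have Fu : uncur F (x, `|p|^-1 *: p) = `|p|^-1.
  by rewrite /uncur /= (finsler_homo hF)// ?invr_gt0// Fp mulr1.
have := HM0 _ Kp; have := HM1 _ Kp; rewrite Fu invrK normr_id gtr0_norm ?invr_gt0//.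
move=> pM1 pM0; split=> //.
rewrite invfM mulrA divff// mul1r -[`|p|]invrK.
by rewrite lef_pV2 ?posrE ?invr_gt0.
Qed.

Lemma segment_ball p c c' (a s : R) : 0 <= s <= 1 -> `|c - p| <= a -> `|c' - p| <= a ->
  `|s *: (c' - c) + c - p| <= a.
Proof.
move=> /andP[s0 s1] ca c'a.
have -> : s *: (c' - c) + c - p = s *: (c' - p) + (1 - s) *: (c - p).
  by apply/rowP => k; rewrite !mxE; ring.
apply: (le_trans (ler_normD _ _)); rewrite !normrZ !ger0_norm// ?subr_ge0//.
have : s * `|c' - p| <= s * a by rewrite ler_wpM2l.
have : (1 - s) * `|c - p| <= (1 - s) * a by rewrite ler_wpM2l// subr_ge0.
lra.
Qed.

(** By homogeneity in v it suffices to bound g(v, v) from below on the unit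
    sphere, where it is continuous and positive. *)
Lemma gform_lower (A B : set E) : compact A -> compact B -> (forall x, A x -> U x) ->
  (forall y, B y -> y != 0) -> exists2 lam : R, 0 < lam &
  forall x y v, A x -> B y -> lam * `|v| ^+ 2 <= gform F x y v v.
Proof.
move=> cA cB AU B0.
pose S := [set v : E | 1 <= `|v| /\ `|v| <= 1].
pose f (z : (E * E) * E) := gform F z.1.1 z.1.2 z.2 z.2.
have cK : compact ((A `*` B) `*` S).
  by apply: compact_setX; [exact: compact_setX|exact: annulus_compact].
have S0 v : S v -> v != 0 by case=> v1 _; rewrite -normr_gt0 (lt_le_trans ltr01).
have cf z : ((A `*` B) `*` S) z -> {for z, continuous f}.
  case: z => [[x y] v] [[/= Ax By] Sv].
  apply: continuous_sumf => i; apply: continuous_sumf => j.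
  have cv (k : 'I_n) : {for ((x, y), v), continuous (fun z : (E * E) * E => z.2 0 k)}.
    apply: (@continuous_comp _ _ _ snd (fun M : E => M 0 k)); first exact: cvg_snd.
    exact: coord_continuous.
  apply: cvgM; last exact: cv.
  apply: cvgM; last exact: cv.
  apply: (@continuous_comp _ _ _ fst (uncur (g F i j))); first exact: cvg_fst.
  exact: (smooth2_cont (smooth_g U_open hF i j) (AU _ Ax) (B0 _ By)).
have [C C0 HC] : exists2 C : R, 0 < C & forall z, ((A `*` B) `*` S) z -> `|(f z)^-1| <= C.
  apply: compact_bound => // z Kz; apply: cvgV; last exact: cf.
  case: z Kz => [[x y] v] [[/= Ax By] Sv].
  by rewrite gt_eqF// (gform_gt0 hF)//; [exact: AU|exact: B0|exact: S0].
exists C^-1; first by rewrite invr_gt0.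
move=> x y v Ax By; have [->|v0] := eqVneq v 0.
  by rewrite normr0 expr2 !mulr0 (gform_ge0 hF)//; [exact: AU|exact: B0].
have nv : 0 < `|v| by rewrite normr_gt0.
have Su : S (`|v|^-1 *: v) by rewrite /S /= norm_normalize.
have := HC ((x, y), `|v|^-1 *: v) (conj (conj Ax By) Su).
rewrite /f /= gformZl gformZr.
have G0 := gform_gt0 hF (AU _ Ax) (B0 _ By) v0.
exact: rescale_lower.
Qed.

(** The balls of radius a about the points of the indicatrices near x0 lie in
    one annulus, which is compact; this makes all constants of the boundary
    value problem uniform in x and p. *)
Lemma local_constants x0 : U x0 -> exists rho a K lam : R,
  [/\ 0 < rho, 0 < a, 0 < K & 0 < lam] /\
  forall x p, `|x - x0| <= rho -> F x p = 1 ->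
  [/\ U x /\ (forall c, `|c - p| <= a -> c != 0),
    (forall c v, `|c - p| <= a -> `|spray F x c v| <= K * `|v| ^+ 2),
    (forall c c' v v', `|c - p| <= a -> `|c' - p| <= a ->
      `|spray F x c v - spray F x c' v'| <=
        K * (`|v| ^+ 2 * `|c - c'| + (`|v| + `|v'|) * `|v - v'|)),
    (forall c c' v v', `|c - p| <= a -> `|c' - p| <= a ->
      `|gform F x c v v| <= K * `|v| ^+ 2 /\
      `|gform F x c v v - gform F x c' v' v'| <=
        K * (`|v| ^+ 2 * `|c - c'| + (`|v| + `|v'|) * `|v - v'|)) &
    (forall v, lam * `|v| ^+ 2 <= gform F x p v v)].
Proof.
move=> Ux0; have [rho rho0 HU] := closed_ball_in Ux0.
have [a [b [a0 Hab]]] := indicatrix_norms HU.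
pose A := [set y : E | a <= `|y| /\ `|y| <= b + a].
pose K : set (E * E) := [set x | `|x - x0| <= rho] `*` A.
have cB : compact [set x : E | `|x - x0| <= rho] by exact: norm_ball_compact.
have cA : compact A by exact: annulus_compact.
have cK : compact K by exact: compact_setX.
have A0 y : A y -> y != 0 by case=> ay _; rewrite -normr_gt0 (lt_le_trans a0).
have KU : K `<=` slit U by case=> x y [/= /HU Ux /A0].
have pA x p c : `|x - x0| <= rho -> F x p = 1 -> `|c - p| <= a -> A c.
  move=> xx Fp cp; have [h1 h2] := Hab x p xx Fp; split.
    have : `|p| <= `|c| + `|c - p|.
      by rewrite -{1}(subKr c p); exact: ler_normB.
    by move: h1 cp; set u := `|p|; set u' := `|c - p|; set u'' := `|c|; lra.
  have -> : c = (c - p) + p by rewrite subrK.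
  apply: (le_trans (ler_normD _ _)).
  by move: h2 cp; set u := `|p|; set u' := `|c - p|; lra.
have [C1 C10 HC1] := @compact_bounds R (option 'I_n * 'I_n * 'I_n)%type _ K
  (fun o => uncur (spray_coef o.1.1 o.1.2 o.2)) cK
  (fun o z Kz => smooth_cont (smooth_spray_coef o.1.1 o.1.2 o.2) (KU z Kz)).
have [C2 C20 HC2] := @compact_lipschitz R n U U_open (option 'I_n * 'I_n * 'I_n)%type
  (fun o => spray_coef o.1.1 o.1.2 o.2) K cK KU
  (fun o => smooth_spray_coef o.1.1 o.1.2 o.2).
have [lam lam0 Hlam] := gform_lower cB cA HU A0.
pose C := C1 + C2.
have C0 : 0 <= C by rewrite addr_ge0// ltW.
pose k := (n ^ 2)%:R * C + 1.
have kC : (n ^ 2)%:R * C <= k by rewrite lerDl.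
exists rho, a, k, lam; split.
  by split => //; rewrite ltr_wpDl// mulr_ge0.
move=> x p xx Fp; have Ap c := pA x p c xx Fp.
have bd c o i j : `|c - p| <= a -> `|spray_coef o i j x c| <= C.
  move=> /Ap Ac; apply: (le_trans (HC1 (o, i, j) (x, c) (conj xx Ac))).
  by rewrite lerDl ltW.
have lip c c' o i j : `|c - p| <= a -> `|c' - p| <= a ->
    `|spray_coef o i j x c - spray_coef o i j x c'| <= C * `|c - c'|.
  move=> ca c'a.
  apply: (@le_trans _ _ (C2 * `|c - c'|)).
    apply: (HC2 (o, i, j) x c' c) => s s01; split=> //=; apply: Ap.
    exact: segment_ball.
  by rewrite ler_wpM2r// lerDr ltW.
have pos v v' (c c' : E) : 0 <= `|v| ^+ 2 * `|c - c'| + (`|v| + `|v'|) * `|v - v'|.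
  by rewrite addr_ge0// mulr_ge0// ?exprn_ge0// addr_ge0.
split.
- by split; [exact: HU|move=> c /Ap/A0].
- move=> c v ca; apply: (le_trans (spray_bound v C0 (fun o i j => bd c o i j ca))).
  by rewrite ler_wpM2r// exprn_ge0.
- move=> c c' v v' ca c'a; apply: (le_trans (spray_coef_lipschitz v v' C0
    (fun o i j => bd c' o i j c'a) (fun o i j => lip c c' o i j ca c'a))).
  by rewrite ler_wpM2r.
- move=> c c' v v' ca c'a; rewrite !gform_quad; split.
    apply: (le_trans (quad_bound v (fun i j => bd c None i j ca))).
    by rewrite ler_wpM2r// exprn_ge0.
  apply: (le_trans (quad_lipschitz v v'
    (fun i j => bd c' None i j c'a) (fun i j => lip c c' None i j ca c'a))).
  by rewrite ler_wpM2r.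
- move=> v; apply: Hlam => //; apply: Ap.
  by rewrite subrr normr0 ltW.
Qed.

End LocalConstants.

(** * Short geodesic arcs *)

Section SmallArcs.
Variables (R : realType) (n : nat) (U : set 'rV[R]_n).
Hypothesis U_open : open U.
Local Notation E := 'rV[R]_n.
Variable F : E -> E -> R.
Hypothesis hF : finsler U F.
Implicit Types (x y v w p q : E).

Lemma row_mvt (c c1 : R -> E) (s : R) : 0 <= s -> {within `[0, 1], continuous c} ->
  (forall t : R, t \in `]0, 1[ -> row_derive c t (c1 t)) ->
  (forall t : R, t \in `]0, 1[ -> `|c1 t| <= s) ->
  forall t : R, t \in `[0, 1] -> `|c t - c 0| <= s.
Proof.
move=> s0 cc dc c1s t; rewrite in_itv/= => /andP[t0 t1]; apply: norm_le => // k.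
rewrite sub_coord.
have cw : {within `[0, t], continuous c}.
  apply: continuous_subspaceW cc => v /=; rewrite !in_itv/= => /andP[v0 vt].
  by rewrite v0 (le_trans vt t1).
have inI (u : R) : u \in `]0, t[ -> u \in `]0, 1[.
  by rewrite !in_itv/= => /andP[u0 ut]; rewrite u0 (lt_le_trans ut t1).
have d1 (u : R) : u \in `]0, t[ -> is_derive u 1 (fun s => c s 0 k) (c1 u 0 k).
  by move=> /inI uI; exact: dc.
have b1 (u : R) : u \in `]0, t[ -> `|c1 u 0 k| <= s.
  by move=> /inI uI; apply: (le_trans (coord_le _ _)); exact: c1s.
apply: (le_trans (mvt_bound t0 (row_within_coord (k := k) cw) d1 b1)).
by rewrite subr0 ler_piMr.
Qed.

Lemma arc_length_ext x (c c' : R -> E) : (forall t : R, t \in `]0, 1[ -> c' t = c t) ->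
  arc_length F x c' = arc_length F x c.
Proof.
move=> cc'; apply: eq_Rintegral => t; rewrite inE /= => tI.
have -> : velocity c' t = velocity c t.
  apply: near_eq_derive.
  have : \forall s \near t, s \in `]0, 1[ by exact: near_in_itvoo.
  by apply: filterS => s /cc'.
by rewrite cc'.
Qed.

Lemma sqr_bound_le (A B : R) : 0 <= B -> A ^+ 2 <= B ^+ 2 -> A <= B.
Proof.
move=> B0 AB; rewrite leNgt; apply/negP => BA.
by move: AB; rewrite leNgt ltrXn2r.
Qed.

Lemma speed_comparison (K lam k d : R) : 0 < K -> 0 < lam -> k = K / lam + 1 ->
  4 * K * d ^+ 2 <= lam * (2 * k * d) ^+ 2.
Proof.
move=> K0 lam0 kE; have k1 : 1 <= k by rewrite kE lerDr divr_ge0// ltW.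
have kk : K <= lam * k ^+ 2.
  apply: (@le_trans _ _ (lam * k)).
    by rewrite kE mulrDr mulrCA divff ?gt_eqF// !mulr1 lerDl ltW.
  by rewrite (ler_pM2l lam0) expr2 ler_peMl// (le_trans ler01).
have : K * d ^+ 2 <= lam * k ^+ 2 * d ^+ 2 by rewrite ler_wpM2r// sqr_ge0.
by clear kE; rewrite !exprMn; lra.
Qed.

(** The solution of the boundary value problem is a geodesic c. A geodesic
    that is not longer than c has constant speed, so the lower bound of g
    bounds its velocity by 2 k d; it stays in the ball of radius a and equals
    c by uniqueness. The squared length of c is g(c', c') at the time 1/2,
    where c = p + O(d) and c' = q - p + O(d^2). *)
Lemma small_arc x p q (a K lam : R) (k := K / lam + 1) (d := `|q - p|) : 0 < K -> 0 < lam ->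
  F x p = 1 -> F x q = 1 -> U x ->
  (forall c, `|c - p| <= a -> c != 0) ->
  (forall c v, `|c - p| <= a -> `|spray F x c v| <= K * `|v| ^+ 2) ->
  (forall c c' v v', `|c - p| <= a -> `|c' - p| <= a ->
      `|spray F x c v - spray F x c' v'| <=
        K * (`|v| ^+ 2 * `|c - c'| + (`|v| + `|v'|) * `|v - v'|)) ->
  (forall c c' v v', `|c - p| <= a -> `|c' - p| <= a ->
      `|gform F x c v v| <= K * `|v| ^+ 2 /\
      `|gform F x c v v - gform F x c' v' v'| <=
        K * (`|v| ^+ 2 * `|c - c'| + (`|v| + `|v'|) * `|v - v'|)) ->
  (forall y v, F x y = 1 -> lam * `|v| ^+ 2 <= gform F x y v v) ->
  d <= 1 -> 16 * K * d <= 1 -> 2 * d <= a ->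
  2 * k * d <= 2 -> 8 * K * (2 * k * d) <= 1 -> 2 * k * d <= a ->
  exists c, [/\ shortest_arc F x p q c,
    forall c', shortest_arc F x p q c' -> forall t : R, t \in `[0, 1] -> c' t = c t,
    0 <= arc_length F x c &
    `|arc_length F x c ^+ 2 - gform F x p (q - p) (q - p)| <=
       (8 * K + 12 * K ^+ 2) * d ^+ 3].
Proof.
move=> K0 lam0 Fp Fq Ux Hne Hs HsL Hg Hlam d1 Kd da kd Kkd kda.
have d0 : 0 <= d by exact: normr_ge0.
have k1 : 1 <= k by rewrite lerDr divr_ge0// ltW.
have kE : k = K / lam + 1 by [].
have dE : `|q - p| = d by [].
have [c [c1 [cp cq dc dc1 cb]]] := spray_bvp_exists K0 Hs HsL d1 Kd da.
have {}cb (t : R) : t \in `[0, 1] -> `|c t - p| <= 2 * d /\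
    `|c1 t - (q - p)| <= 4 * K * d ^+ 2 by exact: cb.
clearbody k d.
have dk : 2 * d <= 2 * k * d by rewrite -mulrA ler_pM2l// ler_peMl.
have c1b (t : R) : t \in `[0, 1] -> [/\ `|c t - p| <= 2 * d, `|c t - p| <= a,
    `|c1 t - (q - p)| <= 4 * K * d ^+ 2 & `|c1 t| <= 2 * d].
  move=> tI; have [h1 h2] := cb t tI; split => //; first exact: le_trans da.
  have -> : c1 t = (c1 t - (q - p)) + (q - p) by rewrite subrK.
  apply: (le_trans (ler_normD _ _)).
  have : 4 * K * d ^+ 2 <= d.
    rewrite expr2 mulrA ler_piMl//; have : 0 <= K * d by rewrite mulr_ge0// ltW.
    by move: Kd; lra.
  by move: h2; rewrite dE; set u := `|_ - _|; lra.
have in01 (t : R) : t \in `[0, 1] -> t \in `](-1), 2[.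
  by rewrite !in_itv/= => /andP[? ?]; apply/andP; split; lra.
have ccont (t : R) : t \in `[0, 1] -> {for t, continuous c}.
  by move=> /in01/dc; exact: row_derive_continuous.
have wcont : {within `[0, 1], continuous c}.
  by apply: continuous_in_subspaceT => t; rewrite inE; exact: ccont.
have dcI (t : R) : t \in `]0, 1[ -> row_derive c t (c1 t).
  by move=> tI; apply/dc/in01; exact: subset_itv_oo_cc tI.
have Fc : forall t : R, t \in `[0, 1] -> F x (c t) = 1.
  apply: (spray_stays U_open hF Ux ccont (c1 := c1)).
  - by move=> t /c1b[_ ca _ _]; exact: Hne.
  - by rewrite cp.
  - by rewrite cq.
  - move=> t tI; split; [exact: dcI|exact: dc1|].
    have [_ ca _ vb] := c1b t (subset_itv_oo_cc tI).
    have [g1 _] := Hg (c t) (c t) (c1 t) (c1 t) ca ca.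
    apply: (le_trans (ler_norm _)); apply: (le_trans g1).
    apply: (@le_trans _ _ (K * (2 * d) ^+ 2)).
      by rewrite (ler_pM2l K0); exact: ler_sqr_mono.
    have : 16 * K * d * d <= 1 * 1 by apply: ler_pM => //; rewrite mulr_ge0// mulr_ge0// ltW.
    by rewrite exprMn !expr2; lra.
have gc : geodesic_arc F x p q c.
  rewrite -cp -cq; apply: (spray_geodesic U_open hF Ux wcont Fc (c1 := c1)) => t tI.
  by split; [exact: dcI|exact: dc1].
(* The speed is constant, so the length can be read off at any interior time. *)
pose h : R := 2^-1.
have hI : h \in `]0, 1[ by rewrite in_itv/= invr_gt0 ltr0n invf_lt1// ltr1n.
have hJ := subset_itv_oo_cc hI.
pose G := gform F x (c h) (c1 h) (c1 h).
have LE : arc_length F x c = Num.sqrt G.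
  rewrite (arc_length_speed U_open hF Ux gc hI).
  by have [_ ->] := velocity_eq dcI hI.
have ch0 : c h != 0 by have [_ ca _ _] := c1b h hJ; exact: Hne.
have G0 : 0 <= G by exact: (gform_ge0 hF).
have L2 : arc_length F x c ^+ 2 = G by rewrite LE sqr_sqrtr.
have L0 : 0 <= arc_length F x c by rewrite LE sqrtr_ge0.
have GK : G <= 4 * K * d ^+ 2.
  have [_ ca _ vb] := c1b h hJ.
  have [g1 _] := Hg (c h) (c h) (c1 h) (c1 h) ca ca.
  apply: (le_trans (ler_norm _)); apply: (le_trans g1).
  apply: (@le_trans _ _ (K * (2 * d) ^+ 2)).
    by rewrite (ler_pM2l K0); exact: ler_sqr_mono.
  by rewrite exprMn; lra.
have uniq (c' : R -> E) : geodesic_arc F x p q c' -> arc_length F x c' <= arc_length F x c ->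
    forall t : R, t \in `[0, 1] -> c' t = c t.
  move=> gc' L'L; have [[c'p c'q] c'w Fc' _ _] := gc'.
  have v'b (t : R) : t \in `]0, 1[ -> `|velocity c' t| <= 2 * k * d.
    move=> tI; have F't := Fc' t (subset_itv_oo_cc tI).
    have c't0 := indicatrix_neq0 hF Ux F't.
    have g'0 := gform_ge0 hF (velocity c' t) Ux c't0.
    have lamv := Hlam (c' t) (velocity c' t) F't.
    have : gform F x (c' t) (velocity c' t) (velocity c' t) <= 4 * K * d ^+ 2.
      rewrite -(sqr_sqrtr g'0) -(arc_length_speed U_open hF Ux gc' tI).
      have L'0 : 0 <= arc_length F x c'.
        by rewrite (arc_length_speed U_open hF Ux gc' tI) sqrtr_ge0.
      by apply: le_trans GK; rewrite -L2; exact: (ler_sqr_mono L'0 L'L).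
    move=> /(le_trans lamv) H; apply: sqr_bound_le.
      by rewrite mulr_ge0// mulr_ge0// (le_trans ler01).
    rewrite -(ler_pM2l lam0); apply: (le_trans H).
    exact: speed_comparison.
  have s0 : 0 <= 2 * k * d by exact: le_trans (normr_ge0 _) (v'b h hI).
  have d'c (t : R) : t \in `]0, 1[ -> row_derive c' t (velocity c' t).
    by move=> tI; have [_ ? _ _] := geodesic_spray U_open hF Ux gc' tI.
  apply: (@spray_bvp_unique R n (spray F x) p a K K0 Hs HsL (2 * k * d)
      c' (velocity c') c c1) => //.
  - by rewrite c'p cp.
  - by rewrite c'q cq.
  - move=> t tI; have [_ ? ? _] := geodesic_spray U_open hF Ux gc' tI; split=> //.
      apply: le_trans kda; rewrite -c'p.
      exact: (row_mvt s0 c'w d'c v'b (subset_itv_oo_cc tI)).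
    exact: v'b.
  - move=> t tI; have [_ ca _ vb] := c1b t (subset_itv_oo_cc tI).
    split; [exact: dcI|exact: dc1|exact: ca|exact: le_trans dk].
have sc : shortest_arc F x p q c.
  split; [exact: gc|move=> c' gc'].
  case/orP: (le_total (arc_length F x c) (arc_length F x c')) => [LL|L'L]; first exact: LL.
  have cc' (t : R) : t \in `]0, 1[ -> c' t = c t.
    by move=> tI; exact: (uniq c' gc' L'L t (subset_itv_oo_cc tI)).
  have e : forall u v : R, u = v -> v <= u by move=> u v ->.
  exact: (e _ _ (arc_length_ext x cc')).
exists c; split; [exact: sc| |exact: L0|].
  by move=> c' [gc' sc']; exact: (uniq c' gc' (sc' c gc)).
rewrite L2; have [cp2 ca vqp vb] := c1b h hJ.
have pa : `|p - p| <= a by rewrite subrr normr0 (le_trans _ da)// mulr_ge0.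
have [_ g2] := Hg (c h) p (c1 h) (q - p) ca pa.
apply: (le_trans g2); rewrite dE.
have H1 : `|c1 h| ^+ 2 * `|c h - p| <= (2 * d) ^+ 2 * (2 * d).
  apply: ler_pM; [exact: sqr_ge0|exact: normr_ge0| |exact: cp2].
  exact: (ler_sqr_mono (normr_ge0 _) vb).
have H2 : (`|c1 h| + d) * `|c1 h - (q - p)| <= (3 * d) * (4 * K * d ^+ 2).
  apply: ler_pM; [by rewrite addr_ge0|exact: normr_ge0| |exact: vqp].
  have -> : 3 * d = 2 * d + d by ring.
  by rewrite lerD2r.
have -> : (8 * K + 12 * K ^+ 2) * d ^+ 3 =
    K * ((2 * d) ^+ 2 * (2 * d) + (3 * d) * (4 * K * d ^+ 2)) by ring.
by rewrite (ler_pM2l K0) lerD.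
Qed.

Lemma angle_eq x y1 y2 (c : R -> E) :
  shortest_arc F x (direction F x y1) (direction F x y2) c ->
  angle F x y1 y2 = arc_length F x c.
Proof.
move=> sc; have e c' : shortest_arc F x (direction F x y1) (direction F x y2) c' ->
    arc_length F x c' = arc_length F x c.
  case: sc => gc Hc [gc' Hc']; apply/le_anti/andP.
  by split; [exact: (Hc' c gc)|exact: (Hc c' gc')].
apply: xget_unique; first by exists c; split; [exact: sc|reflexivity].
by move=> L [c' [sc' ->]]; exact: (e c' sc').
Qed.

End SmallArcs.

(** * The angle between nearly parallel vectors *)

Section Expansion.
Variables (R : realType) (n : nat) (U : set 'rV[R]_n).
Hypothesis U_open : open U.
Local Notation E := 'rV[R]_n.
Variable F : E -> E -> R.
Hypothesis hF : finsler U F.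
Implicit Types (x y v w p q : E).

Lemma F_direction x y : U x -> y != 0 -> F x (direction F x y) = 1.
Proof.
move=> Ux y0; have F0 := F_gt0 hF Ux y0.
have Fi : 0 < (F x y)^-1 by rewrite invr_gt0.
by rewrite /direction (finsler_homo hF y Ux Fi) mulVf// gt_eqF.
Qed.

Lemma small_conditions (a K k d : R) : 0 < a -> 0 < K -> 0 < k -> 0 <= d ->
  d * (1 + 16 * K + 2 / a + 2 * k + 16 * K * k + 2 * k / a) <= 1 ->
  [/\ d <= 1, 16 * K * d <= 1 & 2 * d <= a] /\
  [/\ 2 * k * d <= 2, 8 * K * (2 * k * d) <= 1 & 2 * k * d <= a].
Proof.
move=> a0 K0 k0 d0 H.
have h1 : 0 <= K * d by rewrite mulr_ge0// ltW.
have h2 : 0 <= d / a by rewrite divr_ge0// ltW.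
have h3 : 0 <= k * d by rewrite mulr_ge0// ltW.
have h4 : 0 <= K * k * d by rewrite !mulr_ge0// ltW.
have h5 : 0 <= k * d / a by rewrite divr_ge0// ltW.
have E1 : d * (1 + 16 * K + 2 / a + 2 * k + 16 * K * k + 2 * k / a) =
  d + 16 * (K * d) + 2 * (d / a) + 2 * (k * d) + 16 * (K * k * d) + 2 * (k * d / a).
  by ring.
rewrite {}E1 in H.
have e1 : 2 * (d / a) <= 1 by lra.
have e2 : 2 * (k * d / a) <= 1 by lra.
rewrite !mulrA in e1 e2.
rewrite ler_pdivrMr// mul1r in e1; rewrite ler_pdivrMr// mul1r in e2.
by split; split; lra.
Qed.

Lemma angle_close x0 : U x0 -> exists rho K C eta : R,
  [/\ 0 < rho, 0 < K, 0 < C & 0 < eta] /\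
  forall x y1 y2, `|x - x0| <= rho -> y1 != 0 -> y2 != 0 ->
  `|direction F x y2 - direction F x y1| <= eta ->
  [/\ U x, joining_arc_well_defined F x y1 y2,
   `|angle F x y1 y2 ^+ 2 - gform F x (direction F x y1)
        (direction F x y2 - direction F x y1) (direction F x y2 - direction F x y1)|
     <= C * `|direction F x y2 - direction F x y1| ^+ 3 &
   forall v w, `|gform F x (direction F x y1) v v - gform F x (direction F x y1) w w|
     <= K * ((`|v| + `|w|) * `|v - w|)].
Proof.
move=> Ux0; have [rho [a [K [lam [[rho0 a0 K0 lam0] H]]]]] := local_constants U_open hF Ux0.
have [rho' rho'0 HU] := closed_ball_in U_open Ux0.
pose k := K / lam + 1.
have k0 : 0 < k by rewrite ltr_wpDl// divr_ge0// ltW.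
pose Z := 1 + 16 * K + 2 / a + 2 * k + 16 * K * k + 2 * k / a.
have Z0 : 0 < Z.
  have h1 : 0 <= 2 / a by rewrite divr_ge0// ltW.
  have h2 : 0 <= 2 * k / a by rewrite divr_ge0 ?mulr_ge0// ltW.
  have h3 : 0 <= K * k by rewrite mulr_ge0// ltW.
  by rewrite /Z; lra.
exists (Num.min rho rho'), K, (8 * K + 12 * K ^+ 2), Z^-1; split.
  split; [by rewrite lt_min rho0|by []| |by rewrite invr_gt0].
  by rewrite addr_gt0// mulr_gt0// exprn_gt0.
move=> x y1 y2; rewrite le_min => /andP[xx xx'] y10 y20.
have Ux := HU x xx'.
have Fp := F_direction Ux y10; have Fq := F_direction Ux y20.
set p := direction F x y1 in Fp *; set q := direction F x y2 in Fq *.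
move=> dZ; have [[_ Hne] Hs HsL Hg _] := H x p xx Fp.
have Hlam y v : F x y = 1 -> lam * `|v| ^+ 2 <= gform F x y v v.
  by move=> Fy; have [_ _ _ _] := H x y xx Fy; exact.
have dZ' : `|q - p| * Z <= 1 by rewrite -ler_pdivlMr// mul1r.
have [[c1 c2 c3] [c4 c5 c6]] := small_conditions a0 K0 k0 (normr_ge0 _) dZ'.
have [c [sc uc L0 Lb]] := small_arc U_open hF K0 lam0 Fp Fq Ux Hne Hs HsL Hg Hlam
  c1 c2 c3 c4 c5 c6.
split.
- exact: Ux.
- by exists c; split; [exact: sc|exact: uc].
- by rewrite (angle_eq sc); exact: Lb.
- move=> v w; have pa : `|p - p| <= a by rewrite subrr normr0 ltW.
  have [_] := Hg p p v w pa pa.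
  by rewrite subrr normr0 mulr0 add0r.
Qed.

Lemma g_homo i j x y (a : R) : U x -> y != 0 -> 0 < a -> g F i j x (a *: y) = g F i j x y.
Proof.
move=> Ux y0 a0; have ay0 : a *: y != 0 by rewrite scaler_eq0 (gt_eqF a0).
have d z : z != 0 -> differentiable (denergy F j x) z.
  by move=> z0; exact: (smooth2_diff2 (smooth_denergy U_open hF j) Ux z0).
rewrite -(pd_denergy U_open hF i j Ux y0) -(pd_denergy U_open hF i j Ux ay0).
have H z : z != 0 -> denergy F j x (a *: z) = a * denergy F j x z.
  by move=> z0; exact: (denergy_homo U_open hF j Ux z0 a0).
have H1 := pd_slit_ext i y0 H.
have H2 : pd i (fun z => denergy F j x (a *: z)) y = a * pd i (denergy F j x) (a *: y).
  by rewrite /pd derive_homothety (deriveZv _ _ (d _ ay0)).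
have H3 : pd i (fun z => a * denergy F j x z) y = a * pd i (denergy F j x) y.
  exact: (deriveZf _ _ (d _ y0)).
exact: (mulfI (lt0r_neq0 a0) (etrans (esym H2) (etrans H1 H3))).
Qed.

Lemma gform_direction x y v w : U x -> y != 0 ->
  gform F x (direction F x y) v w = gform F x y v w.
Proof.
move=> Ux y0; apply: eq_bigr => i _; apply: eq_bigr => j _.
have Fi : 0 < (F x y)^-1 by rewrite invr_gt0 (F_gt0 hF Ux y0).
by rewrite /direction (g_homo i j Ux y0 Fi).
Qed.

(** The angular metric h_ij v^i v^j / F^2, that is, the metric of the
    indicatrix pulled back by the projection to directions. *)
Definition angular (x y v : E) : R := (gform F x y v v - lform F x y v ^+ 2) / F x y ^+ 2.

Definition ddirection x y v : E := \row_k \sum_m v 0 m * pd m (lup F k x) y.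

Lemma direction_lup x y k : direction F x y 0 k = lup F k x y.
Proof. by rewrite /direction mxE mulrC. Qed.

Lemma pd_lup m k x y : U x -> y != 0 ->
  pd m (lup F k x) y = (k == m)%:R / F x y - y 0 k * llow F m x y / F x y ^+ 2.
Proof.
move=> Ux y0; have dF := smooth2_diff2 (smooth_F hF) Ux y0.
have F0 := F_neq0 hF Ux y0.
have dV : differentiable (fun z => (F x z)^-1) y by exact: differentiableV.
have dc : differentiable (fun z : E => z 0 k) y by exact: differentiable_coord.
rewrite /pd /lup (deriveMf _ dc dV) (deriveVf _ F0 dF).
rewrite -/(pd m (fun z : E => z 0 k) y) pd_coord -/(llow F m x y).
by rewrite addrC mulrC mulNr mulrN mulrA mulrAC.
Qed.

Lemma ddirectionE x y v : U x -> y != 0 ->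
  ddirection x y v = (F x y)^-1 *: (v - (lform F x y v / F x y) *: y).
Proof.
move=> Ux y0; apply/rowP => k; rewrite !mxE.
under eq_bigr => m _ do rewrite (pd_lup m k Ux y0) mulrBr.
rewrite sumrB.
have -> : \sum_m v 0 m * ((k == m)%:R / F x y) = v 0 k / F x y.
  rewrite -(sum_delta (fun m => v 0 m) k) mulr_suml; apply: eq_bigr => m _.
  by rewrite eq_sym mulrA.
have -> : \sum_m v 0 m * (y 0 k * llow F m x y / F x y ^+ 2) =
    lform F x y v * y 0 k / F x y ^+ 2.
  rewrite /lform !mulr_suml; apply: eq_bigr => m _; set A := llow _ _ _ _; by ring.
by set A := lform _ _ _ _; set B := F x y; rewrite expr2 invfM; ring.
Qed.

Lemma gform_ddirection x y v : U x -> y != 0 ->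
  gform F x y (ddirection x y v) (ddirection x y v) = angular x y v.
Proof.
move=> Ux y0; rewrite (ddirectionE v Ux y0) gformZl gformZr gformBl.
have F0 := F_neq0 hF Ux y0.
rewrite -[- (_ *: y)]scaleNr.
rewrite !gformDr !gformZl !gformZr (gform_sym U_open hF v y Ux y0).
rewrite !(gform_self U_open hF _ Ux y0) (lform_self hF Ux y0) /angular.
move: (gform _ _ _ _ _) (lform _ _ _ _) (F x y) F0 => G L f f0.
by field.
Qed.

Lemma angular_parallel x y (s : R) : U x -> y != 0 -> angular x y (s *: y) = 0.
Proof.
move=> Ux y0; rewrite /angular gformZl gformZr lformZ.
rewrite (gform_self U_open hF _ Ux y0) (lform_self hF Ux y0).
by move: (F x y) => f; ring.
Qed.

Lemma direction_inj x y v (e : R) : U x -> y != 0 -> y + e *: v != 0 -> e != 0 ->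
  direction F x y = direction F x (y + e *: v) -> angular x y v = 0.
Proof.
move=> Ux y0 y20 e0 dd.
have F2 := F_neq0 hF Ux y20.
have yE : y + e *: v = (F x (y + e *: v) / F x y) *: y.
  move: dd; rewrite /direction => /(congr1 (fun u => F x (y + e *: v) *: u)).
  by rewrite !scalerA divff// scale1r.
have -> : v = (e^-1 * (F x (y + e *: v) / F x y - 1)) *: y.
  rewrite -scalerA scalerBl scale1r -yE addrC addKr scalerA mulVf//.
  by rewrite scale1r.
exact: angular_parallel.
Qed.

(** The choice of s keeps the ball of radius 2 s about y0 away from the
    origin, so that the derivatives of the projection to directions are
    bounded there. *)
Lemma direction_taylor x0 y0 (s : R) : U x0 -> 0 < s -> 4 * s = `|y0| ->
  exists r B1 B2 : R, [/\ 0 < r, 0 < B1 & 0 < B2] /\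
  forall x y v (V e : R), `|x - x0| <= r -> `|y - y0| <= s -> `|v| <= V -> 0 < e ->
    e * V <= s ->
  [/\ y != 0, y + e *: v != 0,
   `|direction F x (y + e *: v) - direction F x y| <= B1 * V * e &
   `|direction F x (y + e *: v) - direction F x y - e *: ddirection x y v|
      <= B2 * V ^+ 2 * e ^+ 2].
Proof.
move=> Ux0 s0 sy0; have [rho rho0 HU] := closed_ball_in U_open Ux0.
pose A := [set y : E | `|y - y0| <= 2 * s].
pose K : set (E * E) := [set x | `|x - x0| <= rho] `*` A.
have cK : compact K by apply: compact_setX; exact: norm_ball_compact.
have A0 y : A y -> y != 0.
  rewrite /A /= => ys; apply/eqP => y00; move: ys.
  by rewrite y00 sub0r normrN -sy0; lra.
have KU : K `<=` slit U by case=> x y [/= /HU Ux /A0].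
have [C1 C10 HC1] := @compact_lipschitz R n U U_open 'I_n (lup F) K cK KU
  (smooth_lup U_open hF).
have [C2 C20 HC2] := @compact_lipschitz R n U U_open ('I_n * 'I_n)%type
  (fun o x y => pd o.1 (lup F o.2 x) y) K cK KU
  (fun o => smooth2_pd U_open o.1 (smooth_lup U_open hF o.2)).
exists rho, C1, (n%:R * C2 + 1); split.
  by split=> //; rewrite ltr_wpDl// mulr_ge0// ltW.
move=> x y v V e xx yy vV e0 eV.
have Ux := HU x xx.
have V0 : 0 <= V by exact: le_trans vV.
have ev : `|e *: v| <= e * V by rewrite normrZ gtr0_norm// ler_wpM2l// ltW.
have seg (t : R) : 0 <= t <= 1 -> A (t *: (e *: v) + y).
  move=> /andP[t0 t1]; rewrite /A /= -addrA; apply: (le_trans (ler_normD _ _)).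
  rewrite normrZ (ger0_norm t0).
  have : t * `|e *: v| <= `|e *: v| by rewrite ler_piMl.
  move: ev yy eV; set a := `|e *: v|; set b := `|y - y0|; set c := e * V; lra.
have yA : A y by have := seg 0; rewrite lexx ler01 scale0r add0r; exact.
have y0' := A0 y yA.
have y2A : A (y + e *: v) by have := seg 1; rewrite lexx ler01 scale1r addrC; exact.
have y20 := A0 _ y2A.
have yE : y + e *: v - y = e *: v by rewrite [y + _]addrC addrK.
have seg1 (t : R) : 0 <= t <= 1 -> K (x, t *: (y + e *: v - y) + y).
  by move=> t01; rewrite yE; split; [exact: xx|exact: seg].
split=> //.
  apply: norm_le => [|k]; first by rewrite !mulr_ge0// ltW.
  rewrite sub_coord !direction_lup.
  apply: (le_trans (HC1 k x y (y + e *: v) seg1)).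
  by rewrite yE -mulrA (ler_pM2l C10) [V * e]mulrC.
apply: norm_le => [|k].
  by rewrite mulr_ge0 ?sqr_ge0// mulr_ge0 ?sqr_ge0// addr_ge0// mulr_ge0// ltW.
have dl (z : E) : A z -> differentiable (lup F k x) z.
  by move=> Az; exact: (smooth2_diff2 (smooth_lup U_open hF k) Ux (A0 z Az)).
have [|t t01 mE] := @MVT_line R _ (lup F k x) y (e *: v).
  by move=> t t01; apply: dl; exact: seg.
have t01' : 0 <= t <= 1 by case/andP: t01 => t0 t1; rewrite !ltW.
have At := seg t t01'.
have -> : (direction F x (y + e *: v) - direction F x y - e *: ddirection x y v) 0 k =
  \sum_m (e * v 0 m) * (pd m (lup F k x) (t *: (e *: v) + y) - pd m (lup F k x) y).
  rewrite !sub_coord !direction_lup [y + _]addrC mE (derive_row _ (dl _ At)).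
  rewrite !mxE mulr_sumr -sumrB; apply: eq_bigr => m _.
  by rewrite !mxE mulrBr mulrA.
apply: (le_trans (ler_norm_sum _ _ _)).
apply: (@le_trans _ _ (\sum_(m < n) C2 * V ^+ 2 * e ^+ 2)).
  apply: ler_sum => m _.
  have -> : C2 * V ^+ 2 * e ^+ 2 = (e * V) * (C2 * (e * V)) by ring.
  rewrite normrM; apply: ler_pM => //.
    rewrite normrM gtr0_norm// (ler_pM2l e0).
    exact: le_trans (coord_le _ _) vV.
  apply: (@le_trans _ _ (C2 * `|t *: (e *: v) + y - y|)).
    apply: (HC2 (m, k) x y (t *: (e *: v) + y)) => u /andP[u0 u1]; split => //=.
    rewrite (addrK y) [u *: (t *: _)]scalerA; apply: seg; case/andP: t01' => t0 t1.
    by rewrite mulr_ge0//= -[leRHS]mulr1 ler_pM.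
  rewrite (ler_pM2l C20) addrK normrZ; apply: le_trans ev.
  by case/andP: t01' => t0 t1; rewrite (ger0_norm t0) ler_piMl.
rewrite sumr_const card_ord -[leLHS]mulr_natl.
have -> : (n%:R * C2 + 1) * V ^+ 2 * e ^+ 2 =
  n%:R * (C2 * V ^+ 2 * e ^+ 2) + V ^+ 2 * e ^+ 2 by ring.
by rewrite lerDl mulr_ge0 ?sqr_ge0.
Qed.

(** By [angle_close] the squared angle is the squared g-length of the chord
    between the two directions, up to its cube; by [direction_taylor] the
    chord is e times the derivative of the projection, up to e^2. *)
Lemma angle_expansion x0 y0 v0 : U x0 -> y0 != 0 -> exists r C e0 : R,
  [/\ 0 < r, 0 < C & 0 < e0] /\
  forall x y v (e : R), `|x - x0| <= r -> `|y - y0| <= r -> `|v - v0| <= r ->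
    0 < e -> e <= e0 ->
  [/\ U x, y != 0, y + e *: v != 0, joining_arc_well_defined F x y (y + e *: v) &
   `|angle F x y (y + e *: v) ^+ 2 / e ^+ 2 - angular x y v| <= C * e].
Proof.
move=> Ux0 y00; pose s := `|y0| / 4.
have s0 : 0 < s by rewrite divr_gt0// normr_gt0.
have sE : 4 * s = `|y0| by rewrite mulrC divfK.
have [rho [K [C [eta [[rho0 K0 C0 eta0] Hc]]]]] := angle_close Ux0.
have [r [B1 [B2 [[r0 B10 B20] Ht]]]] := direction_taylor Ux0 s0 sE.
pose V := `|v0| + s.
have V0 : 0 < V by rewrite ltr_wpDl.
pose b1 := B1 * V; pose b2 := B2 * V ^+ 2.
have b10 : 0 < b1 by rewrite mulr_gt0.
have b20 : 0 < b2 by rewrite mulr_gt0// exprn_gt0.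
pose r' := Num.min s (Num.min rho r).
(* These bounds on e give e^2 <= e, keep y + e v in the ball of radius 2 s
   about y0, and keep the two directions within eta. *)
pose e0 := Num.min 1 (Num.min (s / V) (eta / b1)).
exists r', (C * b1 ^+ 3 + K * ((b1 + (b1 + b2)) * b2)), e0; split; first split.
- by rewrite !lt_min s0 rho0.
- by rewrite addr_gt0// !mulr_gt0 ?exprn_gt0// !addr_gt0.
- by rewrite !lt_min ltr01 (divr_gt0 s0 V0) (divr_gt0 eta0 b10).
move=> x y v e; rewrite !le_min => /and3P[xs xrho xr] /and3P[ys _ _] /and3P[vs _ _] ep.
move=> /and3P[e1 eV eb1].
have vV : `|v| <= V.
  have -> : v = (v - v0) + v0 by rewrite subrK.
  by apply: (le_trans (ler_normD _ _)); rewrite addrC lerD2l.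
rewrite ler_pdivlMr// in eV; rewrite ler_pdivlMr// in eb1.
have [y0' y20 D1 D2] := Ht x y v V e xr ys vV ep eV.
have [|Ux jn A1 A2] := Hc x y (y + e *: v) xrho y0' y20.
  by apply: (le_trans D1); rewrite mulrC.
split=> //.
move: A1 A2 D1 D2; rewrite -/b1 -/b2.
set p := direction F x y; set q := direction F x (y + e *: v); set w := ddirection x y v.
move=> A1 A2 D1 D2.
have gw : gform F x p (e *: w) (e *: w) = e ^+ 2 * angular x y v.
  rewrite (gform_direction _ _ Ux y0') gformZl gformZr.
  by rewrite (gform_ddirection v Ux y0') mulrA expr2.
have {}A2 := A2 (q - p) (e *: w); rewrite gw in A2.
have ee : e ^+ 2 <= e by rewrite expr2 ler_piMl// ltW.
have ew : `|e *: w| <= (b1 + b2) * e.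
  have -> : e *: w = (q - p) - (q - p - e *: w) by rewrite opprB addrC subrK.
  apply: (le_trans (ler_normB _ _)); rewrite mulrDl; apply: (lerD D1).
  by apply: (le_trans D2); rewrite (ler_pM2l b20).
have step1 : C * `|q - p| ^+ 3 <= C * (b1 * e) ^+ 3.
  rewrite (ler_pM2l C0); apply: lerXn2r; last exact: D1.
    by rewrite nnegrE.
  by rewrite nnegrE mulr_ge0// ltW.
have step2 : K * ((`|q - p| + `|e *: w|) * `|q - p - e *: w|) <=
    K * ((b1 * e + (b1 + b2) * e) * (b2 * e ^+ 2)).
  by rewrite (ler_pM2l K0) ler_pM ?addr_ge0// lerD.
have {}A1 := le_trans A1 step1; have {}A2 := le_trans A2 step2.
move: A1 A2; move: (gform F x p (q - p) (q - p)) (angle F x y (y + e *: v)) (angular x y v).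
clear -ep; move=> G a Q A1 A2.
have e2 : 0 < e ^+ 2 by rewrite exprn_gt0.
have -> : a ^+ 2 / e ^+ 2 - Q = (a ^+ 2 - e ^+ 2 * Q) / e ^+ 2 by field; rewrite gt_eqF.
have ie2 : 0 <= (e ^+ 2)^-1 by rewrite invr_ge0 ltW.
rewrite normrM (ger0_norm ie2) ler_pdivrMr//.
have -> : a ^+ 2 - e ^+ 2 * Q = (a ^+ 2 - G) + (G - e ^+ 2 * Q) by ring.
apply: (le_trans (ler_normD _ _)); apply: (le_trans (lerD A1 A2)).
by rewrite le_eqVlt; apply/orP; left; apply/eqP; ring.
Qed.

End Expansion.

(** * Passage to the limit at points of contact *)

Section Touching.
Variables (R : realType) (V : normedModType R).
Implicit Types (z X : V).

Lemma derive_at_local_min (f : V -> R) z X (r : R) : 0 < r -> differentiable f z ->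
  (forall w, `|w - z| < r -> differentiable f w) ->
  (forall w, `|w - z| < r -> f z <= f w) -> 'D_X f z = 0.
Proof.
move=> r0 df dfr fmin.
pose s := r / (`|X| + 1).
have X1 : 0 < `|X| + 1 by rewrite ltr_wpDl.
have s0 : 0 < s by rewrite divr_gt0.
have near (t : R) : t \in `](- s), s[ -> `|t *: X + z - z| < r.
  rewrite in_itv/= => ts; rewrite addrK normrZ.
  have : `|t| < s by rewrite ltr_norml.
  rewrite /s ltr_pdivlMr//; apply: le_lt_trans.
  by rewrite ler_wpM2l// lerDl.
have ss : - s <= s by rewrite ltW// (lt_trans _ s0)// oppr_lt0.
pose g (t : R) := f (t *: X + z).
have D1 (t : R) : t \in `](- s), s[ -> derivable g t 1.
  by move=> /near/dfr dft; have [] := line_rule dft.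
have D2 : 0 \in `](- s), s[ by rewrite in_itv/= oppr_lt0 s0.
have D3 (t : R) : t \in `](- s), s[ -> g 0 <= g t.
  by move=> /near/fmin; rewrite /g scale0r add0r.
have [_ H] := derive1_at_min ss D1 D2 D3.
have df0 : differentiable f (0 *: X + z) by rewrite scale0r add0r.
by have [_] := line_rule df0; rewrite H scale0r add0r.
Qed.

Variables (z0 : V) (Q rho : V -> R) (A : R -> V -> R) (r0 C e0 : R).
Hypotheses (r00 : 0 < r0) (C0 : 0 < C) (e00 : 0 < e0).
Hypothesis ball_compact : forall r, compact [set z | `|z - z0| <= r].
Hypothesis rho_z0 : rho z0 = 0.
Hypothesis rho_ge : forall z, `|z - z0| ^+ 2 <= rho z.
Hypothesis rho_diff : forall z, differentiable rho z.
Hypothesis Q_diff : forall z, `|z - z0| <= r0 -> differentiable Q z.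
Hypothesis A_diff : forall e z, 0 < e -> e <= e0 -> `|z - z0| <= r0 -> differentiable (A e) z.
Hypothesis A_near : forall e z, 0 < e -> e <= e0 -> `|z - z0| <= r0 ->
  `|A e z - Q z| <= C * e.

(** For |z - z0| = r the function A e - Q + rho is at least r^2 - C e, while
    it is at most C e at z0. If 4 C e <= r^2, its minimum over the ball of
    radius r is interior, and the gradient vanishes there. *)
Lemma touching (d : R) : 0 < d -> exists e z, [/\ 0 < e, e <= e0, e <= d,
  `|z - z0| <= r0 /\ `|z - z0| <= d &
  forall X, 'D_X (A e) z = 'D_X Q z - 'D_X rho z].
Proof.
move=> d0; pose r := Num.min d r0.
have rp : 0 < r by rewrite lt_min d0.
have rr0 : r <= r0 by rewrite ge_min lexx orbT.
have rd : r <= d by rewrite ge_min lexx.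
pose e := Num.min (Num.min e0 d) (r ^+ 2 / (4 * C)).
have C40 : 0 < 4 * C by rewrite mulr_gt0.
have ep : 0 < e by rewrite !lt_min e00 d0 divr_gt0// exprn_gt0.
have ee0 : e <= e0 by rewrite !ge_min lexx.
have ed : e <= d by rewrite !ge_min lexx orbT.
have er : 4 * C * e <= r ^+ 2.
  by rewrite mulrC -ler_pdivlMr// !ge_min lexx !orbT.
(* The penalty rho makes z0 the only candidate for the minimum as e tends to
   0. *)
pose f z := A e z - Q z + rho z.
have df z : `|z - z0| <= r -> differentiable f z.
  move=> zr; have zr0 := le_trans zr rr0.
  by apply: differentiableD; [apply: differentiableB; [exact: A_diff|exact: Q_diff]|].
have zK : `|z0 - z0| <= r by rewrite subrr normr0 ltW.
have [z /[!inE] /= zr zmin] : exists2 z, z \in [set z | `|z - z0| <= r] &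
    forall w, w \in [set z | `|z - z0| <= r] -> f z <= f w.
  apply: compact_EVT_min; first by exists z0.
    exact: ball_compact.
  apply: continuous_in_subspaceT => w; rewrite inE => /= wr.
  exact: differentiable_continuous (df w wr).
have fz : f z <= f z0 by apply: zmin; rewrite inE.
have zlt : `|z - z0| < r.
  have h1 : f z0 <= C * e.
    rewrite /f rho_z0 addr0; apply: (le_trans (ler_norm _)).
    by apply: A_near => //; exact: le_trans rr0.
  have h2 : - (C * e) + `|z - z0| ^+ 2 <= f z.
    apply: lerD; last exact: rho_ge.
    by have := A_near ep ee0 (le_trans zr rr0); rewrite ler_norml => /andP[].
  have h3 : `|z - z0| ^+ 2 <= 2 * (C * e) by move: fz h1 h2; lra.
  rewrite ltNge; apply/negP => rz.
  have h4 : r ^+ 2 <= `|z - z0| ^+ 2 by apply: ler_sqr_mono => //; exact: ltW.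
  have Ce : 0 < C * e by rewrite mulr_gt0.
  by move: er h3 h4 Ce; rewrite -mulrA; lra.
exists e, z; split=> //.
  by split; [exact: le_trans rr0|exact: le_trans rd].
move=> X; have r'0 : 0 < r - `|z - z0| by rewrite subr_gt0.
have inb w : `|w - z| < r - `|z - z0| -> `|w - z0| <= r.
  move=> wz; rewrite -(subrKA z) (le_trans (ler_normD _ _))//.
  by rewrite -lerBrDr ltW.
have := @derive_at_local_min f z X (r - `|z - z0|) r'0 (df z zr).
have H1 w : `|w - z| < r - `|z - z0| -> differentiable f w by move=> /inb; exact: df.
have H2 w : `|w - z| < r - `|z - z0| -> f z <= f w.
  by move=> /inb wr; apply: zmin; rewrite inE.
move=> /(_ H1 H2).
have dA := A_diff ep ee0 (le_trans zr rr0); have dQ := Q_diff (le_trans zr rr0).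
have dAQ : differentiable (fun z => A e z - Q z) z by exact: differentiableB.
rewrite (deriveDf X dAQ (rho_diff z)) (deriveBf X dA dQ) => /eqP.
by rewrite addr_eq0 => /eqP/(canRL (subrK _)); rewrite addrC.
Qed.

Lemma touching_sequence : exists (e_ : nat -> R) (z_ : nat -> V),
  [/\ forall j, [/\ 0 < e_ j, e_ j <= e0 & `|z_ j - z0| <= r0],
    e_ j @[j --> \oo] --> (0 : R), z_ j @[j --> \oo] --> z0 &
    forall j X, 'D_X (A (e_ j)) (z_ j) = 'D_X Q (z_ j) - 'D_X rho (z_ j)].
Proof.
have H (j : nat) : exists p : R * V, [/\ 0 < p.1, p.1 <= e0, p.1 <= j.+1%:R^-1,
    `|p.2 - z0| <= r0 /\ `|p.2 - z0| <= j.+1%:R^-1 &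
    forall X, 'D_X (A p.1) p.2 = 'D_X Q p.2 - 'D_X rho p.2].
  have j0 : 0 < j.+1%:R^-1 :> R by rewrite invr_gt0.
  by have [e [z Hz]] := touching j0; exists (e, z).
have [p Hp] := choice H.
have cvg0 : (fun j => j.+1%:R^-1 : R) @ \oo --> (0 : R) by exact: cvg_harmonic.
exists (fun j => (p j).1), (fun j => (p j).2); split.
- by move=> j; have [? ? _ [? _] _] := Hp j.
- apply/cvgrPdist_le => e ep; move/cvgrPdist_le : cvg0 => /(_ e ep); apply: filterS => j.
  rewrite !sub0r !normrN => h; have [p1 _ p2 _ _] := Hp j.
  rewrite gtr0_norm//; apply: (le_trans p2); apply: le_trans h; exact: ler_norm.
- apply/cvgrPdist_le => e ep; move/cvgrPdist_le : cvg0 => /(_ e ep); apply: filterS => j.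
  rewrite sub0r normrN => h; have [_ _ _ [_ p2] _] := Hp j.
  rewrite distrC; apply: (le_trans p2); apply: le_trans h; exact: ler_norm.
- by move=> j X; have [_ _ _ _] := Hp j; exact.
Qed.

End Touching.

(** * Calculus on triples *)

Section ProductCalculus.
Variables (R : realType).

Lemma derive_affine (V V' : normedModType R) (L : V -> V') (f : V' -> R) (z X : V) (X' : V') :
  (forall h : R, L (h *: X + z) = h *: X' + L z) ->
  'D_X (fun z => f (L z)) z = 'D_X' f (L z).
Proof.
move=> HL; rewrite /derive.
have -> : (fun h : R => h^-1 *: (((fun z => f (L z)) \o shift z) (h *: X) - f (L z)))
  = (fun h : R => h^-1 *: ((f \o shift (L z)) (h *: X') - f (L z))) => //.
by apply/funext => h /=; rewrite HL.
Qed.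

Lemma cvg_sumf (T : Type) (F : set_system T) (FF : Filter F) (I : finType)
  (f : I -> T -> R) (l : I -> R) : (forall i, f i x @[x --> F] --> l i) ->
  \sum_i f i x @[x --> F] --> \sum_i l i.
Proof.
move=> cf; have H : forall r : seq I, \sum_(i <- r) f i x @[x --> F] --> \sum_(i <- r) l i.
  elim=> [|i r IH].
    have -> : (fun x => \sum_(i <- [::]) f i x) = cst 0 by apply/funext => y; rewrite big_nil.
    by rewrite big_nil; exact: cvg_cst.
  have -> : (fun x => \sum_(i <- i :: r) f i x) = (fun x => f i x + \sum_(i <- r) f i x).
    by apply/funext => y; rewrite big_cons.
  by rewrite big_cons; apply: cvgD; [exact: cf|exact: IH].
exact: H.
Qed.

Lemma prod_norm_sqr (V V' : normedModType R) (z : V * V') (S : R) :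
  `|z.1| ^+ 2 <= S -> `|z.2| ^+ 2 <= S -> `|z| ^+ 2 <= S.
Proof. by move=> h1 h2; rewrite prod_normE /Order.max; case: ifP. Qed.

Lemma prod_norm_ge (V V' : normedModType R) (z : V * V') (r : R) :
  `|z| <= r -> `|z.1| <= r /\ `|z.2| <= r.
Proof. by rewrite prod_normE ge_max => /andP[]. Qed.

Lemma differentiable_fst (V V' : normedModType R) (z : V * V') : differentiable fst z.
Proof. by apply: linear_differentiable => w; exact: cvg_fst. Qed.

Lemma differentiable_snd (V V' : normedModType R) (z : V * V') : differentiable snd z.
Proof. by apply: linear_differentiable => w; exact: cvg_snd. Qed.

Variable n : nat.
Local Notation E := 'rV[R]_n.
Local Notation W := (E * (E * E))%type.

Lemma norm_sqr_le (w : E) (S : R) : (forall k, w 0 k ^+ 2 <= S) -> 0 <= S -> `|w| ^+ 2 <= S.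
Proof.
move=> wS S0; rewrite -[leRHS](sqr_sqrtr S0); apply: ler_sqr_mono => //.
apply: norm_le => [|k]; first exact: sqrtr_ge0.
by rewrite -sqrtr_sqr; apply: ler_wsqrtr; exact: wS.
Qed.

(** The norm of the product space is a maximum and is not differentiable; this
    sum of squares is smooth and dominates its square. *)
Definition dist2 (z0 z : W) : R := \sum_k ((z.1 - z0.1) 0 k ^+ 2 +
  ((z.2.1 - z0.2.1) 0 k ^+ 2 + (z.2.2 - z0.2.2) 0 k ^+ 2)).

Lemma dist2_ge z0 z : `|z - z0| ^+ 2 <= dist2 z0 z.
Proof.
have ge0 k : 0 <= (z.1 - z0.1) 0 k ^+ 2 + ((z.2.1 - z0.2.1) 0 k ^+ 2 + (z.2.2 - z0.2.2) 0 k ^+ 2).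
  by rewrite !addr_ge0// sqr_ge0.
have D0 : 0 <= dist2 z0 z by rewrite sumr_ge0.
have term k : (z.1 - z0.1) 0 k ^+ 2 + ((z.2.1 - z0.2.1) 0 k ^+ 2 + (z.2.2 - z0.2.2) 0 k ^+ 2)
    <= dist2 z0 z.
  by rewrite /dist2 (bigD1 k)//= lerDl sumr_ge0.
have h1 : `|z.1 - z0.1| ^+ 2 <= dist2 z0 z.
  apply: norm_sqr_le => // k; apply: le_trans (term k).
  by rewrite lerDl addr_ge0// sqr_ge0.
have h2 : `|z.2.1 - z0.2.1| ^+ 2 <= dist2 z0 z.
  apply: norm_sqr_le => // k; apply: le_trans (term k).
  by rewrite addrCA lerDl addr_ge0// sqr_ge0.
have h3 : `|z.2.2 - z0.2.2| ^+ 2 <= dist2 z0 z.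
  apply: norm_sqr_le => // k; apply: le_trans (term k).
  by rewrite addrA lerDr addr_ge0// sqr_ge0.
by apply: prod_norm_sqr => //; exact: prod_norm_sqr.
Qed.

Lemma coord_sub_rule (k : 'I_n) (c y v : E) :
  differentiable (fun y : E => (y - c) 0 k) y /\ 'D_v (fun y : E => (y - c) 0 k) y = v 0 k.
Proof.
have -> : (fun y : E => (y - c) 0 k) = (fun y : E => y 0 k - c 0 k).
  by apply/funext => z; rewrite !mxE.
have dc : differentiable (fun y : E => y 0 k) y by exact: differentiable_coord.
have dk : differentiable (fun _ : E => c 0 k) y by exact: differentiable_cst.
split; first exact: (differentiableB dc dk).
rewrite (deriveBf v dc dk) derive_cst subr0.
by apply: derive_const_growth => h h0 _; rewrite !mxE addrK [LHS]mulKf.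
Qed.

Lemma sqr_linmap_rule (L : W -> E) (k : 'I_n) (c : E) (z X : W) :
  differentiable L z -> (forall h : R, L (h *: X + z) = h *: L X + L z) ->
  differentiable (fun z => (L z - c) 0 k ^+ 2) z /\
  'D_X (fun z => (L z - c) 0 k ^+ 2) z = 2 * (L z - c) 0 k * L X 0 k.
Proof.
move=> dL HL; have [d1 e1] := coord_sub_rule k c (L z) (L X).
have d2 : differentiable (fun z => (L z - c) 0 k) z.
  exact: (differentiable_comp dL d1).
split; first by apply: (@differentiableM R W _ _ z d2 d2).
by rewrite (deriveX2f X d2) (derive_affine (fun y : E => (y - c) 0 k) HL) e1.
Qed.

Lemma differentiable_fst2 (z : W) : differentiable (fun z : W => z.2.1) z.
Proof.
exact: (differentiable_comp (differentiable_snd z) (differentiable_fst z.2)).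
Qed.

Lemma differentiable_snd2 (z : W) : differentiable (fun z : W => z.2.2) z.
Proof.
exact: (differentiable_comp (differentiable_snd z) (differentiable_snd z.2)).
Qed.

Lemma dist2_rule (z0 z X : W) : differentiable (dist2 z0) z /\
  'D_X (dist2 z0) z = \sum_k (2 * (z.1 - z0.1) 0 k * X.1 0 k +
    (2 * (z.2.1 - z0.2.1) 0 k * X.2.1 0 k + 2 * (z.2.2 - z0.2.2) 0 k * X.2.2 0 k)).
Proof.
have H1 k := @sqr_linmap_rule (fun z : W => z.1) k z0.1 z X (differentiable_fst z)
  (fun h => erefl).
have H2 k := @sqr_linmap_rule (fun z : W => z.2.1) k z0.2.1 z X (differentiable_fst2 z)
  (fun h => erefl).
have H3 k := @sqr_linmap_rule (fun z : W => z.2.2) k z0.2.2 z X (differentiable_snd2 z)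
  (fun h => erefl).
have d23 k : differentiable (fun z : W => (z.2.1 - z0.2.1) 0 k ^+ 2 +
    (z.2.2 - z0.2.2) 0 k ^+ 2) z by exact: (differentiableD (H2 k).1 (H3 k).1).
have d123 k : differentiable (fun z : W => (z.1 - z0.1) 0 k ^+ 2 +
    ((z.2.1 - z0.2.1) 0 k ^+ 2 + (z.2.2 - z0.2.2) 0 k ^+ 2)) z.
  exact: (differentiableD (H1 k).1 (d23 k)).
split; first exact: (differentiable_sumf d123).
rewrite (derive_sumf X d123); apply: eq_bigr => k _.
rewrite (deriveDf X (H1 k).1 (d23 k)) (deriveDf X (H2 k).1 (H3 k).1).
by rewrite (H1 k).2 (H2 k).2 (H3 k).2.
Qed.

Lemma dist2_self z0 : dist2 z0 z0 = 0.
Proof.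
by rewrite /dist2 big1// => k _; rewrite !subrr !mxE !expr2 !mulr0 !addr0.
Qed.

Lemma norm_ball_compact3 (z0 : W) (r : R) : compact [set z : W | `|z - z0| <= r].
Proof.
have -> : [set z : W | `|z - z0| <= r] = [set x | `|x - z0.1| <= r] `*`
    ([set y | `|y - z0.2.1| <= r] `*` [set v | `|v - z0.2.2| <= r]).
  apply/seteqP; split=> [[x [y v]]|[x [y v]]] /=.
    by move=> /prod_norm_ge[/= h1 /prod_norm_ge[/= h2 h3]].
  by move=> [h1 [h2 h3]]; rewrite prod_normE ge_max h1 prod_normE ge_max h2 h3.
by apply: compact_setX; [|apply: compact_setX]; exact: norm_ball_compact.
Qed.

Lemma derive_triple (f : E -> E -> E -> R) x y w (a b m : E) :
  differentiable (fun z : W => f z.1 z.2.1 z.2.2) (x, (y, w)) ->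
  'D_((a, (b, m)) : W) (fun z : W => f z.1 z.2.1 z.2.2) (x, (y, w)) =
  \sum_i a 0 i * pd i (fun u => f u y w) x + (\sum_i b 0 i * pd i (fun u => f x u w) y +
    \sum_i m 0 i * pd i (f x y) w).
Proof.
set G := (fun z : W => f z.1 z.2.1 z.2.2) => df.
have -> : (a, (b, m)) = (a, (0, 0)) + ((0, (b, 0)) + (0, (0, m))) :> W.
  apply: injective_projections => /=; first by rewrite !addr0.
  by apply: injective_projections => /=; rewrite !(addr0, add0r).
rewrite (deriveDv _ _ df) (deriveDv _ _ df).
have scale0 (h : R) (u : E) : u = h *: (0 : E) + u by rewrite scaler0 add0r.
congr (_ + (_ + _)).
- have dL : differentiable (fun u : E => (u, (y, w)) : W) x by exact: differentiable_pair.
  have df1 : differentiable (fun u => f u y w) x.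
    exact: (differentiable_comp (g := G) dL df).
  rewrite -(derive_row _ df1); apply/esym.
  apply: (@derive_affine E W (fun u : E => (u, (y, w))) G x a (a, (0, 0))) => h.
  by congr (_, (_, _)); exact: scale0.
- have dL : differentiable (fun u : E => (x, (u, w)) : W) y.
    by apply: differentiable_pair => //; exact: differentiable_pair.
  have df1 : differentiable (fun u => f x u w) y.
    exact: (differentiable_comp (g := G) dL df).
  rewrite -(derive_row _ df1); apply/esym.
  apply: (@derive_affine E W (fun u : E => (x, (u, w))) G y b (0, (b, 0))) => h.
  by congr (_, (_, _)); exact: scale0.
- have dL : differentiable (fun u : E => (x, (y, u)) : W) w.
    by apply: differentiable_pair => //; exact: differentiable_pair.
  have df1 : differentiable (f x y) w.
    exact: (differentiable_comp (g := G) dL df).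
  rewrite -(derive_row _ df1); apply/esym.
  apply: (@derive_affine E W (fun u : E => (x, (y, u))) G w m (0, (0, m))) => h.
  by congr (_, (_, _)); exact: scale0.
Qed.

End ProductCalculus.

(** * The transport equation of the angular metric *)

Section Transport.
Variables (R : realType) (n : nat) (U : set 'rV[R]_n).
Hypothesis U_open : open U.
Local Notation E := 'rV[R]_n.
Local Notation W := (E * (E * E))%type.
Variable F : E -> E -> R.
Hypothesis hF : finsler U F.
Implicit Types (x y v w a b m : E) (z X : W).

Definition angular_coef (j k : 'I_n) x y : R :=
  (g F j k x y - llow F j x y * llow F k x y) * (F x y ^+ 2)^-1.

Lemma smooth_angular_coef j k : smooth2 U (angular_coef j k).
Proof.
apply: (smooth2M U_open).
  apply: (smooth2B U_open); first exact: smooth_g.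
  by apply: (smooth2M U_open); exact: smooth_llow.
apply: (smooth2V U_open); last exact: smooth_F2.
by move=> x y Ux y0; rewrite expf_neq0// (F_neq0 hF).
Qed.

Lemma angularE x y v : angular F x y v = quad (fun j k => angular_coef j k x y) v.
Proof.
rewrite /angular /quad expr2 /lform big_distrlr /= /gform -sumrB mulr_suml.
apply: eq_bigr => j _; rewrite -sumrB mulr_suml; apply: eq_bigr => k _.
by rewrite /angular_coef; ring.
Qed.

Lemma coord_rule (k : 'I_n) y v :
  differentiable (fun y : E => y 0 k) y /\ 'D_v (fun y : E => y 0 k) y = v 0 k.
Proof.
split; first exact: differentiable_coord.
by apply: derive_const_growth => h h0 _; rewrite !mxE addrK [LHS]mulKf.
Qed.

Lemma coord22_rule (k : 'I_n) z X : differentiable (fun z : W => z.2.2 0 k) z /\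
  'D_X (fun z : W => z.2.2 0 k) z = X.2.2 0 k.
Proof.
have [d1 e1] := coord_rule k z.2.2 X.2.2.
split; first exact: (differentiable_comp (differentiable_snd2 z) d1).
rewrite -e1; exact: (@derive_affine R W E (fun z => z.2.2) _ z X X.2.2 (fun h => erefl)).
Qed.

Lemma base_rule (f : E -> E -> R) z X : differentiable (uncur f) (z.1, z.2.1) ->
  differentiable (fun z : W => f z.1 z.2.1) z /\
  'D_X (fun z : W => f z.1 z.2.1) z = 'D_((X.1, X.2.1) : E * E) (uncur f) (z.1, z.2.1).
Proof.
move=> df.
have dL : differentiable (fun z : W => (z.1, z.2.1) : E * E) z.
  exact: (differentiable_pair (differentiable_fst z) (differentiable_fst2 z)).
split; first exact: (differentiable_comp (g := uncur f) dL df).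
exact: (@derive_affine R W (E * E)%type (fun z => (z.1, z.2.1)) (uncur f) z X
  (X.1, X.2.1) (fun h => erefl)).
Qed.

Lemma angular_rule z X : U z.1 -> z.2.1 != 0 ->
  differentiable (fun z : W => angular F z.1 z.2.1 z.2.2) z /\
  'D_X (fun z : W => angular F z.1 z.2.1 z.2.2) z =
  \sum_j \sum_k ('D_((X.1, X.2.1) : E * E) (uncur (angular_coef j k)) (z.1, z.2.1)
      * z.2.2 0 j * z.2.2 0 k +
    angular_coef j k z.1 z.2.1 * (X.2.2 0 j * z.2.2 0 k + z.2.2 0 j * X.2.2 0 k)).
Proof.
move=> Ux y0.
have -> : (fun z : W => angular F z.1 z.2.1 z.2.2) =
    (fun z : W => \sum_j \sum_k angular_coef j k z.1 z.2.1 * z.2.2 0 j * z.2.2 0 k).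
  by apply/funext => u; rewrite angularE.
have B j k := @base_rule (angular_coef j k) z X
  (smooth2_diff (smooth_angular_coef j k) Ux y0).
have C k := coord22_rule k z X.
have d1 j k : differentiable (fun z : W => angular_coef j k z.1 z.2.1 * z.2.2 0 j) z.
  exact: (differentiableM (B j k).1 (C j).1).
have d2 j k : differentiable
    (fun z : W => angular_coef j k z.1 z.2.1 * z.2.2 0 j * z.2.2 0 k) z.
  exact: (differentiableM (d1 j k) (C k).1).
have d3 j := differentiable_sumf (d2 j).
split; first exact: (differentiable_sumf d3).
rewrite (derive_sumf X d3); apply: eq_bigr => j _.
rewrite (derive_sumf X (d2 j)); apply: eq_bigr => k _.
rewrite (deriveMf X (d1 j k) (C k).1) (deriveMf X (B j k).1 (C j).1).
rewrite (B j k).2 (C j).2 (C k).2.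
by set D := 'D__ _ _; move: D; clear => D; ring.
Qed.

Lemma sum_delta_mx (i : 'I_n) (f : 'I_n -> R) : \sum_k (delta_mx 0 i : E) 0 k * f k = f i.
Proof.
rewrite -(sum_delta f i); apply: eq_bigr => k _.
by rewrite mxE eqxx mulrC.
Qed.

Variable H : E -> R.
Hypothesis H_smooth : smooth_on U H.
Hypothesis H_gt0 : forall x, U x -> 0 < H x.
Variable N : 'I_n -> 'I_n -> E -> E -> R.
Hypothesis N_smooth : forall k i, smooth2 U (N k i).
Variable i : 'I_n.

Definition rate x : R := (H x)^-1 * pd i H x.

Definition Nrow x y : E := \row_k N k i x y.

Definition Nrow_derive x y v : E := \row_k \sum_m v 0 m * pd m (N k i x) y.

Lemma transport_sum x y w (p q r : 'I_n -> R) :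
  \sum_k (delta_mx 0 i : E) 0 k * p k +
    (\sum_k Nrow x y 0 k * q k + \sum_k Nrow x w 0 k * r k) =
  p i + (\sum_k N k i x y * q k + \sum_k N k i x w * r k).
Proof.
rewrite sum_delta_mx; congr (_ + (_ + _)); by apply: eq_bigr => k _; rewrite mxE.
Qed.

Lemma addr_solve (a b c d : R) : a + b + c + d = 0 -> a + (b + c) = - d.
Proof. by move=> /eqP; rewrite addr_eq0 -addrA => /eqP. Qed.

Definition scaled_angle2 (e : R) z : R := angle F z.1 z.2.1 (z.2.1 + e *: z.2.2) ^+ 2 / e ^+ 2.

(** The angle equation at (x, y, y + e v) in the variables (x, y, v): the
    second argument moves by N(x, y) and the third by N(x, y + e v), so v
    moves by their difference quotient. *)
Lemma scaled_angle2_rule (e : R) x y v : e != 0 ->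
  differentiable (fun z : W => angle F z.1 z.2.1 z.2.2) (x, (y, y + e *: v)) ->
  angle_equation F H N i x y (y + e *: v) ->
  differentiable (scaled_angle2 e) (x, (y, v)) /\
  'D_((delta_mx 0 i, (Nrow x y, e^-1 *: (Nrow x (y + e *: v) - Nrow x y))) : W)
     (scaled_angle2 e) (x, (y, v)) = - (2 * rate x * scaled_angle2 e (x, (y, v))).
Proof.
move=> e0 dG eqn.
pose G (z : W) := angle F z.1 z.2.1 z.2.2.
pose L (z : W) : W := (z.1, (z.2.1, z.2.1 + e *: z.2.2)).
pose z : W := (x, (y, v)).
pose X : W := (delta_mx 0 i, (Nrow x y, e^-1 *: (Nrow x (y + e *: v) - Nrow x y))).
(* L is affine and carries the direction X to X'. *)
pose X' : W := (delta_mx 0 i, (Nrow x y, Nrow x (y + e *: v))).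
have dL : differentiable L z.
  apply: differentiable_pair; first exact: differentiable_fst.
  apply: differentiable_pair; first exact: differentiable_fst2.
  apply: differentiableD; first exact: differentiable_fst2.
  by apply: differentiableZ; exact: differentiable_snd2.
have dGL : differentiable (fun z => G (L z)) z by exact: (differentiable_comp (g := G) dL dG).
have eGL : 'D_X (fun z => G (L z)) z = 'D_X' G (L z).
  apply: derive_affine => h; rewrite /L /X /X' /=; congr (_, (_, _)).
  rewrite scalerDr addrACA; congr (_ + _).
  rewrite [e *: (h *: _)]scalerA [(e * h) *: _]scalerA [e * h]mulrC -mulrA divff// mulr1.
  by rewrite scalerBr addrC subrK.
have eG : 'D_X' G (L z) = - (rate x * angle F x y (y + e *: v)).
  have T := @derive_triple R n (fun x y w => angle F x y w) x y (y + e *: v)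
    (delta_mx 0 i) (Nrow x y) (Nrow x (y + e *: v)) dG.
  exact: (etrans (etrans T (transport_sum x y (y + e *: v) _ _ _)) (addr_solve eqn)).
have GE : scaled_angle2 e = (fun z => (e ^+ 2)^-1 * G (L z) ^+ 2).
  by apply/funext => u; rewrite /scaled_angle2 mulrC.
have dG2 : differentiable (fun z => G (L z) ^+ 2) z.
  exact: (@differentiableM R W _ _ z dGL dGL).
rewrite GE; split; first exact: differentiableZ.
rewrite (deriveZf X _ dG2) (deriveX2f X dGL) eGL eG.
rewrite -[G (L (x, (y, v)))]/(angle F x y (y + e *: v)).
move: (angle F x y (y + e *: v)) (rate x) => t c.
by ring.
Qed.

End Transport.

Lemma cvg_through (V V' : topologicalType) (h : V -> V') (u : nat -> V) (a : V) :
  {for a, continuous h} -> u j @[j --> \oo] --> a -> h (u j) @[j --> \oo] --> h a.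
Proof. by move=> ch cu; exact: (cvg_comp u h cu ch). Qed.

Section TransportLimit.
Variables (R : realType) (n : nat) (U : set 'rV[R]_n).
Hypothesis U_open : open U.
Local Notation E := 'rV[R]_n.
Local Notation W := (E * (E * E))%type.
Variable F : E -> E -> R.
Hypothesis hF : finsler U F.
Variable H : E -> R.
Hypothesis H_smooth : smooth_on U H.
Hypothesis H_gt0 : forall x, U x -> 0 < H x.
Variable N : 'I_n -> 'I_n -> E -> E -> R.
Hypothesis N_smooth : forall k i, smooth2 U (N k i).
Variable i : 'I_n.
Implicit Types (x y v w : E) (z X : W).

Lemma rate_continuous x : U x -> {for x, continuous (rate H i)}.
Proof.
move=> Ux; apply: (smooth_cont _ Ux).
apply: (smoothM U_open); last exact: (smooth_derive (delta_mx 0 i) H_smooth).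
by apply: (smoothV U_open) H_smooth => y Uy; rewrite gt_eqF// H_gt0.
Qed.

Lemma dN_directional (f : E -> E -> R) x y : smooth2 U f -> U x -> y != 0 ->
  'D_((delta_mx 0 i, Nrow N i x y) : E * E) (uncur f) (x, y) = dN N i f x y.
Proof.
move=> sf Ux y0; rewrite (derive_uncur _ _ (smooth2_diff sf Ux y0)) sum_delta_mx /dN.
by congr (_ + _); apply: eq_bigr => k _; rewrite mxE.
Qed.

Lemma smooth_dN (f : E -> E -> R) : smooth2 U f -> smooth2 U (dN N i f).
Proof.
move=> sf; apply: (smooth2D U_open); first exact: (smooth2_pd1 U_open i sf).
apply: (smooth2_sum U_open) => k; apply: (smooth2M U_open); first exact: N_smooth.
exact: (smooth2_pd U_open k sf).
Qed.

Section Sequence.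
Variables (z0 : W) (e_ : nat -> R) (z_ : nat -> W).
Hypothesis ce : e_ j @[j --> \oo] --> (0 : R).
Hypothesis cz : z_ j @[j --> \oo] --> z0.
Hypothesis e_gt0 : forall j, 0 < e_ j.
Hypothesis Uz0 : U z0.1.
Hypothesis yz0 : z0.2.1 != 0.
Hypothesis Uz : forall j, U (z_ j).1.
Hypothesis seg0 : forall j (s : R), 0 <= s <= 1 ->
  s *: (e_ j *: (z_ j).2.2) + (z_ j).2.1 != 0.

Lemma cvg_base (f : E -> E -> R) : smooth2 U f ->
  f (z_ j).1 (z_ j).2.1 @[j --> \oo] --> f z0.1 z0.2.1.
Proof.
move=> sf; have [d _] := @base_rule R n f z0 z0 (smooth2_diff sf Uz0 yz0).
have c : {for z0, continuous (fun z : W => f z.1 z.2.1)} by exact: differentiable_continuous d.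
exact: (cvg_through (h := fun z : W => f z.1 z.2.1) c cz).
Qed.

Lemma cvg_coord22 k : (z_ j).2.2 0 k @[j --> \oo] --> z0.2.2 0 k.
Proof.
have [d _] := @coord22_rule R n k z0 z0.
exact: (cvg_through (h := fun z : W => z.2.2 0 k) (differentiable_continuous d) cz).
Qed.

Lemma cvg_linmap0 (L : W -> E) k : (forall z, differentiable L z) ->
  (L (z_ j) - L z0) 0 k @[j --> \oo] --> (0 : R).
Proof.
move=> dL; have [d1 _] := coord_sub_rule k (L z0) (L z0) 0.
have d : differentiable (fun z => (L z - L z0) 0 k) z0 by exact: (differentiable_comp (dL z0) d1).
have := cvg_through (h := fun z => (L z - L z0) 0 k) (differentiable_continuous d) cz.
by rewrite subrr [X in _ --> X]mxE.
Qed.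

Definition secant (j : nat) : E := (e_ j)^-1 *:
  (Nrow N i (z_ j).1 ((z_ j).2.1 + e_ j *: (z_ j).2.2) - Nrow N i (z_ j).1 (z_ j).2.1).

Lemma cvg_intermediate (t : nat -> R) : (forall j, 0 <= t j <= 1) ->
  t j *: (e_ j *: (z_ j).2.2) + (z_ j).2.1 @[j --> \oo] --> z0.2.1.
Proof.
move=> t01; rewrite -[X in _ --> X]add0r.
have cv : (z_ j).2.2 @[j --> \oo] --> z0.2.2.
  exact: (cvg_through (h := fun z : W => z.2.2)
    (differentiable_continuous (differentiable_snd2 z0)) cz).
have cy : (z_ j).2.1 @[j --> \oo] --> z0.2.1.
  exact: (cvg_through (h := fun z : W => z.2.1)
    (differentiable_continuous (differentiable_fst2 z0)) cz).
apply: cvgD; last exact: cy.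
have c0 : e_ j *: (z_ j).2.2 @[j --> \oo] --> (0 : E).
  by rewrite -(scale0r z0.2.2); apply: cvgZ.
apply/cvgrPdist_le => d d0; move/cvgrPdist_le : c0 => /(_ d d0); apply: filterS => j.
rewrite !sub0r !normrN => h; apply: le_trans h; rewrite [leLHS]normrZ.
by case/andP: (t01 j) => t0 t1; rewrite (ger0_norm t0) ler_piMl.
Qed.

(** The mean value theorem on the segment from y to y + e v turns the
    difference quotient into derivatives of N at points that converge to y. *)
Lemma cvg_secant k : secant j 0 k @[j --> \oo] -->
  \sum_m z0.2.2 0 m * pd m (N k i z0.1) z0.2.1.
Proof.
have H1 (j : nat) : exists t : R, 0 <= t <= 1 /\ secant j 0 k =
    \sum_m (z_ j).2.2 0 m * pd m (N k i (z_ j).1) (t *: (e_ j *: (z_ j).2.2) + (z_ j).2.1).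
  have dl (s : R) : 0 <= s <= 1 -> differentiable (N k i (z_ j).1)
      (s *: (e_ j *: (z_ j).2.2) + (z_ j).2.1).
    by move=> s01; exact: (smooth2_diff2 (N_smooth k i) (Uz j) (seg0 j s01)).
  have [t /andP[t0 t1] tE] := MVT_line dl.
  have t01 : 0 <= t <= 1 by rewrite !ltW.
  exists t; split=> //.
  rewrite /secant mxE sub_coord ![Nrow _ _ _ _ 0 k]mxE [_ + e_ j *: _]addrC tE.
  rewrite (derive_row _ (dl t t01)) mulr_sumr; apply: eq_bigr => m _.
  by rewrite mxE mulrA mulKf// gt_eqF.
have [t Ht] := choice H1.
have -> : (fun j => secant j 0 k) = (fun j => \sum_m (z_ j).2.2 0 m *
    pd m (N k i (z_ j).1) (t j *: (e_ j *: (z_ j).2.2) + (z_ j).2.1)).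
  by apply/funext => j; have [_] := Ht j.
apply: cvg_sumf => m; apply: cvgM; first exact: cvg_coord22.
have cw := cvg_intermediate (fun j => (Ht j).1).
have cx : (z_ j).1 @[j --> \oo] --> z0.1.
  exact: (cvg_through (h := fun z : W => z.1)
    (differentiable_continuous (differentiable_fst z0)) cz).
have sp := smooth2_pd U_open m (N_smooth k i).
exact: (cvg_through (h := uncur (fun x y => pd m (N k i x) y)) (smooth2_cont sp Uz0 yz0)
  (cvg_pair cx cw)).
Qed.

End Sequence.
End TransportLimit.

Section AngularTransport.
Variables (R : realType) (n : nat) (U : set 'rV[R]_n).
Hypothesis U_open : open U.
Local Notation E := 'rV[R]_n.
Local Notation W := (E * (E * E))%type.
Variable F : E -> E -> R.
Hypothesis hF : finsler U F.
Variable H : E -> R.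
Hypothesis H_smooth : smooth_on U H.
Hypothesis H_gt0 : forall x, U x -> 0 < H x.
Variable N : 'I_n -> 'I_n -> E -> E -> R.
Hypothesis N_smooth : forall k i, smooth2 U (N k i).
Hypothesis angle_pde : forall x y1 y2, U x -> y1 != 0 -> y2 != 0 ->
  direction F x y1 != direction F x y2 ->
  joining_arc_well_defined F x y1 y2 ->
  differentiable (fun z : W => angle F z.1 z.2.1 z.2.2) (x, (y1, y2)) /\
  forall i, angle_equation F H N i x y1 y2.
Variable i : 'I_n.
Implicit Types (x y v w : E) (z X : W).

(** The derivative of the angular metric when (x, y) moves along d_i and v
    moves with velocity m. *)
Definition angular_lie x y v (m : E) : R :=
  \sum_j \sum_k (dN N i (angular_coef F j k) x y * v 0 j * v 0 k +
    angular_coef F j k x y * (m 0 j * v 0 k + v 0 j * m 0 k)).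

(** The limit of the equation for the scaled squared angle at the points
    supplied by [touching_sequence]. Where the angular metric does not vanish
    at v0, nearby v are not multiples of y, so the directions of y and y + e v
    are distinct and the angle equation applies. *)
Lemma angular_transport x0 y0 v0 : U x0 -> y0 != 0 -> angular F x0 y0 v0 != 0 ->
  angular_lie x0 y0 v0 (Nrow_derive N i x0 y0 v0)
    + 2 * rate H i x0 * angular F x0 y0 v0 = 0.
Proof.
move=> Ux0 y00 Q0; pose z0 : W := (x0, (y0, v0)).
pose Q (z : W) := angular F z.1 z.2.1 z.2.2.
have [r [C [e0 [[rp C0 e00] Hexp]]]] := angle_expansion U_open hF v0 Ux0 y00.
have Qc : {for z0, continuous Q}.
  by apply: differentiable_continuous; exact: (angular_rule U_open hF (z := z0) z0 Ux0 y00).1.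
(* Near z0 the vector v stays away from the multiples of y. *)
have [r' r'0 Hr'] : exists2 r' : R, 0 < r' & forall z, `|z - z0| <= r' -> Q z != 0.
  have Q0' : 0 < `|Q z0| by rewrite normr_gt0.
  move/cvgrPdist_lt : Qc => /(_ _ Q0') /nbhs_ballP[s /= s0 Hs].
  exists (s / 2); first by rewrite divr_gt0.
  move=> z zs; have /Hs /= h : ball z0 s z.
    rewrite -ball_normE /ball_/= distrC; apply: (le_lt_trans zs).
    by rewrite ltr_pdivrMr// ltr_pMr// ltr1n.
  by apply/eqP => Qz; move: h; rewrite Qz subr0 ltxx.
pose r0 := Num.min r r'.
have r00 : 0 < r0 by rewrite lt_min rp.
have inbox (z : W) (e : R) : `|z - z0| <= r0 -> 0 < e -> e <= e0 ->
  [/\ U z.1, z.2.1 != 0, z.2.1 + e *: z.2.2 != 0,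
    joining_arc_well_defined F z.1 z.2.1 (z.2.1 + e *: z.2.2) &
    `|angle F z.1 z.2.1 (z.2.1 + e *: z.2.2) ^+ 2 / e ^+ 2 - Q z| <= C * e].
  rewrite le_min => /andP[/prod_norm_ge[/= h1 /prod_norm_ge[/= h2 h3]] _] ep ee.
  exact: Hexp.
have pde (z : W) (e : R) : `|z - z0| <= r0 -> 0 < e -> e <= e0 ->
  differentiable (fun z : W => angle F z.1 z.2.1 z.2.2) (z.1, (z.2.1, z.2.1 + e *: z.2.2)) /\
  angle_equation F H N i z.1 z.2.1 (z.2.1 + e *: z.2.2).
  move=> zr ep ee; have [Ux y1 y2 jn _] := inbox z e zr ep ee.
  have Qz : Q z != 0 by apply: Hr'; move: zr; rewrite le_min => /andP[].
  have en0 : e != 0 by rewrite gt_eqF.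
  have dd : direction F z.1 z.2.1 != direction F z.1 (z.2.1 + e *: z.2.2).
    apply/negP => /eqP/(direction_inj U_open hF Ux y1 y2 en0) Qz0.
    by move: Qz; rewrite /Q Qz0 eqxx.
  by have [d eqn] := angle_pde Ux y1 y2 dd jn; split; [exact: d|exact: eqn].
have Arule (z : W) (e : R) : `|z - z0| <= r0 -> 0 < e -> e <= e0 ->
  differentiable (scaled_angle2 F e) z /\
  'D_((delta_mx 0 i, (Nrow N i z.1 z.2.1, e^-1 *:
      (Nrow N i z.1 (z.2.1 + e *: z.2.2) - Nrow N i z.1 z.2.1))) : W) (scaled_angle2 F e) z =
    - (2 * rate H i z.1 * scaled_angle2 F e z).
  move=> zr ep ee; have [d eqn] := pde z e zr ep ee.
  case: z {zr} d eqn => x [y v] /= d eqn.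
  by apply: scaled_angle2_rule => //; rewrite gt_eqF.
have Qrule (z X : W) : `|z - z0| <= r0 -> differentiable Q z.
  move=> zr; have [Ux y1 _ _ _] := inbox z e0 zr e00 (lexx e0).
  exact: (angular_rule U_open hF X Ux y1).1.
have [e_ [z_ [Hb ce cz HD]]] := @touching_sequence R W z0 Q (dist2 z0) (scaled_angle2 F)
  r0 C e0 r00 C0 e00 (@norm_ball_compact3 R n z0) (dist2_self z0) (dist2_ge z0)
  (fun z => (dist2_rule z0 z z).1) (fun z zr => Qrule z z zr)
  (fun e z ep ee zr => (Arule z e zr ep ee).1)
  (fun e z ep ee zr => let: And5 _ _ _ _ h := inbox z e zr ep ee in h).
have ep j : 0 < e_ j by have [] := Hb j.
have Uz j : U (z_ j).1 by have [e1 e2 e3] := Hb j; have [] := inbox _ _ e3 e1 e2.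
have yz j : (z_ j).2.1 != 0 by have [e1 e2 e3] := Hb j; have [] := inbox _ _ e3 e1 e2.
have seg j (s : R) : 0 <= s <= 1 -> s *: (e_ j *: (z_ j).2.2) + (z_ j).2.1 != 0.
  move=> /andP[]; rewrite le_eqVlt => /orP[/eqP<- _|s0 s1].
    by rewrite scale0r add0r.
  have [e1 e2 e3] := Hb j.
  have se : 0 < s * e_ j by rewrite mulr_gt0.
  have se0 : s * e_ j <= e0 by apply: le_trans e2; rewrite ler_piMl// ltW.
  by have [_ _ h _ _] := inbox _ _ e3 se se0; rewrite scalerA addrC.
pose m := secant N i e_ z_.
(* The derivative of the penalty in the direction of the angle equation; it
   tends to 0 since the direction is bounded. *)
pose D j := \sum_k (2 * ((z_ j).1 - x0) 0 k * (delta_mx 0 i : E) 0 k +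
    (2 * ((z_ j).2.1 - y0) 0 k * Nrow N i (z_ j).1 (z_ j).2.1 0 k +
     2 * ((z_ j).2.2 - v0) 0 k * m j 0 k)).
have eqn j : angular_lie (z_ j).1 (z_ j).2.1 (z_ j).2.2 (m j) - D j +
    2 * rate H i (z_ j).1 * scaled_angle2 F (e_ j) (z_ j) = 0.
  have [e1 e2 e3] := Hb j; have [_ eA] := Arule _ _ e3 e1 e2.
  have := HD j (delta_mx 0 i, (Nrow N i (z_ j).1 (z_ j).2.1, m j)).
  rewrite [X in X = _ -> _]eA (dist2_rule z0 (z_ j) _).2.
  rewrite (angular_rule U_open hF _ (Uz j) (yz j)).2 /= => eq1.
  rewrite -[2 * _ * _]opprK eq1 /D.
  suff -> : angular_lie (z_ j).1 (z_ j).2.1 (z_ j).2.2 (m j) =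
    \sum_j0 \sum_k ('D_((delta_mx 0 i, Nrow N i (z_ j).1 (z_ j).2.1) : E * E)
      (uncur (angular_coef F j0 k)) ((z_ j).1, (z_ j).2.1) *
      (z_ j).2.2 0 j0 * (z_ j).2.2 0 k + angular_coef F j0 k (z_ j).1 (z_ j).2.1 *
      (m j 0 j0 * (z_ j).2.2 0 k + (z_ j).2.2 0 j0 * m j 0 k)) by rewrite subrr.
  apply: eq_bigr => a _; apply: eq_bigr => b _.
  by rewrite (dN_directional N i (smooth_angular_coef U_open hF a b) (Uz j) (yz j)).
have cm k : m j 0 k @[j --> \oo] --> \sum_m v0 0 m * pd m (N k i x0) y0.
  exact: (cvg_secant U_open N_smooth ce cz ep Ux0 y00 Uz seg).
have cv k : (z_ j).2.2 0 k @[j --> \oo] --> v0 0 k by exact: (cvg_coord22 cz).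
have cf (f : E -> E -> R) : smooth2 U f -> f (z_ j).1 (z_ j).2.1 @[j --> \oo] --> f x0 y0.
  by move=> sf; exact: (cvg_base cz Ux0 y00 sf).
pose M : E := Nrow_derive N i x0 y0 v0.
have ME k : M 0 k = \sum_m v0 0 m * pd m (N k i x0) y0 by rewrite mxE.
have c1 : angular_lie (z_ j).1 (z_ j).2.1 (z_ j).2.2 (m j) @[j --> \oo] -->
    angular_lie x0 y0 v0 M.
  apply: cvg_sumf => a; apply: cvg_sumf => b; apply: cvgD.
    apply: cvgM; last exact: cv.
    apply: cvgM; last exact: cv.
    exact: (cf _ (smooth_dN U_open N_smooth i (smooth_angular_coef U_open hF a b))).
  apply: cvgM; first exact: (cf _ (smooth_angular_coef U_open hF a b)).
  by apply: cvgD; apply: cvgM; rewrite ?ME; [exact: cm|exact: cv|exact: cv|exact: cm].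
have c2 : D j @[j --> \oo] --> (0 : R).
  have -> : (0 : R) = \sum_k (2 * 0 * (delta_mx 0 i : E) 0 k +
     (2 * 0 * N k i x0 y0 + 2 * 0 * M 0 k)).
    by rewrite big1// => k _; rewrite !mulr0 !mul0r !addr0.
  apply: cvg_sumf => k; apply: cvgD; last apply: cvgD.
  - apply: cvgM; last exact: cvg_cst.
    apply: cvgM; first exact: cvg_cst.
    exact: (cvg_linmap0 cz k (@differentiable_fst R E _)).
  - apply: cvgM.
      apply: cvgM; first exact: cvg_cst.
      exact: (cvg_linmap0 cz k (@differentiable_fst2 R n)).
    have -> : (fun j => Nrow N i (z_ j).1 (z_ j).2.1 0 k) = (fun j => N k i (z_ j).1 (z_ j).2.1).
      by apply/funext => j; rewrite mxE.
    exact: cf.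
  - rewrite ME; apply: cvgM; last exact: cm.
    apply: cvgM; first exact: cvg_cst.
    exact: (cvg_linmap0 cz k (@differentiable_snd2 R n)).
have c3 : scaled_angle2 F (e_ j) (z_ j) @[j --> \oo] --> angular F x0 y0 v0.
  have cQ : Q (z_ j) @[j --> \oo] --> Q z0 by exact: (cvg_through (h := Q) Qc cz).
  have cA : scaled_angle2 F (e_ j) (z_ j) - Q (z_ j) @[j --> \oo] --> (0 : R).
    have cCe : C * e_ j @[j --> \oo] --> (0 : R).
      by rewrite -[X in _ --> X](mulr0 C); apply: cvgM; [exact: cvg_cst|exact: ce].
    apply/cvgrPdist_le => d d0; move/cvgrPdist_le : cCe => /(_ d d0); apply: filterS => j.
    rewrite !sub0r !normrN => h; have [e1 e2 e3] := Hb j.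
    have [_ _ _ _ h2] := inbox _ _ e3 e1 e2.
    by apply: (le_trans h2); apply: le_trans h; exact: ler_norm.
  have -> : (fun j => scaled_angle2 F (e_ j) (z_ j)) =
      (fun j => (scaled_angle2 F (e_ j) (z_ j) - Q (z_ j)) + Q (z_ j)).
    by apply/funext => j; rewrite subrK.
  by rewrite -[X in _ --> X]add0r; apply: cvgD; [exact: cA|exact: cQ].
have c4 : rate H i (z_ j).1 @[j --> \oo] --> rate H i x0.
  have cx : (z_ j).1 @[j --> \oo] --> x0.
    exact: (cvg_through (h := fun z : W => z.1)
      (differentiable_continuous (differentiable_fst z0)) cz).
  have cr : {for x0, continuous (rate H i)}.
    exact: (rate_continuous U_open H_smooth H_gt0 Ux0).
  exact: (cvg_through (h := rate H i) cr cx).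
have cL : angular_lie (z_ j).1 (z_ j).2.1 (z_ j).2.2 (m j) - D j +
    2 * rate H i (z_ j).1 * scaled_angle2 F (e_ j) (z_ j) @[j --> \oo] -->
    angular_lie x0 y0 v0 M - 0 + 2 * rate H i x0 * angular F x0 y0 v0.
  apply: cvgD; first exact: cvgB.
  by apply: cvgM => //; apply: cvgM => //; exact: cvg_cst.
have c0 : angular_lie (z_ j).1 (z_ j).2.1 (z_ j).2.2 (m j) - D j +
    2 * rate H i (z_ j).1 * scaled_angle2 F (e_ j) (z_ j) @[j --> \oo] --> (0 : R).
  have -> : (fun j => angular_lie (z_ j).1 (z_ j).2.1 (z_ j).2.2 (m j) - D j +
    2 * rate H i (z_ j).1 * scaled_angle2 F (e_ j) (z_ j)) = (fun=> 0).
    by apply/funext => j; exact: eqn.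
  exact: cvg_cst.
have e := cvg_unique (@Rhausdorff R) cL c0.
by rewrite subr0 in e; apply: e.
Qed.

End AngularTransport.

(** * Quadratic forms and the covariant derivatives *)

Section Polarization.
Variables (R : realType) (n : nat).
Local Notation E := 'rV[R]_n.
Implicit Types (b : 'I_n -> 'I_n -> R) (v w : E).

Lemma quad_parallelogram b v w :
  quad b (v + w) + quad b (v - w) = 2 * quad b v + 2 * quad b w.
Proof.
rewrite /quad -big_split !mulr_sumr -big_split; apply: eq_bigr => j _ /=.
rewrite -big_split !mulr_sumr -big_split; apply: eq_bigr => k _ /=.
by rewrite !mxE; ring.
Qed.

Lemma quad_add b v w : quad b (v + w) = quad b v + quad b w +
  (\sum_j \sum_k b j k * v 0 j * w 0 k + \sum_j \sum_k b j k * w 0 j * v 0 k).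
Proof.
rewrite /quad -!big_split; apply: eq_bigr => j _ /=.
rewrite -!big_split; apply: eq_bigr => k _ /=.
by rewrite !mxE; ring.
Qed.

Lemma bilinear_delta b p q :
  \sum_j \sum_k b j k * (delta_mx 0 p : E) 0 j * (delta_mx 0 q : E) 0 k = b p q.
Proof.
rewrite -(sum_delta_mx p (fun j => b j q)); apply: eq_bigr => j _.
rewrite -(sum_delta_mx q (fun k => b j k)) mulr_sumr; apply: eq_bigr => k _.
by ring.
Qed.

Lemma quad_polarization b : (forall j k, b j k = b k j) -> (forall v, quad b v = 0) ->
  forall j k, b j k = 0.
Proof.
move=> bs b0 j k; have := quad_add b (delta_mx 0 j) (delta_mx 0 k).
rewrite !b0 !bilinear_delta (bs k j) !add0r => /eqP.
by rewrite eq_sym -mulr2n mulrn_eq0 => /eqP.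
Qed.

End Polarization.

Section CovariantDerivatives.
Variables (R : realType) (n : nat) (U : set 'rV[R]_n).
Hypothesis U_open : open U.
Local Notation E := 'rV[R]_n.
Variable F : E -> E -> R.
Hypothesis hF : finsler U F.
Variable H : E -> R.
Variable N : 'I_n -> 'I_n -> E -> E -> R.
Hypothesis N_smooth : forall k i, smooth2 U (N k i).
Hypothesis N_homo : forall k i x y (a : R), U x -> y != 0 -> 0 < a ->
  N k i x (a *: y) = a * N k i x y.
Hypothesis dF_eq0 : forall i x y, U x -> y != 0 -> dN N i F x y = 0.
Implicit Types (x y v w : E) (i j k m : 'I_n).

Lemma lup_llow x y : U x -> y != 0 -> \sum_k lup F k x y * llow F k x y = 1.
Proof.
move=> Ux y0; have e : \sum_k lup F k x y * llow F k x y =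
    (\sum_k y 0 k * llow F k x y) / F x y.
  by rewrite mulr_suml; apply: eq_bigr => k _; rewrite /lup mulrAC.
by rewrite e (llow_euler hF Ux y0) divff// (F_neq0 hF Ux y0).
Qed.

Lemma h_contract_up k x y : U x -> y != 0 -> \sum_m h F k m x y * y 0 m = 0.
Proof.
move=> Ux y0; rewrite /h; under eq_bigr => m _ do rewrite mulrBl.
rewrite sumrB; under eq_bigr => m _ do rewrite mulrC eq_sym; rewrite sum_delta.
under eq_bigr => m _ do rewrite -mulrA [llow _ _ _ _ * _]mulrC.
by rewrite -mulr_sumr (llow_euler hF Ux y0) /lup divfK ?subrr// (F_neq0 hF Ux y0).
Qed.

Lemma h_contract_low m x y : U x -> y != 0 -> \sum_a h F a m x y * llow F a x y = 0.
Proof.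
move=> Ux y0; rewrite /h; under eq_bigr => a _ do rewrite mulrBl.
rewrite sumrB; under eq_bigr => a _ do rewrite mulrC; rewrite sum_delta.
under eq_bigr => a _ do rewrite mulrAC.
by rewrite -mulr_suml (lup_llow Ux y0) mul1r subrr.
Qed.

Lemma T_contract k i x y : U x -> y != 0 ->
  \sum_m T F H N k i m x y * y 0 m = - N k i x y.
Proof.
move=> Ux y0; rewrite /T -/(rate H i x); under eq_bigr => m _ do rewrite mulrBl.
rewrite sumrB; under [X in _ - X]eq_bigr => m _ do rewrite -mulrA.
rewrite -mulr_sumr (h_contract_up k Ux y0) mulr0 subr0.
have dNk := smooth2_diff2 (N_smooth k i) Ux y0.
rewrite -(euler1 dNk (fun a a0 => N_homo k i Ux y0 a0)) -sumrN.
by apply: eq_bigr => m _; rewrite mulNr mulrC.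
Qed.

(** The y^m-derivative of d_i F = 0, after exchanging derivatives. *)
Lemma dN_llow i m x y : U x -> y != 0 ->
  dN N i (llow F m) x y = - \sum_k pd m (N k i x) y * llow F k x y.
Proof.
move=> Ux y0; have sF := smooth_F hF.
have d1 : differentiable (fun y => pd i (fun z => F z y) x) y.
  exact: (smooth2_diff2 (smooth2_pd1 U_open i sF) Ux y0).
have d2 k : differentiable (N k i x) y by exact: (smooth2_diff2 (N_smooth k i) Ux y0).
have d3 k : differentiable (pd k (F x)) y by exact: (smooth2_diff2 (smooth2_pd U_open k sF) Ux y0).
have d4 k : differentiable (fun y => N k i x y * pd k (F x) y) y by exact: (differentiableM (d2 k) (d3 k)).
have : pd m (fun y => dN N i F x y) y = pd m (fun=> 0) y.
  by apply: (pd_slit_ext m y0) => z z0; exact: dF_eq0.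
rewrite {2}/pd derive_cst /pd (deriveDf _ d1 (differentiable_sumf d4)) (derive_sumf _ d4).
under eq_bigr => k _ do rewrite (deriveMf _ (d2 k) (d3 k)).
rewrite big_split /= addrA => /eqP; rewrite addr_eq0 => /eqP e.
have a1 : pd i (fun z => llow F m z y) x =
    'D_(delta_mx 0 m) (fun y => pd i (fun z => F z y) x) y.
  exact: (pd_pd1 U_open i m sF Ux y0).
have a2 k : pd k (llow F m x) y = 'D_(delta_mx 0 m) (pd k (F x)) y.
  exact: (pd_pd2 U_open k m sF Ux y0).
have e1 : dN N i (llow F m) x y = 'D_(delta_mx 0 m) (fun y => pd i (fun z => F z y) x) y +
    \sum_k N k i x y * 'D_(delta_mx 0 m) (pd k (F x)) y.
  have a3 : \sum_k N k i x y * pd k (llow F m x) y =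
      \sum_k N k i x y * 'D_(delta_mx 0 m) (pd k (F x)) y.
    by apply: eq_bigr => k _; exact: (congr1 (fun t => N k i x y * t) (a2 k)).
  exact: (congr2 (fun s t => s + t) a1 a3).
have a4 : \sum_k pd k (F x) y * 'D_(delta_mx 0 m) (N k i x) y =
    \sum_k pd m (N k i x) y * llow F k x y.
  by apply: eq_bigr => k _; exact: mulrC.
exact: (etrans (etrans e1 e) (congr1 (fun t => - t) a4)).
Qed.

Lemma cov_llow0 i m x y : U x -> y != 0 -> cov_llow F H N i m x y = 0.
Proof.
move=> Ux y0; rewrite /cov_llow (dN_llow i m Ux y0) /T -/(rate H i x).
under [X in _ - X]eq_bigr => a _ do rewrite mulrBl mulNr -mulrA.
by rewrite sumrB sumrN -mulr_sumr (h_contract_low m Ux y0) mulr0 subr0 subrr.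
Qed.

Lemma cov_lup0 i m x y : U x -> y != 0 -> cov_lup F H N i m x y = 0.
Proof.
move=> Ux y0; have F0 := F_neq0 hF Ux y0.
have e1 : \sum_a T F H N m i a x y * lup F a x y = - (N m i x y / F x y).
  rewrite -mulNr -(T_contract m i Ux y0) mulr_suml; apply: eq_bigr => a _.
  by rewrite /lup mulrA.
have dF1 : differentiable (fun z => F z y) x by exact: (smooth2_diff1 (smooth_F hF) Ux y0).
have dV : differentiable (fun z => (F z y)^-1) x by exact: differentiableV.
have e2 : pd i (fun z => lup F m z y) x =
    - (y 0 m / F x y ^+ 2) * pd i (fun z => F z y) x.
  rewrite /pd /lup (deriveZf _ _ dV) (deriveVf _ F0 dF1).
  by move: ('D__ _ _) => D; rewrite mulNr mulrN mulrA mulNr.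
have e3 : \sum_k N k i x y * pd k (lup F m x) y = N m i x y / F x y -
    y 0 m / F x y ^+ 2 * \sum_k N k i x y * llow F k x y.
  under eq_bigr => k _ do rewrite (pd_lup hF k m Ux y0) mulrBr.
  rewrite sumrB; congr (_ - _).
    rewrite -(sum_delta (fun k => N k i x y) m) mulr_suml; apply: eq_bigr => k _.
    by rewrite eq_sym mulrA.
  rewrite mulr_sumr; apply: eq_bigr => k _.
  by move: (N k i x y) (llow F k x y) (F x y) (y 0 m) => a b c d; ring.
rewrite /cov_lup {1}/dN e1 e2 e3; move: (dF_eq0 i Ux y0); rewrite /dN.
rewrite -/(llow F).
have arith (c P S t : R) : P + S = 0 -> - c * P + (t - c * S) + - t = 0.
  move=> PS; have -> : - c * P + (t - c * S) + - t = - c * (P + S) by ring.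
  by rewrite PS mulr0.
exact: arith.
Qed.

Definition dNg i x y (j k : 'I_n) : R := dN N i (g F j k) x y.

Lemma h_row a x y v : \sum_m h F a m x y * v 0 m = v 0 a - lup F a x y * lform F x y v.
Proof.
rewrite /h; under eq_bigr => m _ do rewrite mulrBl.
rewrite sumrB /lform mulr_sumr; congr (_ - _).
  by under eq_bigr => m _ do rewrite mulrC eq_sym; rewrite sum_delta.
by apply: eq_bigr => m _; rewrite mulrA.
Qed.

Lemma T_row a i x y v : \sum_m T F H N a i m x y * v 0 m =
  - Nrow_derive N i x y v 0 a - rate H i x * (v 0 a - lup F a x y * lform F x y v).
Proof.
rewrite -h_row mulr_sumr mxE -sumrN -sumrB; apply: eq_bigr => m _.
rewrite /T -/(rate H i x).
by move: (pd m (N a i x) y) (rate H i x) (h F a m x y) (v 0 m) => p r q s; ring.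
Qed.

Lemma lup_gform x y v : U x -> y != 0 ->
  \sum_a \sum_j lup F a x y * g F a j x y * v 0 j = lform F x y v.
Proof.
move=> Ux y0; rewrite exchange_big; apply: eq_bigr => j _.
rewrite -mulr_suml; congr (_ * _).
apply: (mulfI (F_neq0 hF Ux y0)); rewrite -(g_euler U_open hF j Ux y0) mulr_sumr.
apply: eq_bigr => a _; rewrite /lup.
by rewrite [y 0 a / _]mulrC !mulrA divff ?mul1r// (F_neq0 hF Ux y0).
Qed.

Lemma T_gform i x y v : U x -> y != 0 ->
  \sum_j \sum_m (\sum_a T F H N a i m x y * g F a j x y) * v 0 j * v 0 m =
  - gform F x y (Nrow_derive N i x y v) v
    - rate H i x * (gform F x y v v - lform F x y v ^+ 2).
Proof.
move=> Ux y0.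
transitivity (\sum_a \sum_j (\sum_m T F H N a i m x y * v 0 m) * (g F a j x y * v 0 j)).
  rewrite [RHS]exchange_big; apply: eq_bigr => j _.
  under [RHS]eq_bigr => a _ do rewrite mulr_suml.
  rewrite [RHS]exchange_big; apply: eq_bigr => m _; rewrite !mulr_suml.
  apply: eq_bigr => a _.
  by move: (T _ _ _ _ _ _ _ _) (g _ _ _ _ _) (v 0 j) (v 0 m) => p q r s; ring.
transitivity (\sum_a \sum_j (- (g F a j x y * Nrow_derive N i x y v 0 a * v 0 j)
   - rate H i x * (g F a j x y * v 0 a * v 0 j
        - lform F x y v * (lup F a x y * g F a j x y * v 0 j)))).
  apply: eq_bigr => a _; apply: eq_bigr => j _; rewrite T_row.
  by move: (g F a j x y) (Nrow_derive _ _ _ _ _ 0 a) (v 0 j) (rate H i x) (v 0 a) (lup _ _ _ _)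
    (lform _ _ _ _) => p q r s t u w; ring.
under eq_bigr => a _ do rewrite sumrB sumrN -mulr_sumr sumrB -mulr_sumr.
rewrite sumrB sumrN -mulr_sumr sumrB -mulr_sumr (lup_gform v Ux y0).
by rewrite -/(gform F x y (Nrow_derive N i x y v) v) -/(gform F x y v v) expr2.
Qed.

(** The H-part of the quadratic form reproduces the numerator of the angular
    metric because T contains the angular projection h. *)
Lemma cov_g_quad i x y v : U x -> y != 0 -> quad (fun j m => cov_g F H N i j m x y) v =
  quad (dNg i x y) v + 2 * gform F x y (Nrow_derive N i x y v) v
    + 2 * rate H i x * (gform F x y v v - lform F x y v ^+ 2).
Proof.
move=> Ux y0; have e := T_gform i v Ux y0.
have e2 : \sum_j \sum_m (\sum_a T F H N a i j x y * g F a m x y) * v 0 j * v 0 m =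
    \sum_j \sum_m (\sum_a T F H N a i m x y * g F a j x y) * v 0 j * v 0 m.
  rewrite [LHS]exchange_big; apply: eq_bigr => j _; apply: eq_bigr => m _.
  exact: mulrAC.
transitivity (quad (dNg i x y) v
  - \sum_j \sum_m (\sum_a T F H N a i m x y * g F a j x y) * v 0 j * v 0 m
  - \sum_j \sum_m (\sum_a T F H N a i j x y * g F a m x y) * v 0 j * v 0 m).
  rewrite /quad -!sumrB; apply: eq_bigr => j _; rewrite -!sumrB; apply: eq_bigr => m _.
  by rewrite -!mulrBl.
have arith (a b c d r s t : R) : t = s -> s = - b - r * (c - d ^+ 2) ->
  a - s - t = a + 2 * b + 2 * r * (c - d ^+ 2) by move=> -> ->; ring.
exact: (arith _ _ _ _ _ _ _ e2 e).
Qed.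

(** * The covariant derivative of the metric *)

(** The contraction N^a_ij l_a, equal to - d_i l_j when d_i F = 0. *)
Definition llow_defect i j x y : R := \sum_a pd j (N a i x) y * llow F a x y.

Lemma dN_angular_coef i j k x y : U x -> y != 0 ->
  dN N i (angular_coef F j k) x y = (F x y ^+ 2)^-1 *
    (dN N i (g F j k) x y + llow_defect i j x y * llow F k x y
      + llow F j x y * llow_defect i k x y).
Proof.
move=> Ux y0.
pose X : E * E := (delta_mx 0 i, Nrow N i x y).
have sF := smooth_F hF.
have dg := smooth2_diff (smooth_g U_open hF j k) Ux y0.
have dl a := smooth2_diff (smooth_llow U_open hF a) Ux y0.
have dF := smooth2_diff sF Ux y0.
have F20 : F x y ^+ 2 != 0 by rewrite expf_neq0// (F_neq0 hF).
have eg : 'D_X (uncur (g F j k)) (x, y) = dN N i (g F j k) x y.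
  exact: (dN_directional N i (smooth_g U_open hF j k) Ux y0).
have el a : 'D_X (uncur (llow F a)) (x, y) = - llow_defect i a x y.
  rewrite -(dN_llow i a Ux y0).
  exact: (dN_directional N i (smooth_llow U_open hF a) Ux y0).
have eF : 'D_X (uncur F) (x, y) = 0.
  by rewrite -(dF_eq0 i Ux y0); exact: (dN_directional N i sF Ux y0).
have dF2 : differentiable (fun z => uncur F z ^+ 2) (x, y).
  exact: (smooth2_diff (smooth_F2 U_open hF) Ux y0).
have eF2 : 'D_X (fun z => uncur F z ^+ 2) (x, y) = 0.
  by rewrite (deriveX2f X dF) eF mulr0.
have dV : differentiable (fun z => (uncur F z ^+ 2)^-1) (x, y).
  by apply: (differentiableV dF2); exact: F20.
have eV : 'D_X (fun z => (uncur F z ^+ 2)^-1) (x, y) = 0.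
  by rewrite (@deriveVf R _ (fun z => uncur F z ^+ 2) (x, y) X F20 dF2) eF2 mulr0.
have dll : differentiable (fun z => uncur (llow F j) z * uncur (llow F k) z) (x, y).
  exact: (differentiableM (dl j) (dl k)).
have dgl : differentiable (fun z => uncur (g F j k) z -
    uncur (llow F j) z * uncur (llow F k) z) (x, y).
  exact: (differentiableB dg dll).
have := deriveMf X dgl dV.
rewrite eV (deriveBf X dg dll) (deriveMf X (dl j) (dl k)) eg !el => e.
rewrite -(dN_directional N i (smooth_angular_coef U_open hF j k) Ux y0).
apply: (etrans e); rewrite /uncur /=.
move: (llow_defect i j x y) (llow_defect i k x y) (dN _ _ _ _ _) => a b c.
by move: (llow F j x y) (llow F k x y) (F x y) (g F j k x y) => p q f G; ring.
Qed.

Lemma lform_Nrow_derive i x y v : lform F x y (Nrow_derive N i x y v) = \sum_j llow_defect i j x y * v 0 j.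
Proof.
rewrite /lform /llow_defect.
under eq_bigr => a _ do rewrite mxE mulr_sumr.
under [RHS]eq_bigr => j _ do rewrite mulr_suml.
rewrite [RHS]exchange_big; apply: eq_bigr => a _; apply: eq_bigr => j _.
by move: (llow F a x y) (v 0 j) (pd j (N a i x) y) => p q r; ring.
Qed.

(** The terms with derivatives of l cancel against the action of N on l(v),
    because d_i l_j = - N^a_ij l_a. *)
Lemma angular_lieE i x y v : U x -> y != 0 ->
  angular_lie F N i x y v (Nrow_derive N i x y v) + 2 * rate H i x * angular F x y v =
  (F x y ^+ 2)^-1 * quad (fun j m => cov_g F H N i j m x y) v.
Proof.
move=> Ux y0; rewrite (cov_g_quad i v Ux y0) /angular.
have e : angular_lie F N i x y v (Nrow_derive N i x y v) = (F x y ^+ 2)^-1 *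
    (quad (dNg i x y) v + 2 * gform F x y (Nrow_derive N i x y v) v).
  set M := Nrow_derive N i x y v; set Fi := (F x y ^+ 2)^-1.
  transitivity (\sum_j \sum_k Fi * (dNg i x y j k * v 0 j * v 0 k +
    (llow_defect i j x y * v 0 j) * (llow F k x y * v 0 k) +
    (llow F j x y * v 0 j) * (llow_defect i k x y * v 0 k) +
    g F j k x y * M 0 j * v 0 k + g F j k x y * v 0 j * M 0 k -
    (llow F j x y * M 0 j) * (llow F k x y * v 0 k) -
    (llow F j x y * v 0 j) * (llow F k x y * M 0 k))).
    apply: eq_bigr => j _; apply: eq_bigr => k _.
    rewrite (dN_angular_coef i j k Ux y0) /angular_coef -/Fi /dNg.
    move: (llow_defect i j x y) (llow_defect i k x y) (dN _ _ _ _ _) (M 0 j) (M 0 k) Fi.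
    move=> a b c d e f.
    by move: (llow F j x y) (llow F k x y) (v 0 j) (v 0 k) (g F j k x y) => p q r s G; ring.
  under eq_bigr => j _ do rewrite -mulr_sumr !sumrB !big_split /=.
  rewrite -mulr_sumr !sumrB !big_split /= -!big_distrlr /=.
  rewrite -(lform_Nrow_derive i x y v) -/M -/(lform F x y v) -/(lform F x y M).
  rewrite -/(gform F x y M v) -/(gform F x y v M) -/(quad (dNg i x y) v).
  rewrite (gform_sym U_open hF v M Ux y0).
  move: (quad _ _) (gform _ _ _ _ _) (lform F x y M) (lform F x y v) Fi => a b c d f.
  by ring.
rewrite e.
move: (quad _ _) (gform F x y v v) (gform _ _ _ _ _) (lform F x y v) (F x y) (rate H i x).
by move=> a b c d f r; ring.
Qed.

(** The angular metric is the squared g-length of [ddirection], whose kernel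
    is spanned by y. *)
Lemma angular_eq0 x y v : U x -> y != 0 -> angular F x y v = 0 -> exists s : R, v = s *: y.
Proof.
move=> Ux y0; rewrite -(gform_ddirection U_open hF v Ux y0) => /(gform_eq0 hF Ux y0).
rewrite (ddirectionE hF v Ux y0) => /eqP; rewrite scaler_eq0 invr_eq0.
rewrite (negPf (F_neq0 hF Ux y0)) /= subr_eq0 => /eqP ->.
by exists (lform F x y v / F x y).
Qed.

Lemma angular_neq0 x y : (1 < n)%N -> U x -> y != 0 -> exists w, angular F x y w != 0.
Proof.
move=> n1 Ux y0; apply: contrapT => H0.
have par k : exists s : R, (delta_mx 0 k : E) = s *: y.
  apply: (angular_eq0 Ux y0); apply/eqP/negPn/negP => h.
  by apply: H0; exists (delta_mx 0 k).
have [j yj] : exists j, y 0 j != 0.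
  apply: contrapT => y0'; move/eqP: y0; apply; apply/rowP => j; rewrite mxE.
  by apply/eqP/negPn/negP => yj; apply: y0'; exists j.
have [k kj] : exists k : 'I_n, k != j.
  have n0 : (0 < n)%N by exact: ltnW.
  have [->|j0] := eqVneq j (Ordinal n0); last by exists (Ordinal n0); rewrite eq_sym.
  by exists (Ordinal n1).
have [s /rowP es] := par k.
have := es j; rewrite !mxE eqxx eq_sym (negPf kj) /= => /esym/eqP.
rewrite mulf_eq0 (negPf yj) orbF => /eqP s0.
by have := es k; rewrite !mxE !eqxx s0 mul0r => /eqP; rewrite oner_eq0.
Qed.

(** If v is a multiple of y, choose w that is not: then w, v + w and v - w are
    no multiples of y, and the parallelogram law applies. *)
Lemma quad_vanishes (b : 'I_n -> 'I_n -> R) x y : (1 < n)%N -> U x -> y != 0 ->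
  (forall v, angular F x y v != 0 -> quad b v = 0) -> forall v, quad b v = 0.
Proof.
move=> n1 Ux y0 Hb v; have [|] := eqVneq (angular F x y v) 0; last exact: Hb.
move=> /(angular_eq0 Ux y0)[s vE].
have [w w0] := angular_neq0 n1 Ux y0.
have npar (t : R) : t != 0 -> angular F x y (v + t *: w) != 0.
  move=> t0; apply/negP => /eqP/(angular_eq0 Ux y0)[s' e].
  move: w0; suff -> : w = (t^-1 * (s' - s)) *: y.
    by rewrite (angular_parallel U_open hF _ Ux y0) eqxx.
  by rewrite -scalerA scalerBl -e -vE addrC addKr scalerA mulVf// scale1r.
have e1 : quad b (v + w) = 0 by apply: Hb; rewrite -[w]scale1r; exact: npar (oner_neq0 _).
have e2 : quad b (v - w) = 0.
  by apply: Hb; rewrite -scaleN1r; apply: npar; rewrite oppr_eq0 oner_neq0.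
have := quad_parallelogram b v w.
rewrite e1 e2 (Hb w w0) mulr0 !addr0 => /esym/eqP.
by rewrite mulf_eq0 pnatr_eq0 /= => /eqP.
Qed.

Lemma cov_g_sym i j m x y : U x -> y != 0 ->
  cov_g F H N i j m x y = cov_g F H N i m j x y.
Proof.
move=> Ux y0; rewrite /cov_g.
have e : dN N i (g F j m) x y = dN N i (g F m j) x y.
  rewrite /dN; have e1 : pd i (fun z => g F j m z y) x = pd i (fun z => g F m j z y) x.
    rewrite /pd; apply: near_eq_derive.
    by apply: (near_open U_open Ux) => z Uz; exact: (g_sym U_open hF j m Uz y0).
  have e2 k : pd k (g F j m x) y = pd k (g F m j x) y by exact: (dg_sym23 U_open hF k j m Ux y0).
  apply: (congr2 (fun s t => s + t) e1); apply: eq_bigr => k _.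
  exact: (congr1 (fun t => N k i x y * t) (e2 k)).
exact: (etrans (addrAC _ _ _) (congr1 (fun t => t - _ - _) e)).
Qed.

End CovariantDerivatives.

Theorem mainTheorem4 (R : realType) (n : nat) (n_ge3 : (3 <= n)%N)
  (U : set 'rV[R]_n) (U_open : open U)
  (F : 'rV[R]_n -> 'rV[R]_n -> R) (F_finsler : finsler U F)
  (H : 'rV[R]_n -> R) (H_smooth : smooth_on U H)
  (H_gt0 : forall x, U x -> 0 < H x)
  (N : 'I_n -> 'I_n -> 'rV[R]_n -> 'rV[R]_n -> R)
  (N_smooth : forall k i, smooth_on (slit U) (fun z => N k i z.1 z.2))
  (N_homo : forall k i x y (a : R), U x -> y != 0 -> 0 < a ->
     N k i x (a *: y) = a * N k i x y)
  (angle_pde : forall x y1 y2, U x -> y1 != 0 -> y2 != 0 ->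
     direction F x y1 != direction F x y2 ->
     joining_arc_well_defined F x y1 y2 ->
     differentiable
       (fun z : 'rV[R]_n * ('rV[R]_n * 'rV[R]_n) => angle F z.1 z.2.1 z.2.2)
       (x, (y1, y2)) /\
     forall i, angle_equation F H N i x y1 y2)
  (dF_eq0 : forall i x y, U x -> y != 0 -> dN N i F x y = 0) :
  forall x y, U x -> y != 0 ->
    (forall k i, \sum_m T F H N k i m x y * y 0 m = - N k i x y) /\
    [/\ forall i, cov_F F N i x y = 0,
        forall i m, cov_llow F H N i m x y = 0,
        forall i m, cov_lup F H N i m x y = 0
      & forall i j m, cov_g F H N i j m x y = 0].
Proof.
move=> x y Ux y0.
have N_smooth2 : forall k i, smooth2 U (N k i) by exact: N_smooth.
split; first by move=> k i; exact: (T_contract F_finsler H N_smooth2 N_homo k i Ux y0).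
split=> [i|i m|i m|i].
- exact: dF_eq0.
- exact: (cov_llow0 U_open F_finsler H N_smooth2 dF_eq0 i m Ux y0).
- exact: (cov_lup0 F_finsler H N_smooth2 N_homo dF_eq0 i m Ux y0).
apply: quad_polarization; first by move=> j k; exact: (cov_g_sym U_open F_finsler H N i j k Ux y0).
apply: (quad_vanishes U_open F_finsler (ltnW n_ge3) Ux y0) => v v0.
have := angular_transport U_open F_finsler H_smooth H_gt0 N_smooth2 angle_pde i Ux y0 v0.
rewrite (angular_lieE U_open F_finsler H N_smooth2 dF_eq0 i v Ux y0).
move=> /eqP; rewrite mulf_eq0 invr_eq0 expf_eq0 /= (negPf (F_neq0 F_finsler Ux y0)).
by move=> /eqP.
Qed.
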